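(* Let assumptions (H1)-(H5) (listed in the context) hold, let $u^*=\{u^*(k),k\in\mathcal T\}$ be an optimal control and let $x^*_\gamma=\{x^*_\gamma(k)\}_{k=0}^N$ be the corresponding optimal state process. Then there exist a probability measure $\lambda^*\in\Lambda^{u^*}$ and a solution $(P_\gamma,Q_\gamma)$ of the adjoint equation (given in the context) such that for any $u\in U_k$ and $k\in\mathcal T$, $$\int_\Gamma\big\langle\partial_u\mathscr H_\gamma(k,x^*_\gamma(k),u^*(k),P_\gamma(k),Q_\gamma(k)),\,u-u^*(k)\big\rangle\,\lambda^*(d\gamma)\ \ge\ 0,\qquad \mathbb P\text{-a.s.}$$
   Context: Probabilistic setting. $N>0$ is a fixed integer, $\mathcal T=\{0,\dots,N-1\}$. On a complete probability space $(\Omega,\mathcal F,\mathbb P)$, $B(1),\dots,B(N)$ are independent $\mathbb R^d$-valued random variables (components $B^i(k)$) with $\mathbb E[|B(k)|^p]\le C(p)<\infty$ for some $p\ge2$. $\mathcal F_0=\{\emptyset,\Omega\}$, $\mathcal F_k=\sigma(B(1),\dots,B(k))$. $U_0,\dots,U_{N-1}$ are nonempty convex subsets of $\mathbb R^m$. An admissible control is $u=\{u(k)\}_{k\in\mathcal T}$ with $u(k)$ $\mathcal F_k$-measurable, $U_k$-valued, and $\mathbb E[\sum_{k=0}^{N-1}|u(k)|^q]<\infty$ with some (fixed) $q>2$; $\mathcal U$ is the set of admissible controls. Model uncertainty. $\Gamma$ is a locally compact Polish space with distance $\widetilde d$ and Borel $\sigma$-field $\mathcal B(\Gamma)$; $\Lambda$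 is a set of probability measures on $(\Gamma,\mathcal B(\Gamma))$. For each $\gamma\in\Gamma$, $k\in\mathcal T$: $b_\gamma(k,\cdot,\cdot):\mathbb R^n\times U_k\to\mathbb R^n$, $\sigma_\gamma(k,\cdot,\cdot):\mathbb R^n\times U_k\to\mathbb R^{n\times d}$ (columns $\sigma^i_\gamma$), $f_\gamma(k,\cdot,\cdot):\mathbb R^n\times U_k\to\mathbb R$, $\phi_\gamma:\mathbb R^n\to\mathbb R$ are given continuous functions. $\partial_x,\partial_u$ denote Jacobians (row vectors for scalar functions; inside an inner product, $\partial_u\mathscr H$ is read as a vector in $\mathbb R^m$). State and cost. For $u\in\mathcal U$ and fixed $x_0\in\mathbb R^n$: $x_\gamma(0)=x_0$ and $$x_\gamma(k+1)=b_\gamma(k,x_\gamma(k),u(k))+\sigma_\gamma(k,x_\gamma(k),u(k))B(k+1),\quad k\in\mathcal T;$$ $y_\gamma(0)=\mathbb E\big[\sum_{k=0}^{N-1}f_\gamma(k,x_\gamma(k),u(k))+\phi_\gamma(x_\gamma(N))\big]$ and $J(u)=\sup_{\lambda\in\Lambda}\int_\Gamma y_\gamma(0)\,\lambda(d\gamma)$. A control $u^*\in\mathcal U$ is optimal if it minimizes $J$ over $\mathcal U$. Let $x^*_\gamma$, $y^*_\gamma(0)$ be the state and value associated with $u^*$. $\Lambda^{u^*}=\{\lambda\in\Lambda: J(u^* )=\int_\Gamma y^*_\gamma(0)\lambda(d\gamma)\}$. Assumptions. A modulus of continuity is a continuous, semiadditive (i.e. subadditive), nondecreasing $\psi:[0,\infty)\to[0,\infty)$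 with $\psi(0)=0$. (H1) There is a constant $L>0$ such that for each $k\in\mathcal T$, $\gamma\in\Gamma$: $|b_\gamma(k,0,0)|+|\sigma_\gamma(k,0,0)|\le L$, and $b_\gamma(k,x,u),\sigma_\gamma(k,x,u)$ are continuously differentiable in $(x,u)$ with derivatives bounded by $L$. (H2) For each $k\in\mathcal T$, $\gamma\in\Gamma$: $f_\gamma(k,x,u),\phi_\gamma(x)$ are continuously differentiable in $(x,u)$ with derivatives bounded by $L(1+|x|+|u|)$, and $|f_\gamma(k,0,0)|\le L$. (H3) There is a modulus of continuity $\psi$ with $|\chi_\gamma(k,x,u)-\chi_\gamma(k,x',u')|\le\psi(|x-x'|+|u-u'|)$ for all $k\in\mathcal T$, $x,x'\in\mathbb R^n$, $u,u'\in U_k$, $\gamma\in\Gamma$, where $\chi_\gamma$ is any of the derivatives in (H1), (H2). (H4) For each $R>0$ there is a modulus of continuity $\psi_R$ with $|\chi_\gamma(k,x,u)-\chi_{\gamma'}(k,x,u)|\le\psi_R(\widetilde d(\gamma,\gamma'))$ for all $k\in\mathcal T$, $|x|,|u|\le R$, $\gamma,\gamma'\in\Gamma$, where $\chi_\gamma$ is any of $b_\gamma,\sigma_\gamma,f_\gamma,\phi_\gamma$ and their derivatives in $(x,u)$. (H5) $\Lambda$ is a weakly compact and convex set of probability measures on $(\Gamma,\mathcal B(\Gamma))$. Adjoint equation. A superscript $*$ on a coefficient denotes evaluation along $u^*$: $b^*_\gamma(k)=b_\gamma(k,x^*_\gamma(k),u^*(k))$, $\phi^*_\gamma(N)=\phi_\gamma(x^*_\gamma(N))$,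 etc., similarly for derivatives. For each $\gamma$, $P_\gamma(k)\in\mathbb R^n$ and $Q_\gamma(k)\in\mathbb R^{n\times d}$ (columns $Q^i_\gamma(k)$), $k\in\mathcal T$, satisfy $$P_\gamma(N-1)=\mathbb E[(\partial_x\phi^*_\gamma(N))^\top\mid\mathcal F_{N-1}],\quad Q_\gamma(N-1)=\mathbb E[(\partial_x\phi^*_\gamma(N))^\top B(N)^\top\mid\mathcal F_{N-1}],$$ and for $k=0,\dots,N-2$, with $Z_\gamma(k+1)=(\partial_xb^*_\gamma(k+1))^\top P_\gamma(k+1)+\sum_{i=1}^d(\partial_x\sigma^{*,i}_\gamma(k+1))^\top Q^i_\gamma(k+1)+(\partial_xf^*_\gamma(k+1))^\top$, $$P_\gamma(k)=\mathbb E[Z_\gamma(k+1)\mid\mathcal F_k],\qquad Q_\gamma(k)=\mathbb E[Z_\gamma(k+1)B(k+1)^\top\mid\mathcal F_k].$$ Hamiltonian: for $k\in\mathcal T$, $p\in\mathbb R^n$, $r\in\mathbb R^{n\times d}$ with columns $r^i$, $$\mathscr H_\gamma(k,x,u,p,r)=f_\gamma(k,x,u)+\langle p,b_\gamma(k,x,u)\rangle+\sum_{i=1}^d\langle r^i,\sigma^i_\gamma(k,x,u)\rangle.$$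
   Formalization: Adds to (H2) the bound |φ_γ(0)| ≤ L for all γ, without which the supremum defining J may not be attained on Λ and Λ^{u*} may be empty; Λ is taken nonempty. *)

(* Defs.v *)
From HB Require Import structures.
From mathcomp Require Import all_boot all_order all_algebra.
From mathcomp Require Import all_classical all_reals all_analysis.

Set Implicit Arguments.
Unset Strict Implicit.
Unset Printing Implicit Defensive.

Import Order.TTheory GRing.Theory Num.Theory.
Import numFieldNormedType.Exports.

Local Open Scope classical_set_scope.
Local Open Scope ring_scope.

(** The library norm on matrices is the sup norm; [enorm]
    is the Euclidean norm of vectors and the Frobenius norm of matrices. *)
Definition enorm {R : realType} {a c : nat} (A : 'M[R]_(a, c)) : R :=
  Num.sqrt (\sum_i \sum_j A i j ^+ 2).

Definition inner {R : realType} {a : nat} (x y : 'cV[R]_a) : R :=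
  \sum_i x i 0 * y i 0.

Definition modulus {R : realType} (psi : R -> R) : Prop :=
  [/\ {within [set t | 0 <= t], continuous psi},
      forall s t, 0 <= s -> 0 <= t -> psi (s + t) <= psi s + psi t,
      forall s t, 0 <= s -> s <= t -> psi s <= psi t,
      forall t, 0 <= t -> 0 <= psi t &
      psi 0 = 0].

(** Differentiability relative to a set [D] that need not be open: increments
    are restricted to [D]. The library's ['d] and [differentiable] only speak
    of full neighbourhoods. At interior points of [D] (more generally, when the
    directions of [D] at [z] span the space) [J] is unique and is the usual
    Jacobian. *)
Definition is_jacobian {R : realType} {l r : nat} (D : set 'cV[R]_l)
    (g : 'cV[R]_l -> 'cV[R]_r) (z : 'cV[R]_l) (J : 'M[R]_(r, l)) : Prop :=
  forall e : R, 0 < e -> exists2 delta : R, 0 < delta &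
    forall z', D z' -> enorm (z' - z) < delta ->
      enorm (g z' - g z - J *m (z' - z)) <= e * enorm (z' - z).

Definition C1_on {R : realType} {l r : nat} (D : set 'cV[R]_l)
    (g : 'cV[R]_l -> 'cV[R]_r) (J : 'cV[R]_l -> 'M[R]_(r, l)) : Prop :=
  (forall z, D z -> is_jacobian D g z (J z)) /\ {within D, continuous J}.

(** A function of (x, u) as a function of the stacked vector [col_mx x u]; its
    Jacobian is [row_mx] of the partial Jacobians in x and u. *)
Definition stacked {R : realType} {T : Type} {n m : nat}
    (g : 'cV[R]_n -> 'cV[R]_m -> T) (z : 'cV[R]_(n + m)) : T :=
  g (usubmx z) (dsubmx z).

#[short(type="pmetricType")]
HB.structure Definition PointedMetric (K : numDomainType) :=
  {M of Pointed M & Metric K M}.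

(** The given distance [mdist] of a [pmetricType] generates the topology but is
    not itself required to be complete. *)
Definition completely_metrizable (R : realType) (T : topologicalType) : Prop :=
  exists dist : T -> T -> R,
    [/\ forall x y, dist x y = 0 <-> x = y,
        forall x y, dist x y = dist y x,
        forall x y z, dist x z <= dist x y + dist y z,
        forall x (A : set T), nbhs x A <->
          exists2 e : R, 0 < e & [set y | dist x y < e] `<=` A &
        forall s : nat -> T,
          (forall e : R, 0 < e -> exists n0 : nat, forall i j : nat,
             (n0 <= i)%N -> (n0 <= j)%N -> dist (s i) (s j) < e) ->
          exists l : T, s @ \oo --> l].

Definition polish (R : realType) (T : topologicalType) : Prop :=
  (exists2 A : set T, countable A & dense A) /\ completely_metrizable R T.

Definition borel {R : realType} (Gamma : pmetricType R) :=
  g_sigma_algebraType (@open Gamma).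

Definition bounded_continuous {R : realType} (Gamma : pmetricType R) : Type :=
  {h : Gamma -> R | continuous h /\ exists M : R, forall g, `|h g| <= M}.

Definition weak_pairing {R : realType} {Gamma : pmetricType R}
    (lam : probability (borel Gamma) R) :
    {ptws bounded_continuous Gamma -> R} :=
  fun h => (\int[lam]_(g in [set: borel Gamma]) sval h g)%R.

(** Probability measures with the weak topology: the coarsest one making
    lam |-> \int h dlam continuous for each bounded continuous h. *)
Notation weak_probability Gamma := (initial_topology (@weak_pairing _ Gamma)).

Definition weakly_compact {R : realType} {Gamma : pmetricType R}
    (Lam : set (probability (borel Gamma) R)) : Prop :=
  compact (Lam : set (weak_probability Gamma)).

Definition convex_probabilities {R : realType} {Gamma : pmetricType R}
    (Lam : set (probability (borel Gamma) R)) : Prop :=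
  forall (lam1 lam2 lam : probability (borel Gamma) R) (t : R),
    Lam lam1 -> Lam lam2 -> 0 <= t <= 1 ->
    (forall A : set (borel Gamma), measurable A ->
       lam A = (t%:E * lam1 A + (1 - t)%:E * lam2 A)%E) ->
    Lam lam.

Section Probability.
Context {R : realType} {dO : measure_display} {Omega : measurableType dO}.
Variable P : probability Omega R.

Definition vec_events {d : nat} (X : Omega -> 'cV[R]_d) : set (set Omega) :=
  [set A | exists (i : 'I_d) (Y : set R),
             measurable Y /\ A = (fun w => X w i 0) @^-1` Y].

Definition random_vector {d : nat} (X : Omega -> 'cV[R]_d) : Prop :=
  forall i, measurable_fun setT (fun w => X w i 0).

Definition independent_vectors {d : nat} (N : nat)
    (B : nat -> Omega -> 'cV[R]_d) : Prop :=
  forall (J : {set 'I_N}) (A : 'I_N -> set Omega),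
    (forall k : 'I_N, <<s vec_events (B k.+1) >> (A k)) ->
    P (\big[setI/setT]_(k in J) A k) = (\prod_(k in J) P (A k))%E.

(** The index j starts at 1, so F_0 is the trivial sigma-algebra. *)
Definition filtration {d : nat} (B : nat -> Omega -> 'cV[R]_d) (k : nat) :
    set (set Omega) :=
  <<s \bigcup_(j in [set j | (0 < j <= k)%N]) vec_events (B j) >>.

Definition adapted_to {a c : nat} (G : set (set Omega))
    (X : Omega -> 'M[R]_(a, c)) : Prop :=
  forall i j (Y : set R), measurable Y -> G ((fun w => X w i j) @^-1` Y).

(** [Y] is a version of the (entrywise) conditional expectation E[X | G]. *)
Definition is_condexp {a c : nat} (G : set (set Omega))
    (X Y : Omega -> 'M[R]_(a, c)) : Prop :=
  adapted_to G Y /\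
  forall i j,
    [/\ P.-integrable setT (fun w => (X w i j)%:E),
        P.-integrable setT (fun w => (Y w i j)%:E) &
        forall A, G A ->
          (\int[P]_(w in A) (Y w i j)%:E = \int[P]_(w in A) (X w i j)%:E)%E].

Definition admissible {d m : nat} (N : nat) (B : nat -> Omega -> 'cV[R]_d)
    (q : R) (U : nat -> set 'cV[R]_m) : set (nat -> Omega -> 'cV[R]_m) :=
  [set u | [/\ forall k, (k < N)%N -> adapted_to (filtration B k) (u k),
               forall k, (k < N)%N -> forall w, U k (u k w) &
               ('E_P[(fun w => \sum_(k < N) enorm (u k w) `^ q)%R] < +oo)%E]].

End Probability.

(** Times are natural numbers,
    of which only 0, ..., N-1 matter; likewise only the control values in U_k
    matter. [csx i], [csu i] are the Jacobians of the i-th column of [cs]. *)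
Record coefficients (R : realType) (Gamma : Type) (n m d : nat) := Coefficients {
  cb   : Gamma -> nat -> 'cV[R]_n -> 'cV[R]_m -> 'cV[R]_n ;
  cs   : Gamma -> nat -> 'cV[R]_n -> 'cV[R]_m -> 'M[R]_(n, d) ;
  cf   : Gamma -> nat -> 'cV[R]_n -> 'cV[R]_m -> R ;
  cphi : Gamma -> 'cV[R]_n -> R ;
  cbx  : Gamma -> nat -> 'cV[R]_n -> 'cV[R]_m -> 'M[R]_(n, n) ;
  cbu  : Gamma -> nat -> 'cV[R]_n -> 'cV[R]_m -> 'M[R]_(n, m) ;
  csx  : 'I_d -> Gamma -> nat -> 'cV[R]_n -> 'cV[R]_m -> 'M[R]_(n, n) ;
  csu  : 'I_d -> Gamma -> nat -> 'cV[R]_n -> 'cV[R]_m -> 'M[R]_(n, m) ;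
  cfx  : Gamma -> nat -> 'cV[R]_n -> 'cV[R]_m -> 'rV[R]_n ;
  cfu  : Gamma -> nat -> 'cV[R]_n -> 'cV[R]_m -> 'rV[R]_m ;
  cphix : Gamma -> 'cV[R]_n -> 'rV[R]_n }.

Section Assumptions.
Context {R : realType} {Gamma : pmetricType R} {n m d : nat}.
Variables (c : coefficients R Gamma n m d) (N : nat) (U : nat -> set 'cV[R]_m).

Definition C1_xu {r : nat} (k : nat) (g : 'cV[R]_n -> 'cV[R]_m -> 'cV[R]_r)
    (gx : 'cV[R]_n -> 'cV[R]_m -> 'M[R]_(r, n))
    (gu : 'cV[R]_n -> 'cV[R]_m -> 'M[R]_(r, m)) : Prop :=
  C1_on [set z | U k (dsubmx z)] (stacked g)
    (stacked (fun x u => row_mx (gx x u) (gu x u))).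

(** The coefficients are only meaningful for controls in U_k, so a bound at
    u = 0 makes sense only if 0 belongs to U_k. The bounds at the origin are
    therefore taken at (0, v k) with v k an arbitrary reference point of U_k;
    when 0 is in U_k one may take v k = 0. *)
Definition H1 (L : R) (v : nat -> 'cV[R]_m) : Prop :=
  forall k, (k < N)%N -> forall g,
    enorm (cb c g k 0 (v k)) + enorm (cs c g k 0 (v k)) <= L
    /\ C1_xu k (cb c g k) (cbx c g k) (cbu c g k)
    /\ (forall i, C1_xu k (fun x u => col i (cs c g k x u))
                    (csx c i g k) (csu c i g k))
    /\ (forall x u, U k u ->
          [/\ enorm (cbx c g k x u) <= L, enorm (cbu c g k x u) <= L,
              forall i, enorm (csx c i g k x u) <= L &
              forall i, enorm (csu c i g k x u) <= L]).

Definition H2 (L : R) (v : nat -> 'cV[R]_m) : Prop :=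
  (forall k, (k < N)%N -> forall g,
     `|cf c g k 0 (v k)| <= L
     /\ C1_xu k (fun x u => (cf c g k x u)%:M) (cfx c g k) (cfu c g k)
     /\ (forall x u, U k u ->
           enorm (cfx c g k x u) <= L * (1 + enorm x + enorm u)
           /\ enorm (cfu c g k x u) <= L * (1 + enorm x + enorm u)))
  /\ (forall g,
     C1_on setT (fun x => (cphi c g x)%:M) (cphix c g)
     /\ (forall x, enorm (cphix c g x) <= L * (1 + enorm x))).

Definition H3 : Prop :=
  exists2 psi : R -> R, modulus psi &
    forall g,
    (forall k x x' u u', (k < N)%N -> U k u -> U k u' ->
       let r := psi (enorm (x - x') + enorm (u - u')) in
       enorm (cbx c g k x u - cbx c g k x' u') <= r
       /\ enorm (cbu c g k x u - cbu c g k x' u') <= r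
       /\ (forall i, enorm (csx c i g k x u - csx c i g k x' u') <= r)
       /\ (forall i, enorm (csu c i g k x u - csu c i g k x' u') <= r)
       /\ enorm (cfx c g k x u - cfx c g k x' u') <= r
       /\ enorm (cfu c g k x u - cfu c g k x' u') <= r)
    /\ (forall x x', enorm (cphix c g x - cphix c g x') <= psi (enorm (x - x'))).

Definition H4 : Prop :=
  forall rho : R, 0 < rho ->
  exists2 psi : R -> R, modulus psi &
    forall g g', let r := psi (mdist g g') in
    (forall k x u, (k < N)%N -> U k u -> enorm x <= rho -> enorm u <= rho ->
       enorm (cb c g k x u - cb c g' k x u) <= r
       /\ enorm (cs c g k x u - cs c g' k x u) <= r
       /\ `|cf c g k x u - cf c g' k x u| <= r
       /\ enorm (cbx c g k x u - cbx c g' k x u) <= r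
       /\ enorm (cbu c g k x u - cbu c g' k x u) <= r
       /\ (forall i, enorm (csx c i g k x u - csx c i g' k x u) <= r)
       /\ (forall i, enorm (csu c i g k x u - csu c i g' k x u) <= r)
       /\ enorm (cfx c g k x u - cfx c g' k x u) <= r
       /\ enorm (cfu c g k x u - cfu c g' k x u) <= r)
    /\ (forall x, enorm x <= rho ->
       `|cphi c g x - cphi c g' x| <= r
       /\ enorm (cphix c g x - cphix c g' x) <= r).

(** If Lam were empty, the cost would be -oo and no lambda* could exist. *)
Definition H5 (Lam : set (probability (borel Gamma) R)) : Prop :=
  [/\ Lam !=set0, weakly_compact Lam & convex_probabilities Lam].

Definition hamiltonian (g : Gamma) (k : nat) (x : 'cV[R]_n) (u : 'cV[R]_m)
    (p : 'cV[R]_n) (r : 'M[R]_(n, d)) : R :=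
  cf c g k x u + inner p (cb c g k x u)
  + \sum_i inner (col i r) (col i (cs c g k x u)).

(** The partial Jacobian in u of the Hamiltonian; see [hamiltonian_uP]. *)
Definition hamiltonian_u (g : Gamma) (k : nat) (x : 'cV[R]_n) (u : 'cV[R]_m)
    (p : 'cV[R]_n) (r : 'M[R]_(n, d)) : 'rV[R]_m :=
  cfu c g k x u + p^T *m cbu c g k x u
  + \sum_i (col i r)^T *m csu c i g k x u.

End Assumptions.

Section Control.
Context {R : realType} {Gamma : pmetricType R} {n m d : nat}.
Context {dO : measure_display} {Omega : measurableType dO}.
Variables (P : probability Omega R) (c : coefficients R Gamma n m d) (N : nat).
Variables (B : nat -> Omega -> 'cV[R]_d) (x0 : 'cV[R]_n).

Fixpoint state (u : nat -> Omega -> 'cV[R]_m) (g : Gamma) (k : nat)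
    (w : Omega) : 'cV[R]_n :=
  if k is j.+1 then
    cb c g j (state u g j w) (u j w)
    + cs c g j (state u g j w) (u j w) *m B j.+1 w
  else x0.

Definition value (u : nat -> Omega -> 'cV[R]_m) (g : Gamma) : \bar R :=
  'E_P[(fun w => \sum_(k < N) cf c g k (state u g k w) (u k w)
                 + cphi c g (state u g N w))%R]%E.

Definition averaged_value (u : nat -> Omega -> 'cV[R]_m)
    (lam : probability (borel Gamma) R) : \bar R :=
  (\int[lam]_(g in [set: borel Gamma]) value u g)%E.

Definition robust_cost (Lam : set (probability (borel Gamma) R))
    (u : nat -> Omega -> 'cV[R]_m) : \bar R :=
  ereal_sup [set averaged_value u lam | lam in Lam].

Definition optimal (q : R) (U : nat -> set 'cV[R]_m)
    (Lam : set (probability (borel Gamma) R))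
    (ustar : nat -> Omega -> 'cV[R]_m) : Prop :=
  admissible P N B q U ustar /\
  forall u, admissible P N B q U u -> (robust_cost Lam ustar <= robust_cost Lam u)%E.

Definition worst_case (Lam : set (probability (borel Gamma) R))
    (u : nat -> Omega -> 'cV[R]_m) : set (probability (borel Gamma) R) :=
  [set lam | Lam lam /\ robust_cost Lam u = averaged_value u lam].

Section Adjoint.
Variable u : nat -> Omega -> 'cV[R]_m.
Variables (p : Gamma -> nat -> Omega -> 'cV[R]_n)
          (r : Gamma -> nat -> Omega -> 'M[R]_(n, d)).

Definition adjoint_Z (g : Gamma) (k : nat) (w : Omega) : 'cV[R]_n :=
  (cbx c g k (state u g k w) (u k w))^T *m p g k w
  + \sum_i (csx c i g k (state u g k w) (u k w))^T *m col i (r g k w)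
  + (cfx c g k (state u g k w) (u k w))^T.

Definition adjoint_solution : Prop :=
  forall g : Gamma,
    is_condexp P (filtration B N.-1)
      (fun w => (cphix c g (state u g N w))^T) (p g N.-1)
    /\ is_condexp P (filtration B N.-1)
      (fun w => (cphix c g (state u g N w))^T *m (B N w)^T) (r g N.-1)
    /\ (forall k, (k.+1 < N)%N ->
      is_condexp P (filtration B k) (adjoint_Z g k.+1) (p g k)
      /\ is_condexp P (filtration B k)
           (fun w => adjoint_Z g k.+1 w *m (B k.+1 w)^T) (r g k)).

(** For each g, (p g, r g) is only determined up to null sets that may depend
    on g. Joint measurability in (g, w) is what gives a meaning to integrating
    over g at fixed w. *)
Definition jointly_measurable : Prop :=
  forall k, (k < N)%N ->
    (forall i, measurable_fun setT
       (fun z : borel Gamma * Omega => p z.1 k z.2 i 0))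
    /\ (forall i j, measurable_fun setT
       (fun z : borel Gamma * Omega => r z.1 k z.2 i j)).

End Adjoint.
End Control.

Section HamiltonianDerivative.
Context {R : realType}.

Let enorm_ge0 a k (A : 'M[R]_(a, k)) : 0 <= enorm A.
Proof. exact: sqrtr_ge0. Qed.

Let le_enorm a k (A : 'M[R]_(a, k)) i j : `|A i j| <= enorm A.
Proof.
rewrite -sqrtr_sqr ler_wsqrtr// (bigD1 i)//= (bigD1 j)//= -addrA lerDl.
by rewrite addr_ge0 ?sumr_ge0// => *; rewrite ?sumr_ge0// => *; exact: sqr_ge0.
Qed.

Let enorm_scalar (x : R) : enorm (x%:M : 'M[R]_1) = `|x|.
Proof. by rewrite /enorm !big_ord1 mxE eqxx mulr1n sqrtr_sqr. Qed.

Let enorm_col0 k l (y : 'cV[R]_l) : enorm (col_mx (0 : 'cV[R]_k) y) = enorm y.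
Proof.
rewrite /enorm big_split_ord/= big1 ?add0r => [|i _]; last first.
  by rewrite big_ord1 col_mxEu mxE expr0n.
by congr Num.sqrt; apply: eq_bigr => i _; rewrite !big_ord1 col_mxEd.
Qed.

Let sjac l (D : set 'cV[R]_l) (z : 'cV[R]_l) (h rho : 'cV[R]_l -> R) : Prop :=
  forall e : R, 0 < e -> exists2 delta : R, 0 < delta &
    forall z', D z' -> enorm (z' - z) < delta ->
      `|h z' - h z - rho (z' - z)| <= e * enorm (z' - z).

Let sjacD l (D : set 'cV[R]_l) z h1 r1 h2 r2 : sjac D z h1 r1 ->
  sjac D z h2 r2 -> sjac D z (fun y => h1 y + h2 y) (fun y => r1 y + r2 y).
Proof.
move=> j1 j2 e e0; have e20 : 0 < e / 2 by rewrite divr_gt0.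
have [d1 d10 H1] := j1 _ e20; have [d2 d20 H2] := j2 _ e20.
exists (Num.min d1 d2); first by rewrite lt_min d10.
move=> z' Dz'; rewrite lt_min => /andP[zd1 zd2].
rewrite [X in `|X|](_ : _ = (h1 z' - h1 z - r1 (z' - z))
                          + (h2 z' - h2 z - r2 (z' - z))); last first.
  by rewrite /= opprD (opprD (r1 _)) [in LHS](addrACA (h1 z')) [in LHS](addrACA (h1 z' - _)).
rewrite (le_trans (ler_normD _ _))// [e]splitr mulrDl lerD//.
  exact: H1.
exact: H2.
Qed.

Let sjac0 l (D : set 'cV[R]_l) z : sjac D z (fun=> 0) (fun=> 0).
Proof.
move=> e e0; exists 1 => // z' _ _.
by rewrite !subr0 normr0 mulr_ge0// ltW.
Qed.

Let sjacZ l (D : set 'cV[R]_l) z h rho (a : R) : sjac D z h rho ->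
  sjac D z (fun y => a * h y) (fun y => a * rho y).
Proof.
move=> j e e0; have a0 : 0 < `|a| + 1 by rewrite ltr_wpDl.
have [delta d0 H] := j _ (divr_gt0 e0 a0).
exists delta => // z' Dz' zd; rewrite -!mulrBr normrM.
apply: (@le_trans _ _ ((`|a| + 1) * (e / (`|a| + 1) * enorm (z' - z)))).
  apply: ler_pM => //; first by rewrite lerDl.
  exact: H.
by rewrite mulrA [_ * (e / _)]mulrC divfK// gt_eqF.
Qed.

Let sjac_sum l (D : set 'cV[R]_l) z (I : Type) (t : seq I)
    (h rho : I -> 'cV[R]_l -> R) : (forall i, sjac D z (h i) (rho i)) ->
  sjac D z (fun y => \sum_(i <- t) h i y) (fun y => \sum_(i <- t) rho i y).
Proof.
move=> j; elim: t => [|i t IH].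
  rewrite (_ : (fun y => _) = fun=> 0); last by apply/funext => y; rewrite big_nil.
  rewrite [X in sjac _ _ _ X](_ : _ = fun=> 0); last by apply/funext => y; rewrite big_nil.
  exact: sjac0.
rewrite (_ : (fun y => _) = fun y => h i y + \sum_(k <- t) h k y); last first.
  by apply/funext => y; rewrite big_cons.
rewrite [X in sjac _ _ _ X](_ : _ = fun y => rho i y + \sum_(k <- t) rho k y);
  last by apply/funext => y; rewrite big_cons.
exact: sjacD.
Qed.

Let sjac_comp n m r (D : set 'cV[R]_m) (g : 'cV[R]_n -> 'cV[R]_m -> 'cV[R]_r)
    x u (gx : 'M[R]_(r, n)) (gu : 'M[R]_(r, m)) :
  is_jacobian [set z | D (dsubmx z)] (stacked g) (col_mx x u) (row_mx gx gu) ->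
  forall i, sjac D u (fun y => g x y i 0) (fun y => (gu *m y) i 0).
Proof.
move=> j i e e0; have [delta d0 H] := j _ e0; exists delta => // u' Du' ud.
have := H (col_mx x u').
rewrite /stacked/= opp_col_mx add_col_mx subrr enorm_col0 !col_mxKu !col_mxKd.
rewrite mul_row_col mulmx0 add0r => /(_ Du' ud); apply: le_trans.
by have := le_enorm (g x u' - g x u - gu *m (u' - u)) i 0; rewrite !mxE.
Qed.

Lemma hamiltonian_uP (Gamma : pmetricType R) n m d
    (c : coefficients R Gamma n m d) N (U : nat -> set 'cV[R]_m) L v :
  H1 c N U L v -> H2 c N U L v ->
  forall g k x u p r, (k < N)%N -> U k u ->
  is_jacobian (U k) (fun u' => (hamiltonian c g k x u' p r)%:M) u
    (hamiltonian_u c g k x u p r).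
Proof.
move=> h1 [h2 _] g k x u p r kN Uu.
have Uz : [set z : 'cV[R]_(n + m) | U k (dsubmx z)] (col_mx x u).
  by rewrite /= col_mxKd.
have [_ [[Jb _] [Js _]]] := h1 k kN g.
have [_ [[Jf _] _]] := h2 k kN g.
have := Jb _ Uz; rewrite {2}/stacked col_mxKu col_mxKd => /sjac_comp {}Jb.
have {}Js i j : sjac (U k) u (fun y => cs c g k x y j i)
    (fun y => (csu c i g k x u *m y) j 0).
  have := (Js i).1 _ Uz; rewrite {2}/stacked col_mxKu col_mxKd.
  move=> /sjac_comp/(_ j).
  by rewrite (_ : (fun y => col _ _ _ _) = fun y => cs c g k x y j i) //;
    apply/funext => y; rewrite mxE.
have := Jf _ Uz; rewrite {2}/stacked col_mxKu col_mxKd => /sjac_comp/(_ 0).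
rewrite (_ : (fun y => _%:M _ _) = cf c g k x); last first.
  by apply/funext => y; rewrite mxE eqxx mulr1n.
move=> {}Jf.
have Hs := sjacD (sjacD Jf (sjac_sum (index_enum 'I_n)
    (fun j => sjacZ (p j 0) (Jb j))))
  (sjac_sum (index_enum 'I_d) (fun i => sjac_sum (index_enum 'I_n)
    (fun j => sjacZ (r j i) (Js i j)))).
move=> e e0; have [delta d0 H] := Hs e e0; exists delta => // u' Uu' ud.
have := H u' Uu' ud; congr (_ <= _).
set M := (X in enorm X).
have -> : M = (M 0 0)%:M.
  by apply/matrixP => a a'; rewrite !ord1 [RHS]mxE eqxx mulr1n.
rewrite enorm_scalar; congr `|_|; rewrite /M !mxE !eqxx !mulr1n.
congr (_ - _ - _).
- rewrite /hamiltonian /inner; congr (_ + _).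
  by apply: eq_bigr => i _; apply: eq_bigr => j _; rewrite !mxE.
- rewrite /hamiltonian /inner; congr (_ + _).
  by apply: eq_bigr => i _; apply: eq_bigr => j _; rewrite !mxE.
have -> : \sum_j hamiltonian_u c g k x u p r 0 j * (u' - u) j 0
    = (hamiltonian_u c g k x u p r *m (u' - u)) 0 0 by rewrite mxE.
rewrite /hamiltonian_u !mulmxDl mulmx_suml -mulmxA ![in RHS]mxE summxE.
congr (_ + _ + _).
  by apply: eq_bigr => j _; rewrite !mxE.
apply: eq_bigr => i _; rewrite -mulmxA [in RHS]mxE.
by apply: eq_bigr => j _; rewrite !mxE.
Qed.

End HamiltonianDerivative.

(* Main.v *)
Require Import Defs.
From HB Require Import structures.
From mathcomp Require Import all_boot all_order all_algebra.
From mathcomp Require Import all_classical all_reals all_analysis.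
From mathcomp Require Import measurable_realfun.
From mathcomp Require Import ring lra.

Set Implicit Arguments.
Unset Strict Implicit.
Unset Printing Implicit Defensive.

Import Order.TTheory GRing.Theory Num.Theory.
Import numFieldNormedType.Exports.

Local Open Scope classical_set_scope.
Local Open Scope ring_scope.

(** The proof is a variational argument in which three kinds of uniformity over
    the model parameter have to be produced: of the expansion of the cost, of the
    measurability of the adjoint pair, and of the choice of the measure.

    Expansion of the cost. At a fixed sample point the state, the difference of
    two states and the error of linearisation are all bounded by one scalar
    recursion [dom], whose coefficients involve the noise and the controls but not
    the parameter. As the noise is independent of the past, the recursion stays
    square integrable ([adL2_dom]). Dominated convergence then gives continuity of
    the mean cost in the parameter ([mean_cost_continuous]) and a first order
    expansion of it along segments of controls, with an error that is uniform over
    the parameter ([uniform_expansion]).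

    Adjoint pair. It is built backwards in time. At each step the conditional
    expectation is realised by writing the variable as a function of the past and
    of the next noise and integrating the noise out ([doob_dynkin_split],
    [freeze], [joint_condexp]); this yields versions that are jointly measurable
    in the parameter and the sample point and bounded in mean square uniformly
    over the parameter. Pairing them with the linearised state and summing by
    parts in time turns the derivative of the mean cost into the integral of the
    Hamiltonian gradient against the variation of the control
    ([mean_variation_duality]).

    Choice of the measure. Fix a competitor. Along the segment from the optimal
    control to the competitor the robust cost cannot decrease, and almost
    maximising measures for the perturbed controls accumulate, by weak
    compactness, at a measure that is worst for the optimal control and at which
    the averaged derivative is nonnegative ([danskin]). The measure depends on the
    competitor. Since the derivative is affine in the competitor by duality, and
    linear in the measure, a minimax argument on the convex compact set of worst
    measures gives a single measure for all competitors ([minimax],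
    [least_favourable]). The minimax lemma is reduced to two functions at a time,
    where it is a projection onto a quadrant of the plane.

    Pointwise form. For that measure the inequality is tested on competitors which
    differ from the optimal control only at one time, on an event of F_k, where
    they take a constant value ([spike_admissible]). By Fubini the average of the
    Hamiltonian inequality over the parameter is nonnegative in mean on every
    event of F_k, hence almost surely ([ae_nonneg_average]). *)

(** * Euclidean norm and mean value theorem *)

Section EuclideanNorm.
Context {R : realType}.

Lemma cauchy_schwarz_sum (I : finType) (a b : I -> R) :
  (\sum_i a i * b i) ^+ 2 <= (\sum_i a i ^+ 2) * (\sum_i b i ^+ 2).
Proof.
set A := \sum_i a i ^+ 2; set B := \sum_i b i ^+ 2; set C := \sum_i a i * b i.
have A0 : 0 <= A by apply: sumr_ge0 => i _; exact: sqr_ge0.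
have [A_eq0|A_neq0] := eqVneq A 0.
  have a0 i : a i = 0.
    apply/eqP; rewrite -sqrf_eq0 eq_le sqr_ge0 andbT -A_eq0 /A (bigD1 i)//=.
    by rewrite lerDl sumr_ge0// => *; exact: sqr_ge0.
  by rewrite A_eq0 mul0r /C big1 ?expr0n// => i _; rewrite a0 mul0r.
have Agt0 : 0 < A by rewrite lt_def A_neq0.
have : 0 <= \sum_i (A * b i - C * a i) ^+ 2.
  by apply: sumr_ge0 => i _; exact: sqr_ge0.
have -> : \sum_i (A * b i - C * a i) ^+ 2 = A * (A * B - C ^+ 2).
  transitivity (\sum_i (A ^+ 2 * b i ^+ 2 + - (A * C *+ 2) * (a i * b i)
      + C ^+ 2 * a i ^+ 2)).
    by apply: eq_bigr => i _; ring.
  rewrite !big_split/= -!mulr_sumr -/A -/B -/C; ring.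
by rewrite pmulr_rge0// subr_ge0.
Qed.

Lemma enorm_ge0 a c (A : 'M[R]_(a, c)) : 0 <= enorm A.
Proof. exact: sqrtr_ge0. Qed.

Lemma sqr_enorm a c (A : 'M[R]_(a, c)) :
  enorm A ^+ 2 = \sum_i \sum_j A i j ^+ 2.
Proof.
rewrite sqr_sqrtr//; apply: sumr_ge0 => i _; apply: sumr_ge0 => j _.
exact: sqr_ge0.
Qed.

Lemma le_enorm a c (A : 'M[R]_(a, c)) i j : `|A i j| <= enorm A.
Proof.
rewrite -sqrtr_sqr ler_wsqrtr// (bigD1 i)//= (bigD1 j)//= -addrA lerDl.
by rewrite addr_ge0 ?sumr_ge0// => *; rewrite ?sumr_ge0// => *; exact: sqr_ge0.
Qed.

Lemma enorm0 a c : enorm (0 : 'M[R]_(a, c)) = 0.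
Proof.
by rewrite /enorm big1 ?sqrtr0// => i _; rewrite big1// => j _; rewrite mxE expr0n.
Qed.

Lemma enormZ a c (x : R) (A : 'M[R]_(a, c)) : enorm (x *: A) = `|x| * enorm A.
Proof.
rewrite -(sqrtr_sqr x) -sqrtrM ?sqr_ge0// mulr_sumr; congr Num.sqrt.
apply: eq_bigr => i _; rewrite mulr_sumr; apply: eq_bigr => j _.
by rewrite mxE exprMn.
Qed.

Lemma enormN a c (A : 'M[R]_(a, c)) : enorm (- A) = enorm A.
Proof. by rewrite -scaleN1r enormZ normrN1 mul1r. Qed.

Lemma enormD a c (A A' : 'M[R]_(a, c)) : enorm (A + A') <= enorm A + enorm A'.
Proof.
have := cauchy_schwarz_sum (fun ij : 'I_a * 'I_c => A ij.1 ij.2)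
  (fun ij => A' ij.1 ij.2).
have EA := sqr_enorm A; have EA' := sqr_enorm A'.
have := sqr_enorm (A + A'); rewrite !pair_big/= in EA EA' *.
rewrite -EA -EA' => EAA' /=.
rewrite -exprMn -ler_sqrt ?sqr_ge0// !sqrtr_sqr.
rewrite [X in _ <= X]ger0_norm ?mulr_ge0 ?enorm_ge0// => CS.
rewrite -(@ler_pXn2r _ 2) ?nnegrE ?addr_ge0 ?enorm_ge0//.
rewrite EAA' sqrrD EA EA'.
under eq_bigr do rewrite mxE sqrrD.
rewrite !big_split/= lerD2r lerD2l [leRHS]mulr2n.
by rewrite lerD// (le_trans (ler_norm _)).
Qed.

Lemma enormM a c e (A : 'M[R]_(a, c)) (A' : 'M[R]_(c, e)) :
  enorm (A *m A') <= enorm A * enorm A'.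
Proof.
rewrite -(@ler_pXn2r _ 2) ?nnegrE ?mulr_ge0 ?enorm_ge0//.
rewrite exprMn !sqr_enorm mulr_suml; apply: ler_sum => i _.
rewrite exchange_big mulr_sumr; apply: ler_sum => j _.
by rewrite mxE cauchy_schwarz_sum.
Qed.

Lemma enorm_le_sum a c (A : 'M[R]_(a, c)) :
  enorm A <= \sum_i \sum_j `|A i j|.
Proof.
have S0 : 0 <= \sum_i \sum_j `|A i j|.
  by apply: sumr_ge0 => i _; apply: sumr_ge0.
rewrite -(@ler_pXn2r _ 2) ?nnegrE ?enorm_ge0// sqr_enorm !pair_big/=.
rewrite expr2 mulr_suml; apply: ler_sum => ij _.
rewrite -real_normK ?num_real// expr2 ler_wpM2l//.
by rewrite (bigD1 ij)//= lerDl sumr_ge0.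
Qed.

Lemma enorm_le_coord a (x : 'cV[R]_a) (M : R) :
  (forall i, `|x i 0| <= M) -> enorm x <= a%:R * M.
Proof.
move=> xM; rewrite (le_trans (enorm_le_sum _))//.
under eq_bigr do rewrite big_ord1.
rewrite -[a in a%:R]card_ord -sumr_const mulr_suml.
by apply: ler_sum => i _; rewrite mul1r.
Qed.

Lemma enorm_scalar (x : R) : enorm (x%:M : 'M[R]_1) = `|x|.
Proof. by rewrite /enorm !big_ord1 mxE eqxx mulr1n sqrtr_sqr. Qed.

Lemma inner_mul a (x y : 'cV[R]_a) : inner x y = (x^T *m y) 0 0.
Proof. by rewrite mxE; apply: eq_bigr => i _; rewrite mxE. Qed.

Lemma innerDl a (x y z : 'cV[R]_a) : inner (x + y) z = inner x z + inner y z.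
Proof. by rewrite !inner_mul linearD/= mulmxDl mxE. Qed.

Lemma innerDr a (x y z : 'cV[R]_a) : inner z (x + y) = inner z x + inner z y.
Proof. by rewrite !inner_mul mulmxDr mxE. Qed.

Lemma innerZr a (t : R) (x y : 'cV[R]_a) : inner x (t *: y) = t * inner x y.
Proof. by rewrite !inner_mul -scalemxAr mxE. Qed.

Lemma inner_sumr (I : Type) (s : seq I) a (x : 'cV[R]_a) (y : I -> 'cV[R]_a) :
  inner x (\sum_(i <- s) y i) = \sum_(i <- s) inner x (y i).
Proof.
rewrite inner_mul mulmx_sumr summxE; apply: eq_bigr => i _.
by rewrite inner_mul.
Qed.

End EuclideanNorm.

Section MeanValue.
Context {R : realType}.

(** Along a segment of the convex set the relative Jacobian is a genuine
    derivative in the one-dimensional parameter, so the usual mean value theorem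
    applies to each component; the intermediate point depends on the component. *)
Lemma jacobian_mean_value l r (D : set 'cV[R]_l) (g : 'cV[R]_l -> 'cV[R]_r)
    (J : 'cV[R]_l -> 'M[R]_(r, l)) (z z' : 'cV[R]_l) (i : 'I_r) :
  (forall t : R, 0 <= t <= 1 -> D (z + t *: (z' - z))) ->
  (forall y, D y -> is_jacobian D g y (J y)) ->
  exists2 t : R, 0 <= t <= 1 &
    (g z' - g z) i 0 = (J (z + t *: (z' - z)) *m (z' - z)) i 0.
Proof.
move=> Dseg Jg; set h := z' - z.
pose G (t : R) := g (z + t *: h) i 0.
pose dG (t : R) := (J (z + t *: h) *m h) i 0.
have h0 : 0 < enorm h + 1 by rewrite ltr_wpDl ?enorm_ge0.
(* Dividing by enorm h + 1 rather than enorm h covers the case z = z'. *)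
have Gexp (t e : R) : 0 <= t <= 1 -> 0 < e -> exists2 delta : R, 0 < delta &
    forall s : R, 0 <= s <= 1 -> `|s - t| < delta ->
      `|G s - G t - dG t * (s - t)| <= e * `|s - t|.
  move=> t01 e0.
  have [delta d0 Hd] := Jg _ (Dseg _ t01) _ (divr_gt0 e0 h0).
  exists (delta / (enorm h + 1)); first exact: divr_gt0.
  move=> s s01; rewrite ltr_pdivlMr// => std.
  have st : z + s *: h - (z + t *: h) = (s - t) *: h.
    by rewrite opprD addrACA subrr add0r -scalerBl.
  have : `|s - t| * enorm h < delta.
    by rewrite (le_lt_trans _ std)// ler_wpM2l// lerDl.
  have := Hd _ (Dseg _ s01); rewrite -/h st enormZ => Hst lt_d.
  have := le_trans (le_enorm _ i 0) (Hst lt_d).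
  have entry (a b y : 'cV[R]_r) : (a - b - (s - t) *: y) i 0
      = a i 0 - b i 0 - (s - t) * y i 0 by rewrite !mxE.
  rewrite linearZ/= entry => le1.
  rewrite [dG t * _]mulrC (le_trans le1)// mulrCA [leRHS]mulrC ler_wpM2l//.
  by rewrite -mulrA ler_piMr ?(ltW e0)// ler_pdivrMl// mulr1 lerDl.
have Gder (t : R) : t \in `]0, 1[%R -> is_derive t 1 G (dG t).
  rewrite in_itv/= => /andP[t0 t1].
  suff cv : (fun s : R => s^-1 *: (G (s *: 1 + t) - G t)) @ 0^' --> dG t.
    have dvb : derivable G t 1 by apply/cvg_ex; exists (dG t).
    by apply: DeriveDef dvb _; exact: cvg_lim cv.
  apply/cvgrPdist_le => e e0.
  have t01 : 0 <= t <= 1 by rewrite !ltW.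
  have [delta d0 Hd] := Gexp t e t01 e0.
  have m0 : 0 < Num.min delta (Num.min t (1 - t)).
    by rewrite !lt_min d0 t0 subr_gt0.
  near=> s.
  have sn0 : s != 0 by near: s; exact: nbhs_dnbhs_neq.
  have : `|s| < Num.min delta (Num.min t (1 - t)).
    by near: s; exact: dnbhs0_lt.
  rewrite !lt_min => /and3P[sd]; rewrite !ltr_norml => /andP[st _] /andP[_ s1t].
  have := Hd (s + t); rewrite addrK => /(_ _ sd) Hs.
  have -> : dG t - s^-1 *: (G (s *: 1 + t) - G t)
      = - (s^-1 * (G (s + t) - G t - dG t * s)).
    have -> : s *: (1 : R) = s by rewrite /GRing.scale/= mulr1.
    by rewrite /GRing.scale/=; field.
  rewrite normrN normrM normfV ler_pdivrMl ?normr_gt0// [leRHS]mulrC Hs//.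
  by apply/andP; split; lra.
have Gcont : {within `[0, 1], continuous G}.
  apply/subspace_continuousP => t; rewrite /= in_itv/= => t01.
  apply/cvgrPdist_le => e e0.
  have [delta d0 Hd] := Gexp t 1 t01 ltr01.
  have k0 : 0 < 1 + `|dG t| by rewrite ltr_pwDl.
  have m0 : 0 < Num.min delta (e / (1 + `|dG t|)) by rewrite lt_min d0 divr_gt0.
  apply/nbhs_ballP; exists (Num.min delta (e / (1 + `|dG t|))) => //= s.
  rewrite /ball/= lt_min distrC => /andP[sd se]; rewrite in_itv/= => s01.
  have := Hd _ s01 sd; rewrite mul1r => Hs.
  rewrite distrC (_ : G s - G t = G s - G t - dG t * (s - t) + dG t * (s - t));
    last by rewrite subrK.
  rewrite (le_trans (ler_normD _ _))// normrM.
  rewrite (@le_trans _ _ ((1 + `|dG t|) * `|s - t|)) //.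
    by rewrite mulrDl mul1r lerD.
  by rewrite mulrC -ler_pdivlMr// ltW.
have [t t01 Gt] := MVT ltr01 Gder Gcont.
exists t; first by move: t01; rewrite in_itv/= => /andP[/ltW-> /ltW->].
move: Gt; rewrite subr0 mulr1 /dG /G scale1r scale0r addr0 /h subrKC => <-.
by rewrite !mxE.
Unshelve. all: by end_near.
Qed.
End MeanValue.

(** * First order expansions and moduli of continuity *)

Section TaylorExpansion.
Context {R : realType} {n m : nat}.
Variables (U : nat -> set 'cV[R]_m) (k : nat).
Hypothesis U_segment : forall u u' (t : R), U k u -> U k u' -> 0 <= t <= 1 ->
  U k (u + t *: (u' - u)).

Section MeanValueXU.
Context {r : nat} (g : 'cV[R]_n -> 'cV[R]_m -> 'cV[R]_r).
Context (gx : 'cV[R]_n -> 'cV[R]_m -> 'M[R]_(r, n)).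
Context (gu : 'cV[R]_n -> 'cV[R]_m -> 'M[R]_(r, m)).
Hypothesis g_C1 : C1_xu U k g gx gu.
Variables (x x' : 'cV[R]_n) (u u' : 'cV[R]_m).
Hypotheses (Uu : U k u) (Uu' : U k u').

Let dist_xu := enorm (x' - x) + enorm (u' - u).

Lemma mean_value_xu (i : 'I_r) : exists2 t : R, 0 <= t <= 1 &
  (g x' u' - g x u) i 0
  = (gx (x + t *: (x' - x)) (u + t *: (u' - u)) *m (x' - x)
     + gu (x + t *: (x' - x)) (u + t *: (u' - u)) *m (u' - u)) i 0.
Proof.
have seg (t : R) : col_mx x u + t *: (col_mx x' u' - col_mx x u)
    = col_mx (x + t *: (x' - x)) (u + t *: (u' - u)).
  by rewrite opp_col_mx add_col_mx scale_col_mx add_col_mx.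
have [|t t01 gE] := jacobian_mean_value (z := col_mx x u) (z' := col_mx x' u')
    i _ g_C1.1.
  by move=> t t01; rewrite /= seg col_mxKd; exact: U_segment.
exists t => //; move: gE.
rewrite /stacked seg !col_mxKu !col_mxKd => ->.
by rewrite opp_col_mx add_col_mx mul_row_col.
Qed.

Lemma lipschitz_xu (M : R) :
  (forall t : R, 0 <= t <= 1 ->
     enorm (gx (x + t *: (x' - x)) (u + t *: (u' - u))) <= M
     /\ enorm (gu (x + t *: (x' - x)) (u + t *: (u' - u))) <= M) ->
  enorm (g x' u' - g x u) <= r%:R * (M * dist_xu).
Proof.
move=> bound; apply: enorm_le_coord => i.
have [t t01 ->] := mean_value_xu i; have [bx bu] := bound t t01.
rewrite (le_trans (le_enorm _ _ _))// (le_trans (enormD _ _))// mulrDr.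
by rewrite lerD// (le_trans (enormM _ _))// ler_wpM2r// enorm_ge0.
Qed.

(** The mean value theorem gives the derivative at a point of the segment;
    replacing it by the derivative at the base point costs at most the modulus
    at the length of the segment. *)
Lemma taylor_xu (psi : R -> R) : modulus psi ->
  (forall y w, U k w ->
     enorm (gx y w - gx x u) <= psi (enorm (y - x) + enorm (w - u))
     /\ enorm (gu y w - gu x u) <= psi (enorm (y - x) + enorm (w - u))) ->
  enorm (g x' u' - g x u - (gx x u *m (x' - x) + gu x u *m (u' - u)))
    <= r%:R * (psi dist_xu * dist_xu).
Proof.
move=> [_ _ psi_nd _ _] bound; apply: enorm_le_coord => i.
have [t t01 gE] := mean_value_xu i.
have entry (a b c e : 'cV[R]_r) : a i 0 = b i 0 ->
  (a - c) i 0 = (b - c) i 0 by rewrite !mxE => ->.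
rewrite (entry _ _ _ 0 gE).
have /andP[t0 t1] := t01.
have [bx bu] := bound (x + t *: (x' - x)) (u + t *: (u' - u))
  (U_segment Uu Uu' t01).
have le_psi : psi (enorm (x + t *: (x' - x) - x) + enorm (u + t *: (u' - u) - u))
    <= psi dist_xu.
  apply: psi_nd; first by rewrite addr_ge0 ?enorm_ge0.
  rewrite [x + _]addrC [u + _]addrC !addrK !enormZ ger0_norm// /dist_xu lerD//.
    by rewrite ler_piMl ?enorm_ge0.
  by rewrite ler_piMl ?enorm_ge0.
rewrite opprD addrACA -!mulmxBl (le_trans (le_enorm _ _ _))//.
rewrite (le_trans (enormD _ _))// mulrDr.
rewrite lerD// (le_trans (enormM _ _))// ler_wpM2r ?enorm_ge0//.
  exact: le_trans bx _.
exact: le_trans bu _.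
Qed.

End MeanValueXU.
End TaylorExpansion.

Section ModulusTheory.
Context {R : realType} (psi : R -> R).
Hypothesis psi_mod : modulus psi.

Lemma modulus_ge0 t : 0 <= t -> 0 <= psi t.
Proof. by case: psi_mod => _ _ _ + _; exact. Qed.

Lemma modulus_le s t : 0 <= s -> s <= t -> psi s <= psi t.
Proof. by case: psi_mod => _ _ + _ _; exact. Qed.

(** By subadditivity psi is at most psi 1 times an integer above its argument.
    This makes terms such as psi s * s integrable as soon as s is square
    integrable. *)
Lemma modulus_linear_growth t : 0 <= t -> psi t <= psi 1 * (1 + t).
Proof.
move=> t0; have p1 : 0 <= psi 1 by apply: modulus_ge0.
have natle (j : nat) : psi j%:R <= psi 1 * j%:R.
  elim: j => [|j IH]; first by case: psi_mod => _ _ _ _ ->; rewrite mulr0.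
  rewrite -natr1 mulrDr mulr1.
  case: psi_mod => _ + _ _ _ => /(_ j%:R 1 (ler0n _ _) ler01)/le_trans; apply.
  by rewrite lerD2r.
apply: le_trans (_ : psi (Num.truncn t).+1%:R <= _).
  by apply: modulus_le => //; rewrite ltW// truncnS_gt.
apply: le_trans (natle _) _; rewrite ler_wpM2l// -natr1 addrC lerD2l.
by rewrite truncn_le.
Qed.

Lemma modulus_near0 e : 0 < e -> exists2 delta : R, 0 < delta &
  forall t, 0 <= t -> t < delta -> psi t < e.
Proof.
move=> e0; case: psi_mod => cont _ _ nneg z.
have := cont; move=> /subspace_continuousP/(_ 0 (lexx _)).
move=> /cvgrPdist_lt/(_ _ e0)/nbhs_ballP[/= delta d0 Hd].
exists delta => // t t0 td.
have := Hd t; rewrite /ball/= /from_subspace z !sub0r !normrN ger0_norm//.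
by rewrite ger0_norm ?nneg//; apply.
Qed.

(** Applied at a fixed sample point, where [a j] is the size of the j-th
    perturbation. *)
Lemma modulus_cvg0 (a : nat -> R) : (forall j, 0 <= a j) -> a @ \oo --> 0 ->
  (fun j => psi (a j)) @ \oo --> 0.
Proof.
move=> a0 a_cvg; apply/cvgrPdist_lt => e e0.
have [delta d0 Hd] := modulus_near0 e0.
move/cvgrPdist_lt : a_cvg => /(_ _ d0); apply: filterS => j.
rewrite !sub0r !normrN ger0_norm// => aj.
by rewrite ger0_norm ?modulus_ge0// Hd.
Qed.

Lemma measurable_modulus d (T : measurableType d) (f : T -> R) :
  measurable_fun setT f -> (forall x, 0 <= f x) ->
  measurable_fun setT (fun x => psi (f x)).
Proof.
move=> mf f0.
have -> : (fun x => psi (f x)) = (fun t => psi (Num.max t 0)) \o f.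
  by apply/funext => x /=; rewrite max_l.
apply: measurableT_comp mf; apply: nondecreasing_measurable => //= s t st.
apply: modulus_le; first by rewrite le_max lexx orbT.
by rewrite ge_max !le_max st lexx orbT.
Qed.

End ModulusTheory.

Lemma convex_set_segment {R : realType} m (A : set 'cV[R]_m) :
  convex_set (A : set (convex_lmodType 'cV[R]_m)) ->
  forall u u' (t : R), A u -> A u' -> 0 <= t <= 1 -> A (u + t *: (u' - u)).
Proof.
move=> cA u u' t Au Au' /andP[t0 t1].
have := cA u' u (Itv01 t0 t1).
rewrite !inE => /(_ Au' Au); congr (A _).
rewrite /conv/= /unstable.onem scalerBl scale1r scalerBr.
by rewrite addrC addrAC addrA.
Qed.

(** * Factorisation of measurable functions *)

(** The factor is rebuilt as the infimum of the rational levels whose strict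
    sublevel set contains the point; each such set is a pullback along [D]. *)
Lemma doob_dynkin {R : realType} (T : Type) d (Y : measurableType d)
    (D : T -> Y) (f : T -> R) :
  (forall r : R, exists2 S : set Y, measurable S &
     [set x | f x < r] = D @^-1` S) ->
  exists2 g : Y -> R, measurable_fun setT g & forall x, f x = g (D x).
Proof.
move=> fS.
have [S S_P] : exists S : R -> set Y,
    forall r, measurable (S r) /\ [set x | f x < r] = D @^-1` S r.
  have /choice[S HS] : forall r, exists A : set Y,
    measurable A /\ [set x | f x < r] = D @^-1` A.
    by move=> r; have [A mA EA] := fS r; exists A.
  by exists S.
have S_meas r := (S_P r).1.
have SE r x : (D x \in S r) = (f x < r).
  apply/idP/idP; rewrite inE => h.
    suff : [set x | f x < r] x by [].
    by rewrite (S_P r).2.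
  by have : [set x | f x < r] x by []; rewrite (S_P r).2.
pose level (j : nat) : R := if @unpickle rat j is Some r then ratr r else 0.
pose h (j : nat) (y : Y) : \bar R :=
  if y \in S (level j) then (level j)%:E else +oo%E.
exists (fun y => fine (einfs (h ^~ y) 0%N)).
  apply: measurableT_comp => //.
  apply: measurable_fun_einfs => j; apply: measurable_fun_ifT => //.
  apply: (measurable_fun_bool true); rewrite setTI.
  rewrite (_ : _ @^-1` _ = S (level j)); first exact: S_meas.
  apply/seteqP; split=> y; first by move=> /set_mem.
  by move=> yS; exact: mem_set yS.
move=> x; suff -> : einfs (h ^~ (D x)) 0%N = (f x)%:E by [].
apply/eqP; rewrite eq_le; apply/andP; split; last first.
  apply: le_ereal_inf_tmp => _ [j _ <-]; rewrite /h SE.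
  by case: ifPn => [fj|_]; rewrite ?leey// lee_fin ltW.
apply/lee_addgt0Pr => e e0.
have fxe : f x < f x + e by rewrite ltrDl.
have [r] := rat_in_itvoo fxe; rewrite in_itv/= => /andP[fr re].
apply: le_trans (_ : (ratr r)%:E <= _)%E; last by rewrite -EFinD lee_fin ltW.
apply: ereal_inf_lbound; exists (pickle r) => //.
by rewrite /h /level pickleK SE fr.
Qed.

(** The diagonal pulls the product of two sigma-algebras back to the one they
    generate together, so a jointly measurable function of a parameter and a
    sample point can be split into a function of two sample points, one for each
    sigma-algebra. *)
Lemma doob_dynkin_split {R : realType} d (M : measurableType d)
    (T : pointedType) (G1 G2 G3 : set (set T)) (f : M * g_sigma_algebraType G3 -> R) :
  (forall A, G3 A -> <<s G1 >> A \/ <<s G2 >> A) ->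
  measurable_fun setT f ->
  exists2 g : (M * g_sigma_algebraType G1) * g_sigma_algebraType G2 -> R,
    measurable_fun setT g & forall z w, f (z, w) = g ((z, w), w).
Proof.
move=> G3_sub mf.
pose Y : measurableType _ :=
  ((M * g_sigma_algebraType G1) * g_sigma_algebraType G2)%type.
pose D (x : M * g_sigma_algebraType G3) : Y := ((x.1, x.2), x.2).
pose pull := preimage_set_system setT D (@measurable _ Y).
have pull_sa : sigma_algebra setT pull.
  exact: sigma_algebra_preimage (sigma_algebra_measurable _).
have pull_snd (C : set T) : <<s G3 >> C -> pull (setT `*` C).
  pose good := [set C : set T | pull (setT `*` C)].
  suff : <<s G3 >> `<=` good by exact.
  apply: smallest_sub; first split.
  - by rewrite /good/= setX0; case: pull_sa.
  - move=> C1; rewrite /good/= => pC1.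
    case: pull_sa => _ /(_ _ pC1) + _; congr (pull _).
    by apply/seteqP; split=> -[a b]; rewrite /setD /setX/=; tauto.
  - move=> F FG; rewrite /good/= setX_bigcupr.
    by case: pull_sa => _ _; apply.
  move=> C1 /G3_sub[C1G|C1G]; rewrite /good/=.
    exists ((setT `*` C1) `*` setT).
      by apply: measurableX => //; exact: measurableX.
    by rewrite setTI; apply/seteqP; split=> -[a b]/=; tauto.
  exists (setT `*` C1); first exact: measurableX.
  by rewrite setTI; apply/seteqP; split=> -[a b]/=; tauto.
have pull_meas : measurable `<=` pull.
  rewrite measurable_prod_measurableType; apply: smallest_sub => //.
  move=> _ [A mA [C mC <-]].
  have [S1 mS1 S1E] : pull (A `*` setT).
    exists ((A `*` setT) `*` setT); first by do 2 apply: measurableX => //.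
    by rewrite setTI; apply/seteqP; split=> -[a b]/=; tauto.
  have [S2 mS2 S2E] := pull_snd _ mC.
  exists (S1 `&` S2); first exact: measurableI.
  rewrite preimage_setI setIIr S1E S2E.
  by apply/seteqP; split=> -[a b]/=; tauto.
have [|g mg gE] := @doob_dynkin R _ _ Y D f.
  move=> r; have : measurable (f @^-1` [set y | y < r]).
    by rewrite -[X in measurable X]setTI; apply: mf => //; rewrite -set_itvNyo.
  by move=> /pull_meas[S mS SE]; exists S => //; move: SE; rewrite setTI => ->.
by exists g => // z w; rewrite gE.
Qed.

(** * Integrable and square integrable functions *)

Section RealIntegrals.
Context d (T : measurableType d) {R : realType}.
Variable mu : {measure set T -> \bar R}.

(** Real-valued functions are integrated through their extended values; [rint]
    abbreviates integrability in that sense over the whole space. *)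
Definition rint (f : T -> R) := mu.-integrable setT (EFin \o f).

Lemma rint_le (f g : T -> R) : measurable_fun setT f ->
  (forall x, `|f x| <= g x) -> rint g -> rint f.
Proof.
move=> mf fg; apply: le_integrable => //; first exact/measurable_EFinP.
by move=> x _ /=; rewrite lee_fin (le_trans (fg x))// ler_norm.
Qed.

Lemma rint_meas (f : T -> R) : rint f -> measurable_fun setT f.
Proof. by move=> /measurable_int/measurable_EFinP. Qed.

Lemma rintD (f g : T -> R) : rint f -> rint g -> rint (fun x => f x + g x).
Proof. by move=> fi gi; exact: (integrableD measurableT fi gi). Qed.

Lemma rintB (f g : T -> R) : rint f -> rint g -> rint (fun x => f x - g x).
Proof. by move=> fi gi; exact: (integrableB measurableT fi gi). Qed.

Lemma rintZ (c : R) (f : T -> R) : rint f -> rint (fun x => c * f x).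
Proof. by move=> fi; exact: (integrableZl measurableT c fi). Qed.

Lemma rint_sum (I : Type) (s : seq I) (f : I -> T -> R) :
  (forall i, rint (f i)) -> rint (fun x => \sum_(i <- s) f i x).
Proof.
move=> fi; rewrite /rint.
have -> : EFin \o (fun x => \sum_(i <- s) f i x)
    = (fun x => \sum_(i <- s) (f i x)%:E)%E.
  by apply/funext => x /=; rewrite sumEFin.
by apply: integrable_sum => // i _; exact: fi.
Qed.

Lemma Rintegral_sum (I : Type) (s : seq I) (f : I -> T -> R) :
  (forall i, rint (f i)) ->
  \int[mu]_x (\sum_(i <- s) f i x) = \sum_(i <- s) \int[mu]_x (f i x).
Proof.
move=> fi; elim: s => [|i s IH].
  under eq_Rintegral do rewrite big_nil.
  by rewrite big_nil Rintegral_cst//= mul0r.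
rewrite big_cons -IH -RintegralD//; [|exact: fi|exact: rint_sum].
by apply: eq_Rintegral => x _; rewrite big_cons.
Qed.

Lemma RintegralE (f : T -> R) : rint f ->
  (\int[mu]_x (f x)%:E = (\int[mu]_x f x)%:E)%E.
Proof. by move=> fi; rewrite /Rintegral fineK//; exact: integrable_fin_num. Qed.

(** Square integrability, with an explicit bound so that it can be asserted
    uniformly over a family. *)
Definition sqint_le (K : R) (f : T -> R) :=
  measurable_fun setT f /\ (\int[mu]_x (f x ^+ 2)%:E <= K%:E)%E.

Definition sqint (f : T -> R) := exists K, sqint_le K f.

Lemma sqint_rint (f : T -> R) : sqint f -> rint (fun x => f x ^+ 2).
Proof.
move=> [K [mf fK]]; apply/integrableP; split.
  by apply/measurable_EFinP; exact: measurable_funX.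
rewrite (le_lt_trans _ (ltry K))// (le_trans _ fK)// le_eqVlt; apply/orP; left.
by apply/eqP/eq_integral => x _; rewrite /= ger0_norm// sqr_ge0.
Qed.

Lemma sqint_le_Rintegral K (f : T -> R) : sqint_le K f ->
  \int[mu]_x (f x ^+ 2) <= K.
Proof.
by move=> fK; rewrite -lee_fin -RintegralE; [exact: fK.2|apply: sqint_rint; exists K].
Qed.

Lemma rint_sqint (f : T -> R) : measurable_fun setT f ->
  rint (fun x => f x ^+ 2) -> sqint f.
Proof.
by move=> mf fi; exists (\int[mu]_x (f x ^+ 2)); split; rewrite ?RintegralE.
Qed.

Lemma sqint_le_bound K (f g : T -> R) : measurable_fun setT f ->
  (forall x, `|f x| <= `|g x|) -> sqint_le K g -> sqint_le K f.
Proof.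
move=> mf fg [mg gK]; split=> //; apply: le_trans gK.
apply: ge0_le_integral => //=.
- by move=> x _; rewrite lee_fin sqr_ge0.
- by apply/measurable_EFinP; exact: measurable_funX.
- by apply/measurable_EFinP; exact: measurable_funX.
move=> x _; rewrite lee_fin -[leLHS]real_normK ?num_real//.
by rewrite -[leRHS]real_normK ?num_real// lerXn2r ?nnegrE.
Qed.

Lemma sqint_leZ K (c : R) (f : T -> R) : sqint_le K f ->
  sqint_le (c ^+ 2 * K) (fun x => c * f x).
Proof.
move=> [mf fK]; split; first exact: measurable_funM.
under eq_integral do rewrite exprMn EFinM.
rewrite ge0_integralZl//.
- by rewrite (EFinM _ K) lee_wpmul2l// lee_fin sqr_ge0.
- by apply/measurable_EFinP; exact: measurable_funX.
- by move=> x _; rewrite lee_fin sqr_ge0.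
- by rewrite lee_fin sqr_ge0.
Qed.

Lemma sqint_leD K K' (f g : T -> R) : sqint_le K f -> sqint_le K' g ->
  sqint_le (2 * K + 2 * K') (fun x => f x + g x).
Proof.
move=> [mf fK] [mg gK']; split; first exact: measurable_funD.
have m2 (h : T -> R) : measurable_fun setT h ->
    measurable_fun setT (fun x => (2 * h x ^+ 2)%:E).
  by move=> mh; apply/measurable_EFinP/measurable_funM => //; exact: measurable_funX.
have h2 (h : T -> R) x : setT x -> (0 <= (2 * h x ^+ 2)%:E)%E.
  by move=> _; rewrite lee_fin mulr_ge0// sqr_ge0.
apply: (@le_trans _ _ (\int[mu]_x ((2 * f x ^+ 2)%:E + (2 * g x ^+ 2)%:E))%E).
  apply: ge0_le_integral => //=.
  - by move=> x _; rewrite lee_fin sqr_ge0.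
  - by apply/measurable_EFinP/measurable_funX/measurable_funD.
  - by apply: emeasurable_funD; exact: m2.
  move=> x _; rewrite -EFinD lee_fin -subr_ge0.
  rewrite (_ : _ - _ = (f x - g x) ^+ 2); last by ring.
  exact: sqr_ge0.
rewrite ge0_integralD//; [|exact: h2|exact: m2|exact: h2|exact: m2].
have I2 (h : T -> R) K0 : measurable_fun setT h ->
    (\int[mu]_x (h x ^+ 2)%:E <= K0%:E)%E ->
    (\int[mu]_x (2 * h x ^+ 2)%:E <= (2 * K0)%:E)%E.
  move=> mh hK; under eq_integral do rewrite EFinM.
  rewrite ge0_integralZl//.
  - by rewrite EFinM lee_wpmul2l// lee_fin.
  - by apply/measurable_EFinP; exact: measurable_funX.
  - by move=> x _; rewrite lee_fin sqr_ge0.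
by rewrite EFinD leeD// I2.
Qed.

Lemma sqintZ (c : R) (f : T -> R) : sqint f -> sqint (fun x => c * f x).
Proof. by move=> [K fK]; exists (c ^+ 2 * K); exact: sqint_leZ. Qed.

Lemma sqintD (f g : T -> R) : sqint f -> sqint g -> sqint (fun x => f x + g x).
Proof. by move=> [K fK] [K' gK]; exists (2 * K + 2 * K'); exact: sqint_leD. Qed.

Lemma sqint_bound (f g : T -> R) : measurable_fun setT f ->
  (forall x, `|f x| <= `|g x|) -> sqint g -> sqint f.
Proof. by move=> mf fg [K gK]; exists K; exact: sqint_le_bound gK. Qed.

Lemma sqint_mul (f g : T -> R) : sqint f -> sqint g -> rint (fun x => f x * g x).
Proof.
move=> fi gi.
have mf : measurable_fun setT f by case: fi => ? [].
have mg : measurable_fun setT g by case: gi => ? [].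
apply: (@rint_le _ (fun x => f x ^+ 2 + g x ^+ 2)).
- exact: measurable_funM.
- move=> x; rewrite normrM -[f x ^+ 2]real_normK ?num_real//.
  rewrite -[g x ^+ 2]real_normK ?num_real//.
  have := sqr_ge0 (`|f x| - `|g x|); have := normr_ge0 (f x).
  have := normr_ge0 (g x); nra.
- by apply: rintD; exact: sqint_rint.
Qed.

(** The quadratic inequality is applied to [f - t b] with the optimal value
    t = (int f b) / Kb. *)
Lemma cauchy_schwarz_integral (f b : T -> R) (Kb : R) :
  measurable_fun setT f -> 0 < Kb -> sqint_le Kb b ->
  (((\int[mu]_x (f x * b x)) ^+ 2)%:E
     <= (\int[mu]_x (f x ^+ 2)%:E) * Kb%:E)%E.
Proof.
move=> mf Kb0 bK.
have [->|] := eqVneq (\int[mu]_x (f x ^+ 2)%:E)%E +oo%E.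
  by rewrite gt0_mulye ?leey ?lte_fin.
rewrite -ltey => flt.
have fi : sqint f.
  apply: rint_sqint => //; apply/integrableP; split.
    by apply/measurable_EFinP; exact: measurable_funX.
  rewrite (le_lt_trans _ flt)// le_eqVlt; apply/orP; left.
  by apply/eqP/eq_integral => x _; rewrite /= ger0_norm// sqr_ge0.
have bi : sqint b by exists Kb.
rewrite RintegralE; last exact: sqint_rint.
rewrite -EFinM lee_fin; set F := \int[mu]_x (f x ^+ 2).
set I := \int[mu]_x (f x * b x).
have := sqint_le_Rintegral bK; set Bb := \int[mu]_x (b x ^+ 2) => BbK.
pose t := I / Kb.
have : 0 <= \int[mu]_x ((f x - t * b x) ^+ 2).
  by apply: Rintegral_ge0 => x _; exact: sqr_ge0.
have -> : \int[mu]_x ((f x - t * b x) ^+ 2) = F - 2 * t * I + t ^+ 2 * Bb.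
  transitivity (\int[mu]_x (f x ^+ 2 - 2 * t * (f x * b x) + t ^+ 2 * b x ^+ 2)).
    by apply: eq_Rintegral => x _; ring.
  have ffi := sqint_rint fi; have bbi := sqint_rint bi.
  have fbi := sqint_mul fi bi.
  rewrite RintegralD//; [|by apply: rintB => //; exact: rintZ|exact: rintZ].
  rewrite RintegralB//; last exact: rintZ.
  by rewrite !RintegralZl.
have tI : t * Kb = I by rewrite /t divfK// gt_eqF.
rewrite -tI => h; have : t ^+ 2 * Bb <= t ^+ 2 * Kb.
  by rewrite ler_wpM2l// sqr_ge0.
move=> h2; have : 0 <= F - t ^+ 2 * Kb by nra.
by rewrite exprMn => h3; nra.
Qed.

End RealIntegrals.

Lemma rint_cst d (T : measurableType d) {R : realType} (P : probability T R)
  (c : R) : rint P (fun=> c).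
Proof. by apply: finite_measure_integrable_cst. Qed.

Lemma sqint_cst d (T : measurableType d) {R : realType} (P : probability T R)
  (c : R) : sqint P (fun=> c).
Proof. by apply: rint_sqint => //; exact: rint_cst. Qed.

Lemma sqint_rint1 d (T : measurableType d) {R : realType} (P : probability T R)
  (f : T -> R) : sqint P f -> rint P f.
Proof.
move=> fi; have := sqint_mul fi (sqint_cst P 1).
by under [X in rint _ X]eq_fun do rewrite mulr1.
Qed.

(** * Integrating out an independent variable *)

Section Freezing.
Context dO (Omega : measurableType dO) {R : realType}.
Variable P : probability Omega R.
Context d (M : measurableType d).
Context d1 (E1 : measurableType d1) d2 (E2 : measurableType d2).
Variables (X1 : {mfun Omega >-> E1}) (X2 : {mfun Omega >-> E2}).

Definition independent_maps := forall A C, measurable A -> measurable C ->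
  P (X1 @^-1` A `&` X2 @^-1` C) = (P (X1 @^-1` A) * P (X2 @^-1` C))%E.

Hypothesis indep : independent_maps.

Local Notation P1 := (distribution P X1).
Local Notation P2 := (distribution P X2).

Let X12 (w : Omega) := (X1 w, X2 w).

Let mX12 : measurable_fun setT X12.
Proof. by apply: measurable_fun_pair => //; exact: measurable_funPT. Qed.

Let law_pair (S : set (E1 * E2)) : measurable S ->
  (P1 \x P2)%E S = distribution P (mfun_Sub (mem_set mX12)) S.
Proof.
by move=> mS; exact: product_measure_unique.
Qed.

(** Independence says that the joint law of [X1] and [X2] is the product of
    their laws. *)
Lemma ge0_integral_independent (phi : E1 * E2 -> \bar R) :
  measurable_fun setT phi -> (forall x, 0 <= phi x)%E ->
  (\int[P]_w phi (X1 w, X2 w) = \int[P1]_x \int[P2]_y phi (x, y))%E.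
Proof.
move=> mphi phi0; rewrite -fubini_tonelli1//.
rewrite (@eq_measure_integral _ _ _ _ (distribution P (mfun_Sub (mem_set mX12))))//.
  by rewrite ge0_integral_distribution.
by move=> A mA _; exact: law_pair.
Qed.

Lemma integrable_independent (phi : E1 * E2 -> \bar R) :
  measurable_fun setT phi -> P.-integrable setT (fun w => phi (X1 w, X2 w)) ->
  (P1 \x P2)%E.-integrable setT phi.
Proof.
move=> mphi /integrableP[_ phi_fin]; apply/integrableP; split => //.
rewrite fubini_tonelli1//; last exact: measurableT_comp.
have mabs : measurable_fun setT (abse \o phi) by exact: measurableT_comp.
have := ge0_integral_independent mabs (fun=> abse_ge0 _).
by rewrite /= /fubini_F => <-.
Qed.

Lemma integral_independent (phi : E1 * E2 -> \bar R) :
  measurable_fun setT phi -> P.-integrable setT (fun w => phi (X1 w, X2 w)) ->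
  (\int[P]_w phi (X1 w, X2 w) = \int[P1 \x P2]_x phi x)%E.
Proof.
move=> mphi phi_int.
rewrite (@eq_measure_integral _ _ _ _ (distribution P (mfun_Sub (mem_set mX12))))//.
  by rewrite integral_distribution.
by move=> A mA _; exact: law_pair.
Qed.

(** The second moment of the product is the product of the second moments;
    without independence the product would only be integrable. *)
Lemma sqint_independent (a : E1 -> R) (b : E2 -> R) :
  measurable_fun setT a -> measurable_fun setT b ->
  sqint P (a \o X1) -> sqint P (b \o X2) ->
  sqint P (fun w => a (X1 w) * b (X2 w)).
Proof.
move=> ma mb [Ka [mXa aK]] [Kb [mXb bK]]; exists (Ka * Kb); split.
  exact: measurable_funM.
have ma2 : measurable_fun setT (fun x => (a x ^+ 2)%:E).
  by apply/measurable_EFinP; exact: measurable_funX.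
have mb2 : measurable_fun setT (fun x => (b x ^+ 2)%:E).
  by apply/measurable_EFinP; exact: measurable_funX.
have a0 x : (0 <= (a x ^+ 2)%:E)%E by rewrite lee_fin sqr_ge0.
have b0 x : (0 <= (b x ^+ 2)%:E)%E by rewrite lee_fin sqr_ge0.
have aK' : (\int[P1]_x (a x ^+ 2)%:E <= Ka%:E)%E.
  by rewrite ge0_integral_distribution.
have bK' : (\int[P2]_x (b x ^+ 2)%:E <= Kb%:E)%E.
  by rewrite ge0_integral_distribution.
rewrite (@ge0_integral_independent (fun z => ((a z.1 * b z.2) ^+ 2)%:E)).
- rewrite (eq_integral (fun x => (a x ^+ 2)%:E * \int[P2]_y (b y ^+ 2)%:E)%E).
    rewrite ge0_integralZr//; last exact: integral_ge0.
    by rewrite EFinM lee_pmul// integral_ge0.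
  move=> x _ /=; rewrite -ge0_integralZl// ?lee_fin ?sqr_ge0//.
  by apply: eq_integral => y _; rewrite exprMn EFinM.
- apply/measurable_EFinP/measurable_funX/measurable_funM.
    exact: measurableT_comp ma measurable_fst.
  exact: measurableT_comp mb measurable_snd.
- by move=> x; rewrite lee_fin sqr_ge0.
Qed.

Variables (g : (M * E1) * E2 -> R) (b : E2 -> R).
Hypotheses (mg : measurable_fun setT g) (mb : measurable_fun setT b).

(** The version of the conditional expectation of [g z X1 X2 * b X2] given [X1]
    in which [X1] is frozen and [X2] is integrated out. *)
Definition freeze (z : M * E1) : R := \int[P2]_y (g (z, y) * b y).

Lemma measurable_freeze : measurable_fun setT freeze.
Proof.
have mgb : measurable_fun setT
    (fun x : (M * E1) * E2 => (g x * b x.2)%:E).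
  apply/measurable_EFinP/measurable_funM => //.
  exact: measurableT_comp mb measurable_snd.
apply: measurableT_comp => //.
have -> : (fun z => \int[P2]_y (g (z, y) * b y)%:E)%E
  = (fun z => \int[P2]_y ((fun x => (g x * b x.2)%:E)^\+ (z, y))
            - \int[P2]_y ((fun x => (g x * b x.2)%:E)^\- (z, y)))%E.
  apply/funext => z; rewrite integralE; congr (_ - _)%E; apply: eq_integral => y _.
    by rewrite !funeposE.
  by rewrite !funenegE.
apply: emeasurable_funB.
  by apply: measurable_fun_fubini_tonelli_F => //; exact: measurable_funepos.
by apply: measurable_fun_fubini_tonelli_F => //; exact: measurable_funeneg.
Qed.

(** Fubini for the product law, the factor depending on [X1] only being pulled
    out of the inner integral. *)
Lemma freeze_pairing (z : M) (s : E1 -> R) : measurable_fun setT s ->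
  rint P (fun w => s (X1 w) * (g ((z, X1 w), X2 w) * b (X2 w))) ->
  rint P (fun w => s (X1 w) * freeze (z, X1 w)) /\
  \int[P]_w (s (X1 w) * (g ((z, X1 w), X2 w) * b (X2 w)))
  = \int[P]_w (s (X1 w) * freeze (z, X1 w)).
Proof.
move=> ms sgb.
pose phi (x : E1 * E2) := (s x.1 * (g ((z, x.1), x.2) * b x.2))%:E.
have mphi : measurable_fun setT phi.
  apply/measurable_EFinP/measurable_funM.
    exact: measurableT_comp ms measurable_fst.
  apply: measurable_funM; last exact: measurableT_comp mb measurable_snd.
  apply: measurableT_comp mg _; apply: measurable_fun_pair => //.
  apply: measurable_fun_pair => //.
have phi_int : (P1 \x P2)%E.-integrable setT phi by exact: integrable_independent.
have ms_freeze : measurable_fun setT (fun x => (s x * freeze (z, x))%:E).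
  apply/measurable_EFinP/measurable_funM => //.
  by apply: measurableT_comp measurable_freeze _; exact: measurable_pair1.
have ae_eq : {ae P1, forall x, setT x ->
    (\int[P2]_y phi (x, y) = (s x * freeze (z, x))%:E)%E}.
  apply: filterS (ae_integrable1 phi_int) => x phix _.
  have [s0|s0] := eqVneq (s x) 0.
    rewrite s0 mul0r; under eq_integral do rewrite /phi/= s0 mul0r.
    by rewrite integral0.
  have gb : P2.-integrable setT (fun y => (g ((z, x), y) * b y)%:E).
    have := integrableZl measurableT (s x)^-1 phix.
    apply: eq_integrable => // y _.
    by rewrite /phi/= -EFinM mulKf.
  under eq_integral do rewrite /phi/= EFinM.
  rewrite integralZl// /freeze EFinM; congr (_ * _)%E.
  by rewrite RintegralE.
have freeze_int : P1.-integrable setT (fun x => (s x * freeze (z, x))%:E).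
  apply/integrableP; split=> //.
  have /integrableP[_] := integrable_fubini_F phi_int.
  congr (_ < _)%E; apply: ae_eq_integral => //.
  - apply: measurableT_comp => //; exact: measurable_fubini_F phi_int.
  - exact: measurableT_comp.
  - by apply: filterS ae_eq => x + _ => /(_ I); rewrite /fubini_F => ->.
have freeze_intP : rint P (fun w => s (X1 w) * freeze (z, X1 w)).
  apply/integrableP; split.
    by apply: measurableT_comp ms_freeze _; exact: measurable_funPT.
  have /integrableP[_] := freeze_int.
  rewrite ge0_integral_distribution//; exact: measurableT_comp.
split=> //; apply: EFin_inj; rewrite -!RintegralE//.
rewrite (integral_independent mphi)// -integral12_prod_meas1//.
rewrite -(@integral_distribution _ _ _ _ _ P X1
  (fun x => (s x * freeze (z, x))%:E))//.
apply: ae_eq_integral => //; first exact: measurable_fubini_F phi_int.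
Qed.

(** Cauchy-Schwarz in the frozen integral. The bound is the same for every [z]
    for which [K] is. *)
Lemma freeze_sqint (z : M) (K Kb : R) : 0 < Kb ->
  sqint_le P K (fun w => g ((z, X1 w), X2 w)) -> sqint_le P Kb (b \o X2) ->
  sqint_le P (K * Kb) (fun w => freeze (z, X1 w)).
Proof.
move=> Kb0 [_ gK] [_ bK].
have mfr : measurable_fun setT (fun x => freeze (z, x)).
  by apply: measurableT_comp measurable_freeze _; exact: measurable_pair1.
split; first by apply: measurableT_comp mfr _; exact: measurable_funPT.
have mgz : measurable_fun setT (fun x : E1 * E2 => g ((z, x.1), x.2)).
  apply: measurableT_comp mg _; apply: measurable_fun_pair => //.
  exact: measurable_fun_pair.
have b2K : sqint_le P2 Kb b.
  split=> //; rewrite ge0_integral_distribution//.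
    by apply/measurable_EFinP; exact: measurable_funX.
  by move=> y; rewrite lee_fin sqr_ge0.
have mg2 : measurable_fun setT (fun x : E1 * E2 => (g ((z, x.1), x.2) ^+ 2)%:E).
  by apply/measurable_EFinP; exact: measurable_funX.
rewrite -(@ge0_integral_distribution _ _ _ _ _ P X1
  (fun x => (freeze (z, x) ^+ 2)%:E)) ?/=.
- apply: (@le_trans _ _ (\int[P1]_x ((\int[P2]_y (g ((z, x), y) ^+ 2)%:E)
      * Kb%:E))%E).
    apply: ge0_le_integral => //.
    + by move=> x _; rewrite lee_fin sqr_ge0.
    + by apply/measurable_EFinP; exact: measurable_funX.
    + apply: emeasurable_funM => //.
      apply: (@measurable_fun_fubini_tonelli_F _ _ _ _ _ _
        (fun x : E1 * E2 => (g ((z, x.1), x.2) ^+ 2)%:E)) => // x.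
      by rewrite lee_fin sqr_ge0.
    move=> x _; apply: cauchy_schwarz_integral => //.
    by apply: measurableT_comp mg _; exact: measurable_pair1.
  rewrite ge0_integralZr//=.
  + rewrite EFinM lee_wpmul2r ?lee_fin ?(ltW Kb0)//.
    rewrite -(@ge0_integral_independent (fun x => (g ((z, x.1), x.2) ^+ 2)%:E))//.
    by move=> x; rewrite lee_fin sqr_ge0.
  + apply: (@measurable_fun_fubini_tonelli_F _ _ _ _ _ _
      (fun x : E1 * E2 => (g ((z, x.1), x.2) ^+ 2)%:E)) => // x.
    by rewrite lee_fin sqr_ge0.
  + by move=> x _; apply: integral_ge0 => y _; rewrite lee_fin sqr_ge0.
  + by rewrite lee_fin ltW.
- by apply/measurable_EFinP; exact: measurable_funX.
- by move=> x; rewrite lee_fin sqr_ge0.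
Qed.

End Freezing.

(** * The noise filtration and its conditional expectations *)

Section Independence.
Context dO (Omega : measurableType dO) {R : realType}.
Variable P : probability Omega R.
Context {d : nat} (N : nat).
Variable B : nat -> Omega -> 'cV[R]_d.
Hypothesis B_rv : forall k, (0 < k <= N)%N -> random_vector (B k).
Hypothesis B_indep : independent_vectors P N B.

Definition past_events (k : nat) : set (set Omega) :=
  \bigcup_(j in [set j | (0 < j <= k)%N]) vec_events (B j).

(** Copies of the sample space, so that measurability with respect to F_k,
    resp. to sigma(B (k+1)), becomes measurability on a type. *)
Definition Past k := g_sigma_algebraType (past_events k).
Definition Noise k := g_sigma_algebraType (vec_events (B k.+1)).

Lemma vec_events_measurable k : (0 < k <= N)%N ->
  <<s vec_events (B k) >> `<=` measurable.
Proof.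
move=> kN; apply: smallest_sub; first exact: sigma_algebra_measurable.
move=> _ [i [Y [mY ->]]]; rewrite -[X in measurable X]setTI.
exact: B_rv.
Qed.

Lemma filtration_measurable k : (k <= N)%N -> filtration B k `<=` measurable.
Proof.
move=> kN; apply: smallest_sub; first exact: sigma_algebra_measurable.
move=> A [j /= /andP[j0 jk] jA]; apply: (@vec_events_measurable j).
  by rewrite j0 (leq_trans jk).
exact: sub_sigma_algebra.
Qed.

Lemma filtrationW k l : (k <= l)%N -> filtration B k `<=` filtration B l.
Proof.
move=> kl; apply: sub_sigma_algebra2; apply: bigcup_sub => j /= /andP[j0 jk].
by apply: (@bigcup_sup _ _ j) => /=; rewrite j0 (leq_trans jk).
Qed.

Lemma noise_filtration k : <<s vec_events (B k.+1) >> `<=` filtration B k.+1.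
Proof.
by apply: sub_sigma_algebra2; apply: (@bigcup_sup _ _ k.+1) => /=; rewrite leqnn.
Qed.

(** Finite intersections of events of the separate sigma(B j) form a pi-system
    generating F_k. *)
Let cylinders k : set (set Omega) := [set A | exists D : 'I_N -> set Omega,
  (forall j : 'I_N, <<s vec_events (B j.+1) >> (D j)) /\
  A = \big[setI/setT]_(j < N | (j < k)%N) D j].

Let cylinders_setI k : setI_closed (cylinders k).
Proof.
move=> _ _ [D1 [D1B ->]] [D2 [D2B ->]]; exists (fun j => D1 j `&` D2 j).
split; last by rewrite big_split.
move=> j; have mI := @measurableI _ (g_sigma_algebraType (vec_events (B j.+1))).
exact: mI (D1B j) (D2B j).
Qed.

Let cylinders_past k : (k <= N)%N -> past_events k `<=` cylinders k.
Proof.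
move=> kN A [[//|j] /= jk jA].
have jN : (j < N)%N by rewrite (leq_trans jk).
exists (fun i => if i == Ordinal jN then A else setT); split.
  move=> i; case: eqP => [->|_]; first exact: sub_sigma_algebra.
  exact: (@measurableT _ (g_sigma_algebraType (vec_events (B i.+1)))).
rewrite (bigD1 (Ordinal jN))//= eqxx big1 ?setIT//.
by move=> i /andP[_ /negbTE->].
Qed.

Let cylinders_indep k A C : (k < N)%N -> cylinders k A ->
  <<s vec_events (B k.+1) >> C -> P (A `&` C) = (P A * P C)%E.
Proof.
move=> kN [D [DB ->]] BC; pose K := Ordinal kN.
pose D' (i : 'I_N) := if i == K then C else D i.
have D'B (i : 'I_N) : <<s vec_events (B i.+1) >> (D' i).
  by rewrite /D'; case: eqP => // ->.
have D'E (i : 'I_N) : (i < k)%N -> D' i = D i.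
  by rewrite /D'; case: eqP => // ->; rewrite ltnn.
have indep_pred (p : pred 'I_N) (D0 : 'I_N -> set Omega) :
    (forall i : 'I_N, <<s vec_events (B i.+1) >> (D0 i)) ->
    P (\big[setI/setT]_(i | p i) D0 i) = (\prod_(i | p i) P (D0 i))%E.
  move=> /(B_indep (finset p)).
  by under eq_bigl do rewrite inE; under [in RHS]eq_bigl do rewrite inE.
have EJ (i : 'I_N) : (i < k.+1)%N && (i != K) = (i < k)%N.
  by rewrite ltnS ltn_neqAle andbC.
have := indep_pred (fun i => i < k.+1)%N D' D'B.
rewrite (bigD1 K)//= [in RHS](bigD1 K)//=.
under eq_bigl do rewrite EJ.
under [in RHS]eq_bigl do rewrite EJ.
rewrite (eq_bigr D) => [|i]; last by move=> /D'E.
rewrite [in RHS](eq_bigr (P \o D)) => [|i]; last by move=> /D'E/= ->.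
by rewrite [D' K]/D' eqxx setIC => ->; rewrite -indep_pred// muleC.
Qed.

(** The class of events independent of a fixed event of sigma(B (k+1)) is a
    Dynkin system, so it is enough to know it on the pi-system above. *)
Lemma past_noise_indep k A C : (k < N)%N ->
  filtration B k A -> <<s vec_events (B k.+1) >> C ->
  P (A `&` C) = (P A * P C)%E.
Proof.
move=> kN FA BC.
have mC : measurable C by apply: vec_events_measurable BC; rewrite ltnS/=.
have cyl_meas : <<s cylinders k >> `<=` measurable.
  apply: smallest_sub; first exact: sigma_algebra_measurable.
  move=> _ [D [DB ->]]; apply: bigsetI_measurable => j _.
  by apply: vec_events_measurable (DB j) => //=; rewrite ltn_ord.
have finP X : measurable X -> P X \is a fin_num by move=> ?; exact: fin_num_measure.
have compl (S : set Omega) : measurable S -> P (S `&` C) = (P S * P C)%E ->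
    P (~` S `&` C) = (P (~` S) * P C)%E.
  move=> mS SC; have -> : P (~` S) = (1 - P S)%E by exact: probability_setC.
  have -> : P (~` S `&` C) = (P C - P (S `&` C))%E.
    by rewrite setIC -setDE setIC; apply: measureD; rewrite // ltey_eq finP.
  by rewrite SC muleBl ?finP// ?mul1e// fin_num_adde_defr.
have count (F : (set Omega)^nat) : (forall j, measurable (F j)) ->
    trivIset setT F -> (forall j, P (F j `&` C) = (P (F j) * P C)%E) ->
    P (\bigcup_j F j `&` C) = (P (\bigcup_j F j) * P C)%E.
  move=> mF tF FC.
  have -> : P (\bigcup_j F j) = (\sum_(j <oo) P (F j))%E.
    by apply: measure_semi_bigcup => //; exact: bigcupT_measurable.
  have -> : P (\bigcup_j F j `&` C) = (\sum_(j <oo) P (F j `&` C))%E.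
    rewrite setI_bigcupl; apply: measure_semi_bigcup.
    - by move=> j; exact: measurableI.
    - exact: trivIset_setIr.
    - by apply: bigcupT_measurable => j; exact: measurableI.
  rewrite muleC -(fineK (finP _ mC)) -nneseriesZl//.
  by apply: eq_eseriesr => j _; rewrite FC fineK ?finP// muleC.
apply: (@dynkin_induction _ (g_sigma_algebraType (cylinders k)) (cylinders k)
  (fun X => P (X `&` C) = (P X * P C)%E)) => //.
- by rewrite setTI probability_setT mul1e.
- by move=> X Xc; exact: (cylinders_indep kN Xc BC).
- by move=> S /cyl_meas mS SC; exact: compl.
- move=> F mF tF FC; apply: count => // j; exact: cyl_meas (mF j).
apply: sub_sigma_algebra2 FA; exact: cylinders_past (ltnW kN).
Qed.

Lemma measurable_past_id k : (k <= N)%N ->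
  measurable_fun setT (id : Omega -> Past k).
Proof.
move=> kN _ A mA; rewrite setTI preimage_id.
exact: filtration_measurable mA.
Qed.

Lemma measurable_noise_id k : (k < N)%N ->
  measurable_fun setT (id : Omega -> Noise k).
Proof.
move=> kN _ A mA; rewrite setTI preimage_id.
by apply: vec_events_measurable mA; rewrite ltnS.
Qed.

Lemma past_meas k (f : Omega -> R) : (k <= N)%N ->
  measurable_fun setT (f : Past k -> R) -> measurable_fun setT f.
Proof. by move=> kN mf; exact: measurableT_comp mf (measurable_past_id kN). Qed.

Lemma noise_meas k (f : Omega -> R) : (k < N)%N ->
  measurable_fun setT (f : Noise k -> R) -> measurable_fun setT f.
Proof. by move=> kN mf; exact: measurableT_comp mf (measurable_noise_id kN). Qed.

Lemma past_measW k l (f : Omega -> R) : (k <= l)%N ->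
  measurable_fun setT (f : Past k -> R) -> measurable_fun setT (f : Past l -> R).
Proof. by move=> kl mf _ Y mY; exact: filtrationW (mf _ _ mY). Qed.

Lemma noise_past_meas k (f : Omega -> R) :
  measurable_fun setT (f : Noise k -> R) ->
  measurable_fun setT (f : Past k.+1 -> R).
Proof. by move=> mf _ Y mY; exact: noise_filtration (mf _ _ mY). Qed.

Lemma noise_meas_coord k i :
  measurable_fun setT ((fun w => B k.+1 w i 0) : Noise k -> R).
Proof.
move=> _ Y mY; rewrite setTI; apply: sub_sigma_algebra.
by exists i, Y.
Qed.

Lemma adapted_meas k a c (X : Omega -> 'M[R]_(a, c)) i j :
  adapted_to (filtration B k) X ->
  measurable_fun setT ((fun w => X w i j) : Past k -> R).
Proof. by move=> aX _ Y mY; rewrite setTI; exact: aX. Qed.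

Lemma meas_adapted k a c (X : Omega -> 'M[R]_(a, c)) :
  (forall i j, measurable_fun setT ((fun w => X w i j) : Past k -> R)) ->
  adapted_to (filtration B k) X.
Proof.
by move=> mX i j Y mY; have := mX i j measurableT Y mY; rewrite setTI.
Qed.

Let Xpast k (kN : (k < N)%N) : {mfun Omega >-> Past k} :=
  mfun_Sub (mem_set (measurable_past_id (ltnW kN))).

Let Xnoise k (kN : (k < N)%N) : {mfun Omega >-> Noise k} :=
  mfun_Sub (mem_set (measurable_noise_id kN)).

Let indep_past_noise k (kN : (k < N)%N) :
  independent_maps P (Xpast kN) (Xnoise kN).
Proof. by move=> A C mA mC; exact: (past_noise_indep kN mA mC). Qed.

Lemma sqint_past_noise k (a b : Omega -> R) : (k < N)%N ->
  measurable_fun setT (a : Past k -> R) ->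
  measurable_fun setT (b : Noise k -> R) ->
  sqint P a -> sqint P b -> sqint P (fun w => a w * b w).
Proof.
by move=> kN ma mb a2 b2; exact: (sqint_independent (indep_past_noise kN) ma mb).
Qed.

(** Conditional expectation of [F * b] given F_k, with [b] a function of the
    next noise. Abstract conditional expectations are determined, for each
    value of the parameter, only up to a null set, so joint measurability would
    be lost; here the version is explicit: [F] factors through the past and the
    next noise, and the noise is integrated out. *)
Lemma joint_condexp d' (M : measurableType d') k (F : M -> Omega -> R)
    (b : Omega -> R) : (k < N)%N ->
  measurable_fun setT ((fun z => F z.1 z.2) : M * Past k.+1 -> R) ->
  measurable_fun setT (b : Noise k -> R) ->
  exists H : M -> Omega -> R,
  [/\ measurable_fun setT ((fun z => H z.1 z.2) : M * Past k -> R),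
      forall (z : M) (s : Omega -> R), measurable_fun setT (s : Past k -> R) ->
        rint P (fun w => s w * (F z w * b w)) ->
        rint P (fun w => s w * H z w) /\
        \int[P]_w (s w * (F z w * b w)) = \int[P]_w (s w * H z w) &
      forall (z : M) (K Kb : R), 0 < Kb ->
        sqint_le P K (F z) -> sqint_le P Kb b -> sqint_le P (K * Kb) (H z)].
Proof.
move=> kN mF mb.
have gen A : past_events k.+1 A ->
    <<s past_events k >> A \/ <<s vec_events (B k.+1) >> A.
  move=> [j /= /andP[j0]]; rewrite leq_eqVlt => /orP[/eqP->|jk] jA.
    by right; exact: sub_sigma_algebra.
  by left; apply: sub_sigma_algebra; exists j => //=; rewrite j0.
have [g mg gE] := doob_dynkin_split gen mF.
pose X1 := Xpast kN; pose X2 := Xnoise kN.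
have ind : independent_maps P X1 X2 := indep_past_noise kN.
have FE z w : F z w = g ((z, X1 w), X2 w) by exact: (gE z w).
exists (fun z w => freeze P X2 g b (z, X1 w)); split.
- have -> : (fun z : M * Past k => freeze P X2 g b (z.1, X1 z.2))
      = freeze P X2 g b by apply/funext => -[].
  exact: (measurable_freeze P X2 mg mb).
- move=> z s ms.
  have -> : (fun w => s w * (F z w * b w))
      = (fun w => s (X1 w) * (g ((z, X1 w), X2 w) * b (X2 w))).
    by apply/funext => w; rewrite FE.
  exact: (freeze_pairing ind mg mb ms).
- move=> z K Kb Kb0 FK bK; apply: (freeze_sqint ind mg mb Kb0) => //.
  by have -> : (fun w => g ((z, X1 w), X2 w)) = F z by apply/funext => w; rewrite FE.
Qed.

End Independence.

(** * Measurability of functions of a parameter *)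

Section Cells.
Context {R : realType}.

(** If a function is constant up to a vanishing error on the cells of a sequence
    of countable measurable partitions, it is the limit of the functions that
    evaluate it at a representative of the cell. This handles functions of the
    form F (z x) with z measurable and F continuous only on a set that need not
    be measurable: representatives are points of the domain of z. *)
Lemma measurable_cells d (X : measurableType d) (C : countType)
    (I : nat -> X -> C) (f : X -> R) :
  (forall j c, measurable [set x | I j x = c]) ->
  (forall x (e : R), 0 < e -> exists j0, forall j, (j0 <= j)%N ->
     forall x', I j x' = I j x -> `|f x' - f x| < e) ->
  measurable_fun setT f.
Proof.
move=> mI fI.
pose rep j c : X := xget point [set x | I j x = c].
have repE j x : I j (rep j (I j x)) = I j x.
  by apply: (@xgetPex _ point [set y | I j y = I j x]); exists x.
apply: (measurable_fun_cvg (h := fun j x => f (rep j (I j x)))) => [j|x _].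
  move=> _ Y mY; rewrite setTI.
  pose F (i : nat) := if @unpickle C i is Some c then
    if f (rep j c) \in Y then [set x | I j x = c] else set0 else set0.
  have -> : (fun x => f (rep j (I j x))) @^-1` Y = \bigcup_i F i.
    apply/seteqP; split=> [x Yx|x [i _]].
      exists (pickle (I j x)) => //; rewrite /F pickleK.
      by rewrite (mem_set (Yx : Y (f (rep j (I j x))))).
    rewrite /F; case: unpickle => [c|//]; case: ifPn => // /set_mem Yc /= xc.
    by rewrite /preimage/= xc.
  apply: bigcupT_measurable => i; rewrite /F; case: unpickle => [c|//].
  by case: ifP.
apply/cvgrPdist_lt => e e0; have [j0 H] := fI x e e0.
by apply: filterS (nbhs_infty_ge j0) => j /= j0j; rewrite distrC; exact: H (repE _ _).
Qed.

Lemma measurable_floor d (X : measurableType d) (f : X -> R) (a : R) (c : int) :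
  measurable_fun setT f -> measurable [set x | Num.floor (a * f x) = c].
Proof.
move=> mf; have maf : measurable_fun setT (fun x => a * f x).
  exact: measurable_funM.
rewrite (_ : [set x | _] = (fun x => a * f x) @^-1` `[c%:~R, (c + 1)%:~R[).
  by rewrite -[X in measurable X]setTI; exact: maf.
apply/seteqP; split=> x /=; rewrite in_itv/=.
  by move=> <-; rewrite Num.Theory.floor_itv.
by move=> /Num.Theory.floor_def.
Qed.

Definition floor_cell a (j : nat) (x : 'cV[R]_a) : 'cV[int]_a :=
  \col_i Num.floor (j.+1%:R * x i 0).

Lemma floor_cell_close a (j : nat) (x x' : 'cV[R]_a) :
  floor_cell j x = floor_cell j x' -> enorm (x - x') <= a%:R * j.+1%:R^-1.
Proof.
move=> xx'; apply: enorm_le_coord => i.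
have : floor_cell j x i 0 = floor_cell j x' i 0 by rewrite xx'.
rewrite !mxE => fE.
have /andP[l1 u1] := Num.Theory.floor_itv (j.+1%:R * x i 0).
have /andP[l2 u2] := Num.Theory.floor_itv (j.+1%:R * x' i 0).
rewrite fE intrD in l1 u1; rewrite intrD in u2.
have j0 : 0 < j.+1%:R :> R by [].
rewrite -[leRHS]mul1r ler_pdivlMr// mulrC -[X in X * _](gtr0_norm j0) -normrM.
by rewrite mulrBr ler_norml; apply/andP; split; lra.
Qed.

Lemma measurable_floor_cell d (X : measurableType d) a (f : X -> 'cV[R]_a) j c :
  (forall i, measurable_fun setT (fun x => f x i 0)) ->
  measurable [set x | floor_cell j (f x) = c].
Proof.
move=> mf.
rewrite (_ : [set x | _] = \big[setI/setT]_(i < a)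
    [set x | Num.floor (j.+1%:R * f x i 0) = c i 0]).
  by apply: bigsetI_measurable => i _; exact: measurable_floor.
apply/seteqP; split=> x /=.
  by move=> <-; rewrite -bigcap_seq => i _ /=; rewrite mxE.
rewrite -bigcap_seq => H; apply/matrixP => i k; rewrite ord1 mxE.
by apply: H; rewrite /= mem_index_enum.
Qed.

End Cells.

Section ParametrizedMeasurability.
Context {R : realType} {Gamma : pmetricType R}.

Lemma open_mball (x : Gamma) (e : R) : open [set y | mdist x y < e].
Proof.
rewrite openE => y /= xy; rewrite /interior.
apply/nbhs_ballP; exists (e - mdist x y); first by rewrite /= subr_gt0.
move=> z; rewrite ballEmdist/= ltrBrDl.
exact/le_lt_trans/metric_triangle.
Qed.

Lemma polish_dense_sequence : polish R Gamma ->
  exists s : nat -> Gamma, forall g (e : R), 0 < e -> exists i, mdist (s i) g < e.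
Proof.
move=> [[A /countable_injP[f f_inj] A_dense] _].
exists (fun i => xget point [set a | A a /\ f a = i]) => g e e0.
have [|a [ga Aa]] := A_dense [set y | mdist g y < e] _ (open_mball _ _).
  by exists g; rewrite /= mdistxx.
exists (f a); have ex_a : exists b, [set b | A b /\ f b = f a] b by exists a.
have [/= Ab fba] := xgetPex point ex_a.
by rewrite (f_inj _ _ _ _ fba) ?inE// metric_sym.
Qed.

Lemma open_borel (A : set Gamma) : open A -> measurable (A : set (borel Gamma)).
Proof. exact: sub_sigma_algebra. Qed.

Definition equicontinuous_on {n m} (U : set 'cV[R]_m)
    (chi : Gamma -> 'cV[R]_n -> 'cV[R]_m -> R) :=
  forall x u, U u -> forall e : R, 0 < e -> exists2 delta : R, 0 < delta &
    forall g x' u', U u' -> enorm (x' - x) + enorm (u' - u) < delta ->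
      `|chi g x' u' - chi g x u| < e.

Definition parameter_continuous {n m} (U : set 'cV[R]_m)
    (chi : Gamma -> 'cV[R]_n -> 'cV[R]_m -> R) :=
  forall x u, U u -> forall g (e : R), 0 < e -> exists2 delta : R, 0 < delta &
    forall g', mdist g g' < delta -> `|chi g' x u - chi g x u| < e.

(** Every coefficient and every entry of every derivative satisfies this; it is
    all that measurability and continuity in the parameter need. *)
Definition regular_coef {n m} (U : set 'cV[R]_m)
    (chi : Gamma -> 'cV[R]_n -> 'cV[R]_m -> R) :=
  equicontinuous_on U chi /\ parameter_continuous U chi.

Lemma regular_coef_close {n m} U (chi : Gamma -> 'cV[R]_n -> 'cV[R]_m -> R)
    g x u (e : R) : regular_coef U chi -> U u -> 0 < e ->
  exists2 delta : R, 0 < delta & forall g' x' u', U u' ->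
    mdist g g' < delta -> enorm (x' - x) + enorm (u' - u) < delta ->
    `|chi g' x' u' - chi g x u| < e.
Proof.
move=> [eq_xu cont_g] Uu e0; have e20 : 0 < e / 2 by rewrite divr_gt0.
have [d1 d10 H1] := eq_xu x u Uu _ e20.
have [d2 d20 H2] := cont_g x u Uu g _ e20.
exists (Num.min d1 d2); first by rewrite lt_min d10.
move=> g' x' u' Uu'; rewrite !lt_min => /andP[_ gg'] /andP[xu _].
rewrite [e]splitr; have := ltrD (H1 g' x' u' Uu' xu) (H2 g' gg').
apply: le_lt_trans; rewrite (le_trans _ (ler_normD _ _))//.
by rewrite addrA subrK.
Qed.

Hypothesis Gamma_polish : polish R Gamma.

(** The cells are indexed by the first point of a dense sequence close to the
    parameter, and by the integer parts of the scaled coordinates of state and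
    control. *)
Lemma regular_coef_measurable {n m} U (chi : Gamma -> 'cV[R]_n -> 'cV[R]_m -> R)
    dE (E : measurableType dE) (X : Gamma -> E -> 'cV[R]_n) (u : E -> 'cV[R]_m) :
  regular_coef U chi -> (forall w, U (u w)) ->
  (forall i, measurable_fun setT (fun z : borel Gamma * E => X z.1 z.2 i 0)) ->
  (forall i, measurable_fun setT (fun w => u w i 0)) ->
  measurable_fun setT (fun z : borel Gamma * E => chi z.1 (X z.1 z.2) (u z.2)).
Proof.
move=> chi_reg Uu mX mu; have [s s_dense] := polish_dense_sequence Gamma_polish.
have near_ex j g : exists i, mdist (s i) g < j.+1%:R^-1 by exact: s_dense.
pose near j g := ex_minn (near_ex j g).
pose cell (j : nat) (z : borel Gamma * E) : nat * ('cV[int]_n * 'cV[int]_m) :=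
  (near j z.1, (floor_cell j (X z.1 z.2), floor_cell j (u z.2))).
apply: (measurable_cells (I := cell)) => [j [i [cx cu]]|z e e0].
  rewrite (_ : [set z | _] = (fst @^-1` [set g | near j g = i]) `&`
    ([set z | floor_cell j (X z.1 z.2) = cx]
     `&` [set z | floor_cell j (u z.2) = cu])); last first.
    apply/seteqP; split=> z; rewrite /setI/preimage/cell/=.
      by move=> [-> -> ->].
    by move=> [-> [-> ->]].
  apply: measurableI; last apply: measurableI.
  - rewrite -[X in measurable X]setTI; apply: measurable_fst => //.
    rewrite (_ : [set g | _] = [set g | mdist (s i) g < j.+1%:R^-1] `&`
      \big[setI/setT]_(l < i) ~` [set g | mdist (s l) g < j.+1%:R^-1]).
      have mball l : measurable
          ([set g | mdist (s l) g < j.+1%:R^-1] : set (borel Gamma)).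
        exact: (open_borel (open_mball (s l) j.+1%:R^-1)).
      apply: (@measurableI _ (borel Gamma)); first exact: mball.
      apply: (@bigsetI_measurable _ (borel Gamma)) => l _.
      by apply: (@measurableC _ (borel Gamma)); exact: mball.
    apply/seteqP; split=> g /=; rewrite /near; case: ex_minnP => k sk kmin.
      move=> <-; split=> //; rewrite -bigcap_seq => l _ /= sl.
      by have := kmin _ sl; rewrite leqNgt ltn_ord.
    move=> [si]; rewrite -bigcap_seq => H; apply/eqP; rewrite eqn_leq kmin//=.
    rewrite leqNgt; apply/negP => ki.
    by apply: (H (Ordinal ki)) sk; rewrite /= mem_index_enum.
  - exact: (measurable_floor_cell (f := fun z : borel Gamma * E => X z.1 z.2)).
  - apply: (measurable_floor_cell (f := fun z : borel Gamma * E => u z.2)) => l.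
    exact: measurableT_comp (mu l) measurable_snd.
have [delta d0 H] := regular_coef_close z.1 (X z.1 z.2) chi_reg (Uu z.2) e0.
pose K : R := n%:R + m%:R + 2.
have K0 : 0 < K by rewrite ltr_wpDl// addr_ge0.
exists (Num.truncn (K / delta)) => j jK z' [nE xE uE].
have jd : K * j.+1%:R^-1 < delta.
  rewrite ltr_pdivrMr// mulrC -ltr_pdivrMr//.
  by rewrite (lt_le_trans (Num.Theory.truncnS_gt _))// ler_nat ltnS.
have j0 : 0 < j.+1%:R^-1 :> R by rewrite invr_gt0.
have small (a : R) : a <= K -> a * j.+1%:R^-1 < delta.
  by move=> aK; rewrite (le_lt_trans _ jd)// ler_wpM2r// ltW.
have n0 : 0 <= n%:R :> R by []. have m0 : 0 <= m%:R :> R by [].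
apply: H => //.
  apply: le_lt_trans (small 2 _); last by rewrite /K; lra.
  rewrite (le_trans (metric_triangle _ (s (near j z.1)) _))//.
  rewrite mulrDl mul1r lerD// ltW//.
    by rewrite metric_sym /near; case: ex_minnP.
  by rewrite -nE /near; case: ex_minnP.
apply: le_lt_trans (small (n%:R + m%:R) _); last by rewrite /K; lra.
by rewrite mulrDl lerD// floor_cell_close.
Qed.

Lemma regular_coef_cvg {n m} U (chi : Gamma -> 'cV[R]_n -> 'cV[R]_m -> R)
    (X : Gamma -> 'cV[R]_n) (u : 'cV[R]_m) (g : Gamma) (s : nat -> Gamma) :
  regular_coef U chi -> U u -> (fun j => mdist g (s j)) @ \oo --> 0 ->
  (fun j => enorm (X (s j) - X g)) @ \oo --> 0 ->
  (fun j => chi (s j) (X (s j)) u) @ \oo --> chi g (X g) u.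
Proof.
move=> chi_reg Uu sg Xg; apply/cvgrPdist_lt => e e0.
have [delta d0 H] := regular_coef_close g (X g) chi_reg Uu e0.
move/cvgrPdist_lt : sg => /(_ _ d0) sg.
move/cvgrPdist_lt : Xg => /(_ _ d0) Xg.
near=> j; rewrite distrC; apply: H => //.
  have : `|0 - mdist g (s j)| < delta by near: j.
  by rewrite sub0r normrN ger0_norm// mdist_ge0.
have : `|0 - enorm (X (s j) - X g)| < delta by near: j.
by rewrite sub0r normrN subrr enorm0 addr0 ger0_norm// enorm_ge0.
Unshelve. all: by end_near.
Qed.

End ParametrizedMeasurability.

(** * Pathwise estimates for the controlled state *)

Section Domination.
Context {R : realType} {Omega : Type} {d : nat}.
Variables (B : nat -> Omega -> 'cV[R]_d) (K : R).

(** The scalar recursion that dominates, at a fixed sample point, the state, the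
    difference of two states and the linearisation error; nothing in it depends
    on the parameter, which makes all estimates uniform over it. *)
Fixpoint dom (a : nat -> Omega -> R) (x : R) (k : nat) (w : Omega) : R :=
  if k is j.+1 then K * (1 + enorm (B j.+1 w)) * (dom a x j w + a j w) else x.

Hypothesis K_ge0 : 0 <= K.

Lemma dom_factor_ge0 k w : 0 <= K * (1 + enorm (B k w)).
Proof. by rewrite mulr_ge0// addr_ge0// enorm_ge0. Qed.

Lemma dom_ge0 a x k w : 0 <= x -> (forall j, 0 <= a j w) -> 0 <= dom a x k w.
Proof.
move=> x0 a0; elim: k => //= k IH.
by rewrite mulr_ge0 ?dom_factor_ge0// addr_ge0.
Qed.

Lemma dom_scale (t : R) a k w :
  dom (fun j w => t * a j w) 0 k w = t * dom a 0 k w.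
Proof.
elim: k => [|k IH] /=; first by rewrite mulr0.
by rewrite IH -mulrDr mulrCA.
Qed.

Lemma dom_cvg0 (a : nat -> nat -> Omega -> R) k w :
  (forall l, (fun j => a j l w) @ \oo --> 0) ->
  (fun j => dom (a j) 0 k w) @ \oo --> 0.
Proof.
move=> a0; elim: k => [|k IH] /=; first exact: cvg_cst.
have := cvgM (cvg_cst (K * (1 + enorm (B k.+1 w)))) (cvgD IH (a0 k)).
by rewrite addr0 mulr0; apply.
Qed.

End Domination.

Section Pathwise.
Context {R : realType} {Gamma : pmetricType R} {n m d : nat}.
Context {dO : measure_display} {Omega : measurableType dO}.
Variables (c : coefficients R Gamma n m d) (N : nat) (U : nat -> set 'cV[R]_m).
Variables (L : R) (v : nat -> 'cV[R]_m) (psi : R -> R).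
Variables (B : nat -> Omega -> 'cV[R]_d) (x0 : 'cV[R]_n).

Hypotheses (hH1 : H1 c N U L v) (hH2 : H2 c N U L v) (L_ge0 : 0 <= L).
Hypothesis v_in : forall k, (k < N)%N -> U k (v k).
Hypothesis U_segment : forall k u u' (t : R), (k < N)%N -> U k u -> U k u' ->
  0 <= t <= 1 -> U k (u + t *: (u' - u)).
Hypothesis psi_mod : modulus psi.
Hypothesis psi_coef : forall g,
  (forall k x x' u u', (k < N)%N -> U k u -> U k u' ->
     let r := psi (enorm (x - x') + enorm (u - u')) in
     enorm (cbx c g k x u - cbx c g k x' u') <= r
     /\ enorm (cbu c g k x u - cbu c g k x' u') <= r
     /\ (forall i, enorm (csx c i g k x u - csx c i g k x' u') <= r)
     /\ (forall i, enorm (csu c i g k x u - csu c i g k x' u') <= r)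
     /\ enorm (cfx c g k x u - cfx c g k x' u') <= r
     /\ enorm (cfu c g k x u - cfu c g k x' u') <= r)
  /\ (forall x x', enorm (cphix c g x - cphix c g x') <= psi (enorm (x - x'))).
Hypothesis phi_bounded_at_0 : forall g, `|cphi c g 0| <= L.

(** A common constant for all one-step estimates below. The dimensions enter
    because the mean value theorem is applied to each component. *)
Definition step_const : R := (n%:R + 1) * (L + 1) * (1 + d%:R).
Local Notation K := step_const.

Lemma step_const_ge0 : 0 <= K.
Proof. by rewrite !mulr_ge0// addr_ge0. Qed.

Let L_le_K (b s : R) : 0 <= b -> 0 <= s ->
  L * s + d%:R * (b * (L * s)) <= K * (1 + b) * s.
Proof.
move=> b0 s0; rewrite /step_const.
have n0 : 0 <= n%:R :> R by []. have d0 : 0 <= d%:R :> R by [].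
have -> : L * s + d%:R * (b * (L * s)) = L * (1 + d%:R * b) * s by ring.
rewrite ler_wpM2r//.
apply: (@le_trans _ _ (L * ((1 + d%:R) * (1 + b)))).
  by rewrite ler_wpM2l//; nra.
rewrite -mulrA ler_wpM2r//; first by rewrite mulr_ge0// addr_ge0.
apply: (@le_trans _ _ (L + 1)); first by rewrite lerDl.
by rewrite ler_peMl ?addr_ge0// lerDr.
Qed.

Let nL_le_K (b s l : R) : 0 <= b -> 0 <= s -> 0 <= l -> l <= L + 1 ->
  n%:R * (l * s) + d%:R * (b * (n%:R * (l * s))) <= K * (1 + b) * s.
Proof.
move=> b0 s0 l0 lL; rewrite /step_const.
have n0 : 0 <= n%:R :> R by []. have d0 : 0 <= d%:R :> R by [].
have -> : n%:R * (l * s) + d%:R * (b * (n%:R * (l * s)))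
  = n%:R * l * (1 + d%:R * b) * s by ring.
rewrite ler_wpM2r//.
apply: (@le_trans _ _ (n%:R * l * ((1 + d%:R) * (1 + b)))).
  by rewrite ler_wpM2l ?mulr_ge0//; nra.
rewrite -[leRHS]mulrA ler_wpM2r//; first by rewrite mulr_ge0// addr_ge0.
by rewrite ler_pM// lerDl.
Qed.

Let noise_sum (h : 'I_d -> 'cV[R]_n) (be : 'cV[R]_d) (M : R) :
  (forall i, enorm (h i) <= M) ->
  enorm (\sum_i be i 0 *: h i) <= d%:R * (enorm be * M).
Proof.
move=> hM; apply: (@le_trans _ _ (\sum_(i < d) enorm (be i 0 *: h i))).
  elim/big_ind2 : _ => [|y1 s1 y2 s2 h1 h2|//]; first by rewrite enorm0.
  by rewrite (le_trans (enormD _ _))// lerD.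
rewrite mulr_natl -[X in _ *+ X]card_ord -sumr_const; apply: ler_sum => i _.
by rewrite enormZ ler_pM ?enorm_ge0// le_enorm.
Qed.

Let mulmx_cols (S : 'M[R]_(n, d)) (be : 'cV[R]_d) :
  S *m be = \sum_i be i 0 *: col i S.
Proof.
apply/matrixP => i k; rewrite !ord1 mxE summxE.
by apply: eq_bigr => j _; rewrite !mxE mulrC.
Qed.

Definition step g k x u (be : 'cV[R]_d) : 'cV[R]_n :=
  cb c g k x u + cs c g k x u *m be.

Definition dstep g k x u (be : 'cV[R]_d) (dx : 'cV[R]_n) (du : 'cV[R]_m) :
    'cV[R]_n :=
  (cbx c g k x u *m dx + cbu c g k x u *m du)
  + \sum_i be i 0 *: (csx c i g k x u *m dx + csu c i g k x u *m du).

Lemma step_lipschitz g k x x' u u' be : (k < N)%N -> U k u -> U k u' ->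
  enorm (step g k x' u' be - step g k x u be)
    <= K * (1 + enorm be) * (enorm (x' - x) + enorm (u' - u)).
Proof.
move=> kN Uu Uu'; have [_ [Cb [Cs Hb]]] := hH1 kN g.
have seg := fun a b t => @U_segment k a b t kN.
set s := enorm (x' - x) + enorm (u' - u).
have s0 : 0 <= s by rewrite addr_ge0 ?enorm_ge0.
have -> : step g k x' u' be - step g k x u be = (cb c g k x' u' - cb c g k x u)
    + \sum_i be i 0 *: (col i (cs c g k x' u') - col i (cs c g k x u)).
  rewrite /step opprD addrACA -mulmxBl mulmx_cols; congr (_ + _).
  by apply: eq_bigr => i _; rewrite linearB.
rewrite (le_trans (enormD _ _))//.
apply: le_trans (nL_le_K (enorm_ge0 be) s0 L_ge0 _); last by rewrite lerDl.
apply: lerD.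
  apply: (lipschitz_xu seg Cb Uu Uu') => t t01.
  by have [] := Hb (x + t *: (x' - x)) _ (seg _ _ _ Uu Uu' t01).
apply: noise_sum => i; apply: (lipschitz_xu seg (Cs i) Uu Uu') => t t01.
by have [_ _ h3 h4] := Hb (x + t *: (x' - x)) _ (seg _ _ _ Uu Uu' t01).
Qed.

Lemma dstep_bound g k x u be dx du : (k < N)%N -> U k u ->
  enorm (dstep g k x u be dx du)
    <= K * (1 + enorm be) * (enorm dx + enorm du).
Proof.
move=> kN Uu; have [_ [_ [_ /(_ x u Uu)[h1 h2 h3 h4]]]] := hH1 kN g.
set s := enorm dx + enorm du.
have s0 : 0 <= s by rewrite addr_ge0 ?enorm_ge0.
have lin_le (A1 : 'M[R]_n) (A2 : 'M[R]_(n, m)) : enorm A1 <= L -> enorm A2 <= L ->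
    enorm (A1 *m dx + A2 *m du) <= L * s.
  move=> l1 l2; rewrite (le_trans (enormD _ _))// mulrDr.
  by rewrite lerD// (le_trans (enormM _ _))// ler_wpM2r ?enorm_ge0.
apply: le_trans (L_le_K (enorm_ge0 be) s0).
rewrite (le_trans (enormD _ _))// lerD ?lin_le//.
by apply: noise_sum => i; exact: lin_le.
Qed.

Lemma step_growth g k x u be : (k < N)%N -> U k u ->
  enorm (step g k x u be)
    <= K * (1 + enorm be) * (enorm x + (1 + enorm u + enorm (v k))).
Proof.
move=> kN Uu; have [h0 _] := hH1 kN g.
have -> : step g k x u be = step g k 0 (v k) be
    + (step g k x u be - step g k 0 (v k) be) by rewrite addrC subrK.
rewrite (le_trans (enormD _ _))//.
have : enorm (step g k 0 (v k) be) <= K * (1 + enorm be).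
  rewrite (le_trans (enormD _ _))// (le_trans (lerD (lexx _) (enormM _ _)))//.
  have b0 := enorm_ge0 (cb c g k 0 (v k)); have s0 := enorm_ge0 (cs c g k 0 (v k)).
  have be0 := enorm_ge0 be.
  apply: (@le_trans _ _ (L * (1 + enorm be))).
    have : enorm (cb c g k 0 (v k)) <= L by lra.
    have : enorm (cs c g k 0 (v k)) <= L by lra.
    by nra.
  rewrite ler_wpM2r ?addr_ge0// /step_const -mulrA mulrCA.
  have n0 : 0 <= n%:R :> R by []. have d0 : 0 <= d%:R :> R by [].
  apply: (@le_trans _ _ (L + 1)); first by rewrite lerDl.
  by rewrite ler_peMr ?addr_ge0// mulr_ege1 ?lerDl ?lerDr.
have := step_lipschitz g 0 x be kN (v_in kN) Uu; rewrite subr0 => h1 h2.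
rewrite (le_trans (lerD h2 h1))// -[X in X + _ <= _]mulr1 -mulrDr.
rewrite ler_wpM2l ?mulr_ge0 ?step_const_ge0 ?addr_ge0 ?enorm_ge0//.
by have := enormD u (- v k); rewrite enormN; lra.
Qed.

(** [psi] is a modulus for the derivatives that is the same for all parameters,
    and the noise enters the step linearly. *)
Lemma step_taylor g k (x x' : 'cV[R]_n) (u u' : 'cV[R]_m) be (s : R) :
  (k < N)%N -> U k u -> U k u' ->
  s = enorm (x' - x) + enorm (u' - u) ->
  enorm (step g k x' u' be - step g k x u be
         - dstep g k x u be (x' - x) (u' - u))
    <= K * (1 + enorm be) * (psi s * s).
Proof.
move=> kN Uu Uu' s_def; have [_ [Cb [Cs Hb]]] := hH1 kN g.
have seg := fun a b t => @U_segment k a b t kN.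
have s0 : 0 <= s by rewrite s_def addr_ge0 ?enorm_ge0.
have ps0 : 0 <= psi s * s by rewrite mulr_ge0// modulus_ge0.
have -> : step g k x' u' be - step g k x u be
      - dstep g k x u be (x' - x) (u' - u)
    = (cb c g k x' u' - cb c g k x u
       - (cbx c g k x u *m (x' - x) + cbu c g k x u *m (u' - u)))
    + \sum_i be i 0 *: (col i (cs c g k x' u') - col i (cs c g k x u)
       - (csx c i g k x u *m (x' - x) + csu c i g k x u *m (u' - u))).
  rewrite /step /dstep.
  have -> : \sum_i be i 0 *: (col i (cs c g k x' u') - col i (cs c g k x u)
       - (csx c i g k x u *m (x' - x) + csu c i g k x u *m (u' - u)))
    = (cs c g k x' u' *m be - cs c g k x u *m be)
      - \sum_i be i 0 *: (csx c i g k x u *m (x' - x)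
                          + csu c i g k x u *m (u' - u)).
    rewrite -mulmxBl mulmx_cols -sumrB; apply: eq_bigr => i _.
    have -> : col i (cs c g k x' u' - cs c g k x u)
      = col i (cs c g k x' u') - col i (cs c g k x u) by rewrite linearB.
    by rewrite -scalerBr.
  have regroup (V : zmodType) (a a' b b' e e' : V) :
      a + a' - (b + b') - (e + e') = (a - b - e) + (a' - b' - e').
    by rewrite (opprD b) (opprD e) (addrACA a a') (addrACA (a - b)).
  exact: regroup.
have KE : n%:R * (1 * (psi s * s)) + d%:R * (enorm be * (n%:R * (1 * (psi s * s))))
    <= K * (1 + enorm be) * (psi s * s).
  by apply: nL_le_K; rewrite ?enorm_ge0// lerDr.
rewrite (le_trans (enormD _ _))// (le_trans _ KE)// mul1r s_def.
apply: lerD.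
  apply: (taylor_xu seg Cb x' Uu Uu' psi_mod) => y w Uw.
  by have [h1 [h2 _]] := (psi_coef g).1 k y x w u kN Uw Uu.
apply: noise_sum => i; apply: (taylor_xu seg (Cs i) x' Uu Uu' psi_mod) => y w Uw.
by have [_ [_ [h3 [h4 _]]]] := (psi_coef g).1 k y x w u kN Uw Uu.
Qed.

Lemma dstepD g k x u be dx dx' du :
  dstep g k x u be (dx + dx') du = dstep g k x u be dx du + dstep g k x u be dx' 0.
Proof.
rewrite /dstep addrACA -big_split/=; congr (_ + _).
  by rewrite !mulmxDr mulmx0 addr0 addrAC.
apply: eq_bigr => i _; rewrite -scalerDr; congr (_ *: _).
by rewrite !mulmxDr mulmx0 addr0 addrAC.
Qed.

Lemma dstepZ g k x u be (t : R) dx du :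
  dstep g k x u be (t *: dx) (t *: du) = t *: dstep g k x u be dx du.
Proof.
rewrite /dstep scalerDr scaler_sumr -!scalemxAr -scalerDr; congr (_ + _).
apply: eq_bigr => i _; rewrite -!scalemxAr -scalerDr !scalerA.
by rewrite mulrC.
Qed.

Local Notation state := (state c B x0).

Lemma stateS u g k w :
  state u g k.+1 w = step g k (state u g k w) (u k w) (B k.+1 w).
Proof. by []. Qed.

Definition Ubar (u : nat -> Omega -> 'cV[R]_m) :=
  forall k, (k < N)%N -> forall w, U k (u k w).

Definition growth (u : nat -> Omega -> 'cV[R]_m) : nat -> Omega -> R :=
  dom B K (fun k w => 1 + enorm (u k w) + enorm (v k)) (enorm x0).

Lemma growth_ge0 u k w : 0 <= growth u k w.
Proof.
by apply: dom_ge0 => [||j]; rewrite ?step_const_ge0 ?addr_ge0 ?enorm_ge0.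
Qed.

Lemma state_growth u g k w : Ubar u -> (k <= N)%N ->
  enorm (state u g k w) <= growth u k w.
Proof.
move=> Uu; elim: k => [//|k IH] kN; rewrite stateS.
rewrite (le_trans (step_growth _ _ _ _ _))//; first exact: Uu.
by rewrite ler_wpM2l ?dom_factor_ge0 ?step_const_ge0// lerD// IH// ltnW.
Qed.

Definition gap (du : nat -> Omega -> 'cV[R]_m) : nat -> Omega -> R :=
  dom B K (fun k w => enorm (du k w)) 0.

Lemma gap_ge0 du k w : 0 <= gap du k w.
Proof. by apply: dom_ge0 => [||j]; rewrite ?step_const_ge0 ?enorm_ge0. Qed.

Lemma state_gap u u' g k w : Ubar u -> Ubar u' -> (k <= N)%N ->
  enorm (state u' g k w - state u g k w) <= gap (fun k w => u' k w - u k w) k w.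
Proof.
move=> Uu Uu'; elim: k => [|k IH] kN; first by rewrite /= subrr enorm0.
rewrite !stateS (le_trans (step_lipschitz _ _ _ _ _ _ _))//; [exact: Uu|exact: Uu'|].
by rewrite ler_wpM2l ?dom_factor_ge0 ?step_const_ge0// lerD// IH// ltnW.
Qed.

Variables (u : nat -> Omega -> 'cV[R]_m) (du : nat -> Omega -> 'cV[R]_m).
Hypothesis Uu : Ubar u.
Hypothesis Uu1 : Ubar (fun k w => u k w + du k w).

(** The derivative at [u], in the direction [du], of the state as a function of
    the control. *)
Fixpoint variation (g : Gamma) (k : nat) (w : Omega) : 'cV[R]_n :=
  if k is j.+1 then
    dstep g j (state u g j w) (u j w) (B j.+1 w) (variation g j w) (du j w)
  else 0.

Lemma variation_gap g k w : (k <= N)%N -> enorm (variation g k w) <= gap du k w.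
Proof.
elim: k => [|k IH] kN; first by rewrite /= enorm0.
rewrite (le_trans (dstep_bound _ _ _ _ _ kN (Uu kN w)))//.
by rewrite ler_wpM2l ?dom_factor_ge0 ?step_const_ge0// lerD// IH// ltnW.
Qed.

Definition perturbed (t : R) (k : nat) (w : Omega) := u k w + t *: du k w.

Lemma perturbed_Ubar t : 0 <= t <= 1 -> Ubar (perturbed t).
Proof.
move=> t01 k kN w; rewrite /perturbed.
have -> : du k w = (u k w + du k w) - u k w by rewrite addrC addKr.
by apply: U_segment => //; [exact: Uu|exact: Uu1].
Qed.

(** Bounds, up to the factor [t], the size of the joint perturbation of state and
    control when the control is moved by [t *: du]. *)
Definition incr k w := gap du k w + enorm (du k w).

Definition remainder (t : R) : nat -> Omega -> R :=
  dom B K (fun k w => psi (t * incr k w) * incr k w) 0.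

Lemma incr_ge0 k w : 0 <= incr k w.
Proof. by rewrite addr_ge0 ?gap_ge0 ?enorm_ge0. Qed.

Lemma perturbed_gap (t : R) g k w : 0 <= t <= 1 -> (k <= N)%N ->
  enorm (state (perturbed t) g k w - state u g k w) <= t * gap du k w.
Proof.
move=> t01 kN; have /andP[t0 _] := t01.
rewrite (le_trans (state_gap g w Uu (perturbed_Ubar t01) kN))//.
rewrite /gap -dom_scale le_eqVlt; apply/orP; left; apply/eqP.
congr (dom _ _ _ _ _ _); apply/funext => j; apply/funext => w'.
by rewrite /perturbed addrC addKr enormZ ger0_norm.
Qed.

(** Induction on time: the step applied to the perturbed state differs from its
    linearisation by [step_taylor], and the linearised step propagates the
    error of the previous time. *)
Lemma state_taylor (t : R) g k w : 0 <= t <= 1 -> (k <= N)%N ->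
  enorm (state (perturbed t) g k w - state u g k w - t *: variation g k w)
    <= t * remainder t k w.
Proof.
move=> t01; have /andP[t0 t1] := t01.
elim: k => [|k IH] kN; first by rewrite /= scaler0 subr0 subrr enorm0 mulr0.
have remS : remainder t k.+1 w = K * (1 + enorm (B k.+1 w))
  * (remainder t k w + psi (t * incr k w) * incr k w) by [].
have varS : variation g k.+1 w = dstep g k (state u g k w) (u k w) (B k.+1 w)
  (variation g k w) (du k w) by [].
rewrite !stateS remS varS {remS varS}.
set x := state u g k w; set x' := state (perturbed t) g k w.
set be := B k.+1 w; set y := variation g k w.
have du_t : perturbed t k w - u k w = t *: du k w.
  by rewrite /perturbed addrC addKr.
have -> : step g k x' (perturbed t k w) be - step g k x (u k w) be
      - t *: dstep g k x (u k w) be y (du k w)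
    = (step g k x' (perturbed t k w) be - step g k x (u k w) be
       - dstep g k x (u k w) be (x' - x) (perturbed t k w - u k w))
      + dstep g k x (u k w) be (x' - x - t *: y) 0.
  have dE : dstep g k x (u k w) be (x' - x) (t *: du k w)
      = t *: dstep g k x (u k w) be y (du k w)
        + dstep g k x (u k w) be (x' - x - t *: y) 0.
    by rewrite -dstepZ -dstepD [t *: y + _]addrC subrK.
  have regroup (V : zmodType) (a b e : V) : a - b = a - (b + e) + e.
    by rewrite opprD addrA subrK.
  by rewrite du_t dE; exact: regroup.
rewrite (le_trans (enormD _ _))//.
have Ut := perturbed_Ubar t01 kN w; have U0 := Uu kN w.
rewrite (le_trans (lerD (step_taylor g be kN U0 Ut erefl)
  (dstep_bound g x be _ _ kN U0)))//.
rewrite enorm0 addr0 -mulrDr mulrCA ler_wpM2l ?dom_factor_ge0 ?step_const_ge0//.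
rewrite [leLHS]addrC [leRHS]mulrDr lerD//; first exact: IH (ltnW kN).
rewrite du_t enormZ (ger0_norm t0).
set s := enorm (x' - x) + _.
have s0 : 0 <= s by rewrite addr_ge0 ?mulr_ge0 ?enorm_ge0.
have st : s <= t * incr k w.
  by rewrite /s /incr mulrDr lerD2r perturbed_gap// ltnW.
have ps0 : 0 <= psi s by exact: modulus_ge0 psi_mod _ s0.
rewrite mulrCA ler_pM//.
exact: modulus_le psi_mod _ _ s0 st.
Qed.

(** The linearisation error is also at most twice the first order size. Each of
    the two bounds serves a purpose: [remainder] tends to zero with [t] but
    need not be square integrable, and the other bound is square integrable but
    does not tend to zero. *)
Definition error t k w := Num.min (remainder t k w) (2 * gap du k w).

Lemma error_ge0 t k w : 0 <= t -> 0 <= error t k w.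
Proof.
move=> t0; rewrite le_min mulr_ge0 ?gap_ge0// andbT.
apply: dom_ge0 => [|//|j]; first exact: step_const_ge0.
by rewrite mulr_ge0 ?incr_ge0//; apply: modulus_ge0 => //; rewrite mulr_ge0// incr_ge0.
Qed.

Lemma state_error (t : R) g k w : 0 <= t <= 1 -> (k <= N)%N ->
  enorm (state (perturbed t) g k w - state u g k w - t *: variation g k w)
    <= t * error t k w.
Proof.
move=> t01 kN; have /andP[t0 t1] := t01.
rewrite /error minr_pMr// le_min state_taylor//=.
rewrite (le_trans (enormD _ _))// enormN enormZ ger0_norm//.
rewrite mulrCA mulr_natl mulr2n lerD ?perturbed_gap//.
by rewrite ler_wpM2l// variation_gap.
Qed.

Let f_enorm g k x x' u1 u2 (y : R) :
  `|cf c g k x' u2 - cf c g k x u1 - y|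
  = enorm ((cf c g k x' u2)%:M - (cf c g k x u1)%:M - y%:M : 'M[R]_1).
Proof. by rewrite -enorm_scalar !raddfB. Qed.

Let scalar00 (A : 'M[R]_1) : A = (A 0 0)%:M.
Proof. by apply/matrixP => i j; rewrite !ord1 mxE eqxx mulr1n. Qed.

Let norm_segment a (y y' : 'cV[R]_a) (t : R) : 0 <= t <= 1 ->
  enorm (y + t *: (y' - y)) <= enorm y + enorm y'.
Proof.
move=> /andP[t0 t1].
have -> : y + t *: (y' - y) = (1 - t) *: y + t *: y'.
  by rewrite scalerBr scalerBl scale1r addrA addrAC.
rewrite (le_trans (enormD _ _))// !enormZ !ger0_norm ?subr_ge0//.
by rewrite lerD// ler_piMl ?enorm_ge0// gerBl.
Qed.

Lemma f_lipschitz g k x x' u1 u2 : (k < N)%N -> U k u1 -> U k u2 ->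
  `|cf c g k x' u2 - cf c g k x u1|
    <= L * (1 + (enorm x + enorm x') + (enorm u1 + enorm u2))
       * (enorm (x' - x) + enorm (u2 - u1)).
Proof.
move=> kN Uu1' Uu2; have [_ [Cf Hf]] := hH2.1 k kN g.
have seg := fun a b t => @U_segment k a b t kN.
rewrite -[X in `|X|]subr0 f_enorm raddf0 subr0 -[leRHS]mul1r.
apply: (lipschitz_xu seg Cf Uu1' Uu2) => t t01.
have [h1 h2] := Hf (x + t *: (x' - x)) _ (seg _ _ _ Uu1' Uu2 t01).
have bx := norm_segment x x' t01; have bu := norm_segment u1 u2 t01.
split; [apply: le_trans h1 _|apply: le_trans h2 _]; rewrite ler_wpM2l//; lra.
Qed.

Lemma f_growth g k x u1 : (k < N)%N -> U k u1 ->
  `|cf c g k x u1| <= L * (1 + enorm x + enorm u1 + enorm (v k)) ^+ 2.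
Proof.
move=> kN Uu1'; have [h0 _] := hH2.1 k kN g.
have := f_lipschitz g 0 x kN (v_in kN) Uu1'; rewrite enorm0 add0r subr0 => h.
rewrite -[cf c g k x u1](subrK (cf c g k 0 (v k))) (le_trans (ler_normD _ _))//.
rewrite (le_trans (lerD h h0))//.
have := enormD u1 (- v k); rewrite enormN => hu.
set a := enorm x in h hu *; set b := enorm u1 in h hu *.
set e := enorm (v k) in h hu *.
have a0 : 0 <= a by exact: enorm_ge0.
have b0 : 0 <= b by exact: enorm_ge0.
have e0 : 0 <= e by exact: enorm_ge0.
rewrite -mulrA -[X in _ + X]mulr1 -mulrDr ler_wpM2l//.
apply: (@le_trans _ _ ((1 + a + (e + b)) * (a + (b + e)) + 1)).
  by rewrite lerD2r ler_wpM2l// ?lerD2l// !addr_ge0.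
by nra.
Qed.

Lemma f_taylor g k x x' u1 u2 : (k < N)%N -> U k u1 -> U k u2 ->
  `|cf c g k x' u2 - cf c g k x u1
    - ((cfx c g k x u1 *m (x' - x)) 0 0 + (cfu c g k x u1 *m (u2 - u1)) 0 0)|
    <= psi (enorm (x' - x) + enorm (u2 - u1))
       * (enorm (x' - x) + enorm (u2 - u1)).
Proof.
move=> kN Uu1' Uu2; have [_ [Cf Hf]] := hH2.1 k kN g.
have seg := fun a b t => @U_segment k a b t kN.
rewrite f_enorm raddfD/= -!scalar00 -[leRHS]mul1r.
apply: (taylor_xu seg Cf x' Uu1' Uu2 psi_mod) => y w Uw.
by have [_ [_ [_ [_ [h1 h2]]]]] := (psi_coef g).1 k y x w u1 kN Uw Uu1'.
Qed.

Let phi_mean g x x' : exists2 t : R, 0 <= t <= 1 &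
  cphi c g x' - cphi c g x = (cphix c g (x + t *: (x' - x)) *m (x' - x)) 0 0.
Proof.
have [Cphi _] := hH2.2 g.
have [//|t t01 E] := jacobian_mean_value (z := x) (z' := x') 0 _ Cphi.1.
by exists t => //; rewrite -E !mxE eqxx !mulr1n.
Qed.

Lemma phi_lipschitz g x x' : `|cphi c g x' - cphi c g x|
  <= L * (1 + (enorm x + enorm x')) * enorm (x' - x).
Proof.
have [t t01 ->] := phi_mean g x x'; rewrite (le_trans (le_enorm _ _ _))//.
rewrite (le_trans (enormM _ _))// ler_wpM2r ?enorm_ge0//.
rewrite (le_trans ((hH2.2 g).2 _))// ler_wpM2l// lerD2l.
exact: norm_segment.
Qed.

Lemma phi_growth g x : `|cphi c g x| <= L * (1 + enorm x) ^+ 2.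
Proof.
have := phi_lipschitz g 0 x; rewrite enorm0 add0r subr0 => h.
rewrite -[cphi c g x](subrK (cphi c g 0)) (le_trans (ler_normD _ _))//.
rewrite (le_trans (lerD h (phi_bounded_at_0 g)))//.
have := enorm_ge0 x; set a := enorm x => a0.
rewrite -mulrA -[X in _ + X]mulr1 -mulrDr ler_wpM2l//; nra.
Qed.

Lemma phi_taylor g x x' :
  `|cphi c g x' - cphi c g x - (cphix c g x *m (x' - x)) 0 0|
    <= psi (enorm (x' - x)) * enorm (x' - x).
Proof.
have [t t01 ->] := phi_mean g x x'; have /andP[t0 t1] := t01.
set J := cphix c g _; set J0 := cphix c g x.
have -> : (J *m (x' - x)) 0 0 - (J0 *m (x' - x)) 0 0 = ((J - J0) *m (x' - x)) 0 0.
  rewrite mulmxBl.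
  have entry (a b : 'M[R]_1) : (a - b) 0 0 = a 0 0 - b 0 0 by rewrite !mxE.
  by rewrite entry.
rewrite (le_trans (le_enorm _ _ _))// (le_trans (enormM _ _))//.
rewrite ler_wpM2r ?enorm_ge0// (le_trans ((psi_coef g).2 _ _))//.
apply: modulus_le => //; first exact: enorm_ge0.
by rewrite addrAC subrr add0r enormZ ger0_norm// ler_piMl ?enorm_ge0.
Qed.

Definition cost (u1 : nat -> Omega -> 'cV[R]_m) g w : R :=
  \sum_(k < N) cf c g k (state u1 g k w) (u1 k w) + cphi c g (state u1 g N w).

Definition cost_bound (u1 : nat -> Omega -> 'cV[R]_m) w : R :=
  \sum_(k < N) L * (1 + growth u1 k w + enorm (u1 k w) + enorm (v k)) ^+ 2
  + L * (1 + growth u1 N w) ^+ 2.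

Lemma cost_growth u1 g w : Ubar u1 -> `|cost u1 g w| <= cost_bound u1 w.
Proof.
move=> Uu1'; rewrite (le_trans (ler_normD _ _))// lerD//.
  rewrite (le_trans (ler_norm_sum _ _ _))//; apply: ler_sum => k _.
  rewrite (le_trans (f_growth _ _ _ _))//; first exact: Uu1'.
  rewrite ler_wpM2l// lerXn2r ?nnegrE ?addr_ge0 ?enorm_ge0 ?growth_ge0//.
  by rewrite !lerD2r lerD2l state_growth// ltnW.
rewrite (le_trans (phi_growth _ _))// ler_wpM2l//.
rewrite lerXn2r ?nnegrE ?addr_ge0 ?enorm_ge0 ?growth_ge0//.
by rewrite lerD2l state_growth.
Qed.

Definition cost_variation g w : R :=
  \sum_(k < N)
     ((cfx c g k (state u g k w) (u k w) *m variation g k w) 0 0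
      + (cfu c g k (state u g k w) (u k w) *m du k w) 0 0)
  + (cphix c g (state u g N w) *m variation g N w) 0 0.

Definition cost_error t w : R :=
  \sum_(k < N) (psi (t * incr k w) * incr k w
    + L * (1 + growth u k w + enorm (u k w)) * error t k w)
  + (psi (t * gap du N w) * gap du N w + L * (1 + growth u N w) * error t N w).

Let mul00_le a (J : 'rV[R]_a) (y : 'cV[R]_a) (M s : R) : 0 <= M ->
  enorm J <= M -> enorm y <= s -> `|(J *m y) 0 0| <= M * s.
Proof.
move=> M0 JM ys; rewrite (le_trans (le_enorm _ _ _))//.
by rewrite (le_trans (enormM _ _))// ler_pM ?enorm_ge0.
Qed.

(** The bound [cost_error] depends on the sample point but not on the
    parameter, which is the source of all uniformity over the parameter. *)
Lemma cost_taylor (t : R) g w : 0 <= t <= 1 ->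
  `|cost (perturbed t) g w - cost u g w - t * cost_variation g w|
    <= t * cost_error t w.
Proof.
move=> t01; have /andP[t0 t1] := t01.
have row (a : nat) (J : 'rV[R]_a) (y y' : 'cV[R]_a) :
    (J *m y') 0 0 = (J *m y) 0 0 + (J *m (y' - y)) 0 0.
  have entry (A A' : 'M[R]_1) : (A - A') 0 0 = A 0 0 - A' 0 0 by rewrite !mxE.
  by rewrite mulmxBr entry addrC subrK.
have rowZ (a : nat) (J : 'rV[R]_a) (y : 'cV[R]_a) :
    (J *m (t *: y)) 0 0 = t * (J *m y) 0 0 by rewrite -scalemxAr mxE.
have -> : cost (perturbed t) g w - cost u g w - t * cost_variation g w
  = \sum_(k < N) (cf c g k (state (perturbed t) g k w) (perturbed t k w)
      - cf c g k (state u g k w) (u k w)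
      - t * ((cfx c g k (state u g k w) (u k w) *m variation g k w) 0 0
             + (cfu c g k (state u g k w) (u k w) *m du k w) 0 0))
    + (cphi c g (state (perturbed t) g N w) - cphi c g (state u g N w)
       - t * (cphix c g (state u g N w) *m variation g N w) 0 0).
  rewrite /cost /cost_variation mulrDr mulr_sumr !sumrB; ring.
rewrite (le_trans (ler_normD _ _))// /cost_error mulrDr lerD//.
  rewrite mulr_sumr (le_trans (ler_norm_sum _ _ _))//; apply: ler_sum => k _.
  have kN : (k < N)%N by [].
  have Ut := perturbed_Ubar t01 kN w; have U0 := Uu kN w.
  set x := state u g k w; set x' := state (perturbed t) g k w.
  have du_t : perturbed t k w - u k w = t *: du k w.
    by rewrite /perturbed addrC addKr.
  have := f_taylor g x x' kN U0 Ut; rewrite du_t enormZ (ger0_norm t0) rowZ.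
  rewrite (row _ _ (t *: variation g k w)) rowZ => hf.
  have hx : `|(cfx c g k x (u k w) *m (x' - x - t *: variation g k w)) 0 0|
      <= L * (1 + growth u k w + enorm (u k w)) * (t * error t k w).
    apply: mul00_le.
    - by rewrite mulr_ge0// !addr_ge0 ?growth_ge0 ?enorm_ge0.
    - have [_ [_ Hf]] := hH2.1 k kN g; have [h1 _] := Hf x _ U0.
      rewrite (le_trans h1)// ler_wpM2l// lerD2r lerD2l state_growth//.
      exact: ltnW.
    - by rewrite state_error// ltnW.
  have gap_t : enorm (x' - x) <= t * gap du k w by rewrite perturbed_gap// ltnW.
  have s0 : 0 <= enorm (x' - x) + t * enorm (du k w).
    by rewrite addr_ge0 ?mulr_ge0 ?enorm_ge0.
  have st : enorm (x' - x) + t * enorm (du k w) <= t * incr k w.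
    by rewrite /incr mulrDr lerD2r.
  have hp : psi (enorm (x' - x) + t * enorm (du k w))
      * (enorm (x' - x) + t * enorm (du k w)) <= t * (psi (t * incr k w) * incr k w).
    rewrite mulrCA ler_pM//; first exact: modulus_ge0 psi_mod _ s0.
    exact: modulus_le psi_mod _ _ s0 st.
  move: hf hx hp.
  set a1 := (_ *m _) 0 0; set a2 := (_ *m _) 0 0; set a3 := (_ *m _) 0 0.
  set F := cf _ _ _ _ _ - _ => hf hx hp.
  have -> : F - t * (a1 + a3) = (F - (t * a1 + a2 + t * a3)) + a2 by ring.
  rewrite (le_trans (ler_normD _ _))// [leRHS]mulrDr lerD//.
    exact: le_trans hf hp.
  by rewrite [leRHS]mulrCA.
set x := state u g N w; set x' := state (perturbed t) g N w.
have := phi_taylor g x x'; rewrite (row _ _ (t *: variation g N w)) rowZ => hf.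
have hx : `|(cphix c g x *m (x' - x - t *: variation g N w)) 0 0|
    <= L * (1 + growth u N w) * (t * error t N w).
  apply: mul00_le.
  - by rewrite mulr_ge0// !addr_ge0 ?growth_ge0 ?enorm_ge0.
  - by rewrite (le_trans ((hH2.2 g).2 _))// ler_wpM2l// lerD2l state_growth.
  - exact: state_error.
have gap_t : enorm (x' - x) <= t * gap du N w by rewrite perturbed_gap.
have hp : psi (enorm (x' - x)) * enorm (x' - x)
    <= t * (psi (t * gap du N w) * gap du N w).
  have s0 := enorm_ge0 (x' - x).
  rewrite mulrCA ler_pM//; first exact: modulus_ge0 psi_mod _ s0.
  exact: modulus_le psi_mod _ _ s0 gap_t.
move: hf hx hp.
set a1 := (_ *m _) 0 0; set a2 := (_ *m _) 0 0.
set F := cphi _ _ _ - _ => hf hx hp.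
have -> : F - t * a1 = (F - (t * a1 + a2)) + a2 by ring.
rewrite (le_trans (ler_normD _ _))// [leRHS]mulrDr lerD//.
  exact: le_trans hf hp.
by rewrite [leRHS]mulrCA.
Qed.

Definition cost_variation_bound w : R :=
  \sum_(k < N) L * (1 + growth u k w + enorm (u k w)) * incr k w
  + L * (1 + growth u N w) * gap du N w.

Lemma cost_variation_le g w : `|cost_variation g w| <= cost_variation_bound w.
Proof.
rewrite (le_trans (ler_normD _ _))// lerD//.
  rewrite (le_trans (ler_norm_sum _ _ _))//; apply: ler_sum => k _.
  have [_ [_ Hf]] := hH2.1 k (ltn_ord k) g.
  have [h1 h2] := Hf (state u g k w) _ (Uu (ltn_ord k) w).
  have hM : L * (1 + enorm (state u g k w) + enorm (u k w))
      <= L * (1 + growth u k w + enorm (u k w)).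
    by rewrite ler_wpM2l// lerD2r lerD2l state_growth// ltnW.
  have M0 : 0 <= L * (1 + growth u k w + enorm (u k w)).
    by rewrite mulr_ge0// !addr_ge0 ?growth_ge0 ?enorm_ge0.
  rewrite (le_trans (ler_normD _ _))// mulrDr lerD// mul00_le//.
  - exact: le_trans hM.
  - by rewrite variation_gap// ltnW.
  - exact: le_trans hM.
apply: mul00_le.
- by rewrite mulr_ge0// !addr_ge0 ?growth_ge0 ?enorm_ge0.
- by rewrite (le_trans ((hH2.2 g).2 _))// ler_wpM2l// lerD2l state_growth.
- exact: variation_gap.
Qed.

End Pathwise.

(** * Dependence on the parameter *)

Section RegularCoefficients.
Context {R : realType} {Gamma : pmetricType R} {n m : nat}.
Variables (U : set 'cV[R]_m) (chi : Gamma -> 'cV[R]_n -> 'cV[R]_m -> R).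

Lemma modulus_equicontinuous psi : modulus psi ->
  (forall g x x' u u', U u -> U u' ->
     `|chi g x u - chi g x' u'| <= psi (enorm (x - x') + enorm (u - u'))) ->
  equicontinuous_on U chi.
Proof.
move=> psi_mod chi_psi x u Uu e e0.
have [delta d0 Hd] := modulus_near0 psi_mod e0.
exists delta => // g x' u' Uu' small.
apply: le_lt_trans (chi_psi _ _ _ _ _ Uu' Uu) _.
by apply: Hd => //; rewrite addr_ge0 ?enorm_ge0.
Qed.

(** The derivatives of the costs grow linearly, so the Lipschitz constants of
    the costs are only locally bounded; they are uniform over the parameter all
    the same. *)
Lemma locally_lipschitz_equicontinuous (M : R) : 0 <= M ->
  (forall g x x' u u', U u -> U u' -> `|chi g x' u' - chi g x u|
     <= M * (1 + (enorm x + enorm x') + (enorm u + enorm u'))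
        * (enorm (x' - x) + enorm (u' - u))) ->
  equicontinuous_on U chi.
Proof.
move=> M0 lip x u Uu e e0.
pose C := M * (2 + (enorm x + enorm x) + (enorm u + enorm u)) + 1.
have a0 := enorm_ge0 x; have b0 := enorm_ge0 u.
have C0 : 0 < C by rewrite /C ltr_wpDl// mulr_ge0// !addr_ge0.
exists (Num.min 1 (e / C)); first by rewrite lt_min ltr01 divr_gt0.
move=> g x' u' Uu'; rewrite lt_min => /andP[s1 sC].
apply: le_lt_trans (lip g x x' u u' Uu Uu') _.
set s := enorm (x' - x) + enorm (u' - u) in s1 sC *.
have s0 : 0 <= s by rewrite addr_ge0 ?enorm_ge0.
apply: (@le_lt_trans _ _ (C * s)); last by rewrite mulrC -ltr_pdivlMr.
rewrite ler_wpM2r//.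
have hx : enorm x' <= enorm (x' - x) + enorm x.
  by rewrite -[X in enorm X <= _](subrK x) enormD.
have hu : enorm u' <= enorm (u' - u) + enorm u.
  by rewrite -[X in enorm X <= _](subrK u) enormD.
apply: (@le_trans _ _ (M * (2 + (enorm x + enorm x) + (enorm u + enorm u)))).
  by rewrite ler_wpM2l//; move: s1; rewrite /s; lra.
by rewrite lerDl.
Qed.

Lemma modulus_parameter_continuous :
  (forall rho : R, 0 < rho -> exists2 psi, modulus psi &
    forall g g' x u, U u -> enorm x <= rho -> enorm u <= rho ->
      `|chi g x u - chi g' x u| <= psi (mdist g g')) ->
  parameter_continuous U chi.
Proof.
move=> H x u Uu g e e0; pose rho := 1 + enorm x + enorm u.
have a0 := enorm_ge0 x; have b0 := enorm_ge0 u.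
have rho0 : 0 < rho by rewrite /rho -addrA ltr_pwDl// addr_ge0.
have [psi psi_mod Hpsi] := H _ rho0.
have [delta d0 Hd] := modulus_near0 psi_mod e0.
exists delta => // g' gg'; rewrite distrC.
apply: le_lt_trans (Hpsi g g' x u Uu _ _) _; rewrite /rho; [lra|lra|].
by apply: Hd => //; exact: mdist_ge0.
Qed.

End RegularCoefficients.

Section CoefficientRegularity.
Context {R : realType} {Gamma : pmetricType R} {n m d : nat}.
Variables (c : coefficients R Gamma n m d) (N : nat) (U : nat -> set 'cV[R]_m).
Variables (L : R) (v : nat -> 'cV[R]_m).
Hypotheses (hH1 : H1 c N U L v) (hH2 : H2 c N U L v) (L_ge0 : 0 <= L).
Hypothesis v_in : forall k, (k < N)%N -> U k (v k).
Hypothesis U_segment : forall k u u' (t : R), (k < N)%N -> U k u -> U k u' ->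
  0 <= t <= 1 -> U k (u + t *: (u' - u)).
Hypotheses (hH3 : H3 c N U) (hH4 : H4 c N U).

Let entryB a b (A A' : 'M[R]_(a, b)) i j : `|A i j - A' i j| <= enorm (A - A').
Proof. by have := le_enorm (A - A') i j; rewrite !mxE. Qed.

Let lip_weaken (r s a b : R) : 0 <= r -> 0 <= s -> 0 <= a -> 0 <= b ->
  r * (L * s) <= r * L * (1 + a + b) * s.
Proof.
move=> r0 s0 a0 b0; rewrite mulrA ler_wpM2r// ler_peMr ?mulr_ge0//.
by rewrite -addrA lerDl addr_ge0.
Qed.

Section AtTime.
Variable k : nat.
Hypothesis kN : (k < N)%N.

Lemma regular_b i : regular_coef (U k) (fun g x u => cb c g k x u i 0).
Proof.
have seg := fun a b t => @U_segment k a b t kN.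
split.
  apply: (@locally_lipschitz_equicontinuous _ _ _ _ _ _ (n%:R * L)) => [|g x x' u u' Uu Uu'].
    by rewrite mulr_ge0.
  have [_ [Cb [_ Hb]]] := hH1 kN g.
  apply: le_trans (entryB _ _ _ _) _.
  apply: le_trans (lipschitz_xu seg Cb Uu Uu' (M := L) _) _.
    move=> t t01.
    by have [] := Hb (x + t *: (x' - x)) _ (seg _ _ _ Uu Uu' t01).
  by apply: lip_weaken; rewrite ?addr_ge0 ?enorm_ge0.
apply: modulus_parameter_continuous => rho rho0.
have [psi psi_mod Hpsi] := hH4 rho0; exists psi => // g g' x u Uu xr ur.
by apply: le_trans (entryB _ _ _ _) _; have [/(_ k x u kN Uu xr ur)[]] := Hpsi g g'.
Qed.

Lemma regular_s i j : regular_coef (U k) (fun g x u => cs c g k x u i j).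
Proof.
have seg := fun a b t => @U_segment k a b t kN.
split.
  apply: (@locally_lipschitz_equicontinuous _ _ _ _ _ _ (n%:R * L)) => [|g x x' u u' Uu Uu'].
    by rewrite mulr_ge0.
  have [_ [_ [Cs Hb]]] := hH1 kN g.
  have -> : cs c g k x' u' i j - cs c g k x u i j
      = col j (cs c g k x' u') i 0 - col j (cs c g k x u) i 0 by rewrite !mxE.
  apply: le_trans (entryB _ _ _ _) _.
  apply: le_trans (lipschitz_xu seg (Cs j) Uu Uu' (M := L) _) _.
    move=> t t01.
    by have [] := Hb (x + t *: (x' - x)) _ (seg _ _ _ Uu Uu' t01).
  by apply: lip_weaken; rewrite ?addr_ge0 ?enorm_ge0.
apply: modulus_parameter_continuous => rho rho0.
have [psi psi_mod Hpsi] := hH4 rho0; exists psi => // g g' x u Uu xr ur.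
apply: le_trans (entryB _ _ _ _) _.
by have [/(_ k x u kN Uu xr ur)[_ []]] := Hpsi g g'.
Qed.

Lemma regular_f : regular_coef (U k) (fun g x u => cf c g k x u).
Proof.
split.
  apply: (locally_lipschitz_equicontinuous L_ge0) => g x x' u u' Uu Uu'.
  exact: (f_lipschitz hH2 L_ge0 U_segment g x x' kN Uu Uu').
apply: modulus_parameter_continuous => rho rho0.
have [psi psi_mod Hpsi] := hH4 rho0; exists psi => // g g' x u Uu xr ur.
by have [/(_ k x u kN Uu xr ur)[_ [_ []]]] := Hpsi g g'.
Qed.

Let regular_derivative a b (chi : Gamma -> 'cV[R]_n -> 'cV[R]_m -> 'M[R]_(a, b)) i j :
  (exists2 psi, modulus psi & forall g x x' u u', U k u -> U k u' ->
     enorm (chi g x u - chi g x' u') <= psi (enorm (x - x') + enorm (u - u'))) ->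
  (forall rho : R, 0 < rho -> exists2 psi, modulus psi &
    forall g g' x u, U k u -> enorm x <= rho -> enorm u <= rho ->
      enorm (chi g x u - chi g' x u) <= psi (mdist g g')) ->
  regular_coef (U k) (fun g x u => chi g x u i j).
Proof.
move=> [psi psi_mod Hpsi] H; split.
  apply: (modulus_equicontinuous psi_mod) => g x x' u u' Uu Uu'.
  exact: le_trans (entryB _ _ _ _) (Hpsi _ _ _ _ _ Uu Uu').
apply: modulus_parameter_continuous => rho /H[psi' mod' H']; exists psi' => //.
move=> g g' x u Uu xr ur.
exact: le_trans (entryB _ _ _ _) (H' _ _ _ _ Uu xr ur).
Qed.

Let from_H3 a b (chi : Gamma -> 'cV[R]_n -> 'cV[R]_m -> 'M[R]_(a, b)) :
  (forall psi : R -> R, (forall g x x' u u', U k u -> U k u' ->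
       let r := psi (enorm (x - x') + enorm (u - u')) in
       enorm (cbx c g k x u - cbx c g k x' u') <= r
       /\ enorm (cbu c g k x u - cbu c g k x' u') <= r
       /\ (forall i, enorm (csx c i g k x u - csx c i g k x' u') <= r)
       /\ (forall i, enorm (csu c i g k x u - csu c i g k x' u') <= r)
       /\ enorm (cfx c g k x u - cfx c g k x' u') <= r
       /\ enorm (cfu c g k x u - cfu c g k x' u') <= r) ->
    forall g x x' u u', U k u -> U k u' ->
      enorm (chi g x u - chi g x' u') <= psi (enorm (x - x') + enorm (u - u'))) ->
  exists2 psi, modulus psi & forall g x x' u u', U k u -> U k u' ->
     enorm (chi g x u - chi g x' u') <= psi (enorm (x - x') + enorm (u - u')).
Proof.
have [psi psi_mod Hpsi] := hH3 => H; exists psi => //; apply: H.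
by move=> g x x' u u' Uu Uu'; have [+ _] := Hpsi g; exact.
Qed.

Lemma regular_bx i j : regular_coef (U k) (fun g x u => cbx c g k x u i j).
Proof.
apply: (regular_derivative (chi := fun g x u => cbx c g k x u)).
  by apply: from_H3 => psi H g x x' u u' Uu Uu'; have [] := H g x x' u u' Uu Uu'.
move=> rho /hH4[psi psi_mod Hpsi]; exists psi => // g g' x u Uu xr ur.
by have [/(_ k x u kN Uu xr ur)[_ [_ [_ []]]]] := Hpsi g g'.
Qed.

Lemma regular_bu i j : regular_coef (U k) (fun g x u => cbu c g k x u i j).
Proof.
apply: (regular_derivative (chi := fun g x u => cbu c g k x u)).
  by apply: from_H3 => psi H g x x' u u' Uu Uu'; have [_ []] := H g x x' u u' Uu Uu'.
move=> rho /hH4[psi psi_mod Hpsi]; exists psi => // g g' x u Uu xr ur.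
by have [/(_ k x u kN Uu xr ur)[_ [_ [_ [_ []]]]]] := Hpsi g g'.
Qed.

Lemma regular_sx l i j : regular_coef (U k) (fun g x u => csx c l g k x u i j).
Proof.
apply: (regular_derivative (chi := fun g x u => csx c l g k x u)).
  apply: from_H3 => psi H g x x' u u' Uu Uu'.
  by have [_ [_ []]] := H g x x' u u' Uu Uu'.
move=> rho /hH4[psi psi_mod Hpsi]; exists psi => // g g' x u Uu xr ur.
by have [/(_ k x u kN Uu xr ur)[_ [_ [_ [_ [_ []]]]]]] := Hpsi g g'.
Qed.

Lemma regular_su l i j : regular_coef (U k) (fun g x u => csu c l g k x u i j).
Proof.
apply: (regular_derivative (chi := fun g x u => csu c l g k x u)).
  apply: from_H3 => psi H g x x' u u' Uu Uu'.
  by have [_ [_ [_ []]]] := H g x x' u u' Uu Uu'.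
move=> rho /hH4[psi psi_mod Hpsi]; exists psi => // g g' x u Uu xr ur.
by have [/(_ k x u kN Uu xr ur)[_ [_ [_ [_ [_ [_ []]]]]]]] := Hpsi g g'.
Qed.

Lemma regular_fx i j : regular_coef (U k) (fun g x u => cfx c g k x u i j).
Proof.
apply: (regular_derivative (chi := fun g x u => cfx c g k x u)).
  apply: from_H3 => psi H g x x' u u' Uu Uu'.
  by have [_ [_ [_ [_ []]]]] := H g x x' u u' Uu Uu'.
move=> rho /hH4[psi psi_mod Hpsi]; exists psi => // g g' x u Uu xr ur.
by have [/(_ k x u kN Uu xr ur)[_ [_ [_ [_ [_ [_ [_ []]]]]]]]] := Hpsi g g'.
Qed.

Lemma regular_fu i j : regular_coef (U k) (fun g x u => cfu c g k x u i j).
Proof.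
apply: (regular_derivative (chi := fun g x u => cfu c g k x u)).
  apply: from_H3 => psi H g x x' u u' Uu Uu'.
  by have [_ [_ [_ [_ []]]]] := H g x x' u u' Uu Uu'.
move=> rho /hH4[psi psi_mod Hpsi]; exists psi => // g g' x u Uu xr ur.
by have [/(_ k x u kN Uu xr ur)[_ [_ [_ [_ [_ [_ [_ []]]]]]]]] := Hpsi g g'.
Qed.

End AtTime.

Lemma regular_phi (V : set 'cV[R]_m) : regular_coef V (fun g x _ => cphi c g x).
Proof.
split.
  apply: (locally_lipschitz_equicontinuous L_ge0) => g x x' u u' _ _.
  apply: le_trans (phi_lipschitz hH2 L_ge0 g x x') _.
  have h1 := enorm_ge0 x; have h2 := enorm_ge0 x'; have h3 := enorm_ge0 u.
  have h4 := enorm_ge0 u'; have h5 := enorm_ge0 (x' - x).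
  have h6 := enorm_ge0 (u' - u).
  rewrite ler_pM ?mulr_ge0 ?addr_ge0//; last by rewrite lerDl.
  by rewrite ler_wpM2l// lerDl addr_ge0.
apply: modulus_parameter_continuous => rho rho0.
have [psi psi_mod Hpsi] := hH4 rho0; exists psi => // g g' x u _ xr _.
by have [_ /(_ x xr)[]] := Hpsi g g'.
Qed.

Lemma regular_phix (V : set 'cV[R]_m) i j :
  regular_coef V (fun g x _ => cphix c g x i j).
Proof.
have [psi psi_mod Hpsi] := hH3; split.
  apply: (modulus_equicontinuous psi_mod) => g x x' u u' _ _.
  apply: le_trans (entryB _ _ _ _) _; apply: le_trans ((Hpsi g).2 x x') _.
  by apply: (modulus_le psi_mod); rewrite ?enorm_ge0// lerDl enorm_ge0.
apply: modulus_parameter_continuous => rho rho0.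
have [psi' psi_mod' Hpsi'] := hH4 rho0; exists psi' => // g g' x u _ xr _.
by apply: le_trans (entryB _ _ _ _) _; have [_ /(_ x xr)[]] := Hpsi' g g'.
Qed.

End CoefficientRegularity.

Lemma cvg_finite_sum {R : realType} (I : Type) (s : seq I)
    (f : I -> nat -> R) (l : I -> R) :
  (forall i, f i @ \oo --> l i) ->
  (fun j => \sum_(i <- s) f i j) @ \oo --> \sum_(i <- s) l i.
Proof.
move=> fl; elim: s => [|i s IH].
  by under eq_fun do rewrite big_nil; rewrite big_nil; exact: cvg_cst.
by under eq_fun do rewrite big_cons; rewrite big_cons; exact: cvgD.
Qed.

Section JointMeasurability.
Context {R : realType} {Gamma : pmetricType R} {n m d : nat}.
Context {dO : measure_display} {Omega : measurableType dO}.
Variables (c : coefficients R Gamma n m d) (N : nat) (U : nat -> set 'cV[R]_m).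
Variables (L : R) (v : nat -> 'cV[R]_m).
Variables (B : nat -> Omega -> 'cV[R]_d) (x0 : 'cV[R]_n).
Hypothesis Gamma_polish : polish R Gamma.
Hypotheses (hH1 : H1 c N U L v) (hH2 : H2 c N U L v) (L_ge0 : 0 <= L).
Hypothesis U_segment : forall k u u' (t : R), (k < N)%N -> U k u -> U k u' ->
  0 <= t <= 1 -> U k (u + t *: (u' - u)).
Hypotheses (hH3 : H3 c N U) (hH4 : H4 c N U).

(** Joint measurability in the parameter and the sample point is carried
    through all constructions, because the final argument integrates over the
    parameter at a fixed sample point. The second factor is F_k, which also
    encodes adaptedness. *)
Definition jmeas k (F : Gamma -> Omega -> R) :=
  measurable_fun setT (fun z : borel Gamma * Past B k => F z.1 z.2).

Lemma jmeas_cst k (a : R) : jmeas k (fun _ _ => a).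
Proof. exact: measurable_cst. Qed.

Lemma jmeasD k F F' : jmeas k F -> jmeas k F' -> jmeas k (fun g w => F g w + F' g w).
Proof. by move=> mF mF'; exact: measurable_funD. Qed.

Lemma jmeasM k F F' : jmeas k F -> jmeas k F' -> jmeas k (fun g w => F g w * F' g w).
Proof. by move=> mF mF'; exact: measurable_funM. Qed.

Lemma jmeas_sum k (I : Type) (s : seq I) (F : I -> Gamma -> Omega -> R) :
  (forall i, jmeas k (F i)) -> jmeas k (fun g w => \sum_(i <- s) F i g w).
Proof. by move=> mF; exact: measurable_sum. Qed.

Lemma jmeas_past k (f : Omega -> R) :
  measurable_fun setT (f : Past B k -> R) -> jmeas k (fun _ w => f w).
Proof. by move=> mf; exact: measurableT_comp mf measurable_snd. Qed.

Lemma jmeasW k l F : (k <= l)%N -> jmeas k F -> jmeas l F.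
Proof.
move=> kl mF.
have mid : measurable_fun setT
    (fun z : borel Gamma * Past B l => (z.1, z.2) : borel Gamma * Past B k).
  apply: measurable_fun_pair; first exact: measurable_fst.
  have idkl : measurable_fun setT (id : Past B l -> Past B k).
    by move=> _ Y mY; rewrite setTI preimage_id; exact: filtrationW kl _ mY.
  exact: measurableT_comp idkl measurable_snd.
exact: measurableT_comp mF mid.
Qed.

Lemma jmeas_section k F g : jmeas k F ->
  measurable_fun setT (F g : Past B k -> R).
Proof.
move=> mF; have m2 : measurable_fun setT (fun w : Past B k => ((g : borel Gamma), w)).
  exact: measurable_pair1.
exact: measurableT_comp mF m2.
Qed.

Lemma jmeas_noise k i : jmeas k.+1 (fun _ w => B k.+1 w i 0).
Proof. by apply: jmeas_past; apply: noise_past_meas; exact: noise_meas_coord. Qed.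

Variable u : nat -> Omega -> 'cV[R]_m.
Hypothesis Uu : Ubar N U u.
Hypothesis u_adapted : forall k, (k < N)%N -> adapted_to (filtration B k) (u k).

Let reg_b k (kN : (k < N)%N) i := regular_b hH1 L_ge0 U_segment hH4 kN i.
Let reg_s k (kN : (k < N)%N) i j := regular_s hH1 L_ge0 U_segment hH4 kN i j.

Lemma jmeas_coef k chi (X : Gamma -> Omega -> 'cV[R]_n) : (k < N)%N ->
  regular_coef (U k) chi -> (forall i, jmeas k (fun g w => X g w i 0)) ->
  jmeas k (fun g w => chi g (X g w) (u k w)).
Proof.
move=> kN chi_reg mX.
apply: (regular_coef_measurable Gamma_polish (E := Past B k) (u := u k) chi_reg) => //.
- by move=> w; exact: Uu.
- by move=> i; exact: adapted_meas (u_adapted kN).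
Qed.

Lemma jmeas_state k i : (k <= N)%N -> jmeas k (fun g w => state c B x0 u g k w i 0).
Proof.
elim: k i => [|k IH] i kN; first exact: jmeas_cst.
have mS : jmeas k.+1 (fun g w => cb c g k (state c B x0 u g k w) (u k w) i 0
    + \sum_j cs c g k (state c B x0 u g k w) (u k w) i j * B k.+1 w j 0).
  apply: jmeasD.
    apply: (jmeasW (leqnSn k)); apply: (jmeas_coef kN (reg_b kN i)) => //.
    by move=> l; apply: IH; exact: ltnW.
  apply: jmeas_sum => j; apply: jmeasM; last exact: jmeas_noise.
  apply: (jmeasW (leqnSn k)); apply: (jmeas_coef kN (reg_s kN i j)) => //.
  by move=> l; apply: IH; exact: ltnW.
by rewrite /jmeas; under eq_fun do rewrite /= !mxE.
Qed.

Lemma jmeas_state_coef k chi : (k < N)%N -> regular_coef (U k) chi ->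
  jmeas k (fun g w => chi g (state c B x0 u g k w) (u k w)).
Proof.
by move=> kN chi_reg; apply: jmeas_coef => // i; exact: jmeas_state (ltnW kN).
Qed.

Lemma jmeas_state_terminal (chi : Gamma -> 'cV[R]_n -> R) :
  regular_coef setT (fun g x (_ : 'cV[R]_m) => chi g x) ->
  jmeas N (fun g w => chi g (state c B x0 u g N w)).
Proof.
move=> chi_reg.
apply: (regular_coef_measurable Gamma_polish (E := Past B N)
  (X := fun g w => state c B x0 u g N w) (u := fun=> 0) chi_reg) => //.
by move=> i; exact: jmeas_state.
Qed.

Lemma jmeas_cost : jmeas N (cost c N B x0 u).
Proof.
apply: jmeasD.
  apply: jmeas_sum => k; apply: (jmeasW (ltnW (ltn_ord k))).
  exact: (jmeas_state_coef (ltn_ord k)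
    (regular_f hH2 L_ge0 U_segment hH4 (ltn_ord k))).
exact: (jmeas_state_terminal (regular_phi hH2 L_ge0 hH4 setT)).
Qed.

(** Induction on time: the coefficients are continuous in the state uniformly
    over the parameter, so the parameter and the state may move together.
    Sequences are enough, since dominated convergence is applied along them. *)
Lemma state_parameter_cvg (g : Gamma) (s : nat -> Gamma) k w : (k <= N)%N ->
  (fun j => mdist g (s j)) @ \oo --> 0 ->
  (fun j => enorm (state c B x0 u (s j) k w - state c B x0 u g k w)) @ \oo --> 0.
Proof.
move=> kN sg; elim: k kN => [|k IH] kN.
  by rewrite /= subrr enorm0; exact: cvg_cst.
have {}IH := IH (ltnW kN).
have coef_cvg chi : regular_coef (U k) chi ->
    (fun j => chi (s j) (state c B x0 u (s j) k w) (u k w)) @ \oo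
      --> chi g (state c B x0 u g k w) (u k w).
  move=> chi_reg.
  exact: (regular_coef_cvg (X := fun h => state c B x0 u h k w) chi_reg (Uu kN w)).
have entry i : (fun j => state c B x0 u (s j) k.+1 w i 0) @ \oo
    --> state c B x0 u g k.+1 w i 0.
  have E h : state c B x0 u h k.+1 w i 0 = cb c h k (state c B x0 u h k w) (u k w) i 0
    + \sum_l cs c h k (state c B x0 u h k w) (u k w) i l * B k.+1 w l 0.
    by rewrite /= !mxE.
  rewrite E; under eq_fun do rewrite E.
  apply: cvgD; first by apply: coef_cvg (reg_b kN i).
  apply: cvg_finite_sum => l; apply: cvgM; last exact: cvg_cst.
  by apply: coef_cvg (reg_s kN i l).
apply: (@squeeze_cvgr _ _ _ _ (fun=> 0) (fun j => \sum_i
    `|state c B x0 u (s j) k.+1 w i 0 - state c B x0 u g k.+1 w i 0|)).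
- apply: nearW => j; rewrite enorm_ge0/=.
  apply: le_trans (enorm_le_sum _) _; apply: ler_sum => i _.
  by rewrite big_ord1 !mxE.
- exact: cvg_cst.
rewrite -[X in _ --> X](_ : \sum_(i < n)
    `|state c B x0 u g k.+1 w i 0 - state c B x0 u g k.+1 w i 0| = 0); last first.
  by apply: big1 => i _; rewrite subrr normr0.
apply: cvg_finite_sum => i; apply: cvg_norm; apply: cvgB => //; exact: cvg_cst.
Qed.

Lemma cost_parameter_cvg (g : Gamma) (s : nat -> Gamma) w :
  (fun j => mdist g (s j)) @ \oo --> 0 ->
  (fun j => cost c N B x0 u (s j) w) @ \oo --> cost c N B x0 u g w.
Proof.
move=> sg; apply: cvgD.
  apply: cvg_finite_sum => k.
  apply: (regular_coef_cvg (X := fun h => state c B x0 u h k w)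
    (regular_f hH2 L_ge0 U_segment hH4 (ltn_ord k)) (Uu (ltn_ord k) w)) => //.
  by apply: state_parameter_cvg => //; exact: ltnW.
apply: (regular_coef_cvg (X := fun h => state c B x0 u h N w)
    (regular_phi hH2 L_ge0 hH4 setT) (u := 0)) => //.
exact: state_parameter_cvg.
Qed.

Variable du : nat -> Omega -> 'cV[R]_m.
Hypothesis du_adapted : forall k, (k < N)%N -> adapted_to (filtration B k) (du k).

Lemma jmeas_variation k i : (k <= N)%N ->
  jmeas k (fun g w => variation c B x0 u du g k w i 0).
Proof.
elim: k i => [|k IH] i kN.
  by rewrite /jmeas; under eq_fun do rewrite /= mxE; exact: measurable_cst.
pose V g w := variation c B x0 u du g k w.
pose X g w := state c B x0 u g k w.
have mV j : jmeas k (fun g w => V g w j 0) by exact: IH (ltnW kN).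
have mdu j : jmeas k (fun _ w => du k w j 0).
  by apply: jmeas_past; exact: adapted_meas (du_adapted kN).
have mS : jmeas k.+1 (fun g w =>
    (\sum_j cbx c g k (X g w) (u k w) i j * V g w j 0
     + \sum_j cbu c g k (X g w) (u k w) i j * du k w j 0)
    + \sum_l B k.+1 w l 0 *
      (\sum_j csx c l g k (X g w) (u k w) i j * V g w j 0
       + \sum_j csu c l g k (X g w) (u k w) i j * du k w j 0)).
  apply: jmeasD.
    apply: (jmeasW (leqnSn k)); apply: jmeasD; apply: jmeas_sum => j; apply: jmeasM => //.
      exact: (jmeas_state_coef kN (regular_bx hH3 hH4 kN i j)).
    exact: (jmeas_state_coef kN (regular_bu hH3 hH4 kN i j)).
  apply: jmeas_sum => l; apply: jmeasM; first exact: jmeas_noise.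
  apply: (jmeasW (leqnSn k)); apply: jmeasD; apply: jmeas_sum => j; apply: jmeasM => //.
    exact: (jmeas_state_coef kN (regular_sx hH3 hH4 kN l i j)).
  exact: (jmeas_state_coef kN (regular_su hH3 hH4 kN l i j)).
move: mS; congr (measurable_fun _ _); apply/funext => z.
rewrite /= /dstep !mxE summxE; congr (_ + _ + _).
apply: eq_bigr => l _; rewrite !mxE; congr (_ * (_ + _)).
Qed.

End JointMeasurability.

(** * Square integrability along the filtration *)

Section IntegralLimits.
Context d (T : measurableType d) {R : realType}.
Variable mu : {measure set T -> \bar R}.

Lemma Rintegral_dominated_cvg (f_ : nat -> T -> R) (f g : T -> R) :
  (forall j, measurable_fun setT (f_ j)) -> measurable_fun setT f ->
  (forall x, (fun j => f_ j x) @ \oo --> f x) -> rint mu g ->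
  (forall j x, `|f_ j x| <= g x) ->
  (fun j => \int[mu]_x f_ j x) @ \oo --> \int[mu]_x f x.
Proof.
move=> mf_ mf f_f ig f_g.
have i_ j : rint mu (f_ j) by exact: rint_le ig.
have [||||| if_ _ cv] := @dominated_convergence _ _ _ mu setT measurableT
  (fun j => EFin \o f_ j) (EFin \o f) (EFin \o g).
- by move=> j; exact/measurable_EFinP.
- exact/measurable_EFinP.
- apply: aeW => x _; apply: cvg_EFin; last exact: f_f.
  exact: nearW.
- exact: ig.
- by apply: aeW => x j _; rewrite lee_fin.
move: cv; rewrite (RintegralE if_).
under eq_fun do rewrite (RintegralE (i_ _)).
by move=> /fine_cvg.
Qed.

Lemma measurable_enorm a c (X : T -> 'M[R]_(a, c)) :
  (forall i j, measurable_fun setT (fun w => X w i j)) ->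
  measurable_fun setT (fun w => enorm (X w)).
Proof.
move=> mX.
have msum : measurable_fun setT (fun w => \sum_i \sum_j X w i j ^+ 2).
  apply: measurable_sum => i; apply: measurable_sum => j.
  exact: measurable_funX.
apply: measurableT_comp msum; apply: continuous_measurable_fun.
exact: sqrt_continuous.
Qed.

End IntegralLimits.

(** On a probability space f ^ 2 is at most 1 + f ^ p. *)
Lemma sqint_of_powR d (T : measurableType d) {R : realType} (P : probability T R)
    (f : T -> R) (p : R) : measurable_fun setT f -> (forall w, 0 <= f w) -> 2 <= p ->
  (\int[P]_w (f w `^ p)%:E < +oo)%E -> sqint P f.
Proof.
move=> mf f0 p2 fp.
have mfp : measurable_fun setT (fun w => f w `^ p).
  exact: measurableT_comp (measurable_powR p) mf.
apply: rint_sqint => //.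
apply: (@rint_le _ _ _ _ _ (fun w => 1 + f w `^ p)).
- exact: measurable_funX.
- move=> w; rewrite ger0_norm ?sqr_ge0//.
  have [f1|/ltW f1] := leP (f w) 1.
    by rewrite (@le_trans _ _ 1) ?expr_le1// lerDl powR_ge0.
  by rewrite -powR_mulrn// (le_trans (ler_powR f1 p2))// lerDr.
- apply: rintD; first exact: rint_cst.
  apply/integrableP; split; first exact/measurable_EFinP.
  under eq_integral do rewrite /= ger0_norm ?powR_ge0//.
  exact: fp.
Qed.

Section MeanSquare.
Context dO (Omega : measurableType dO) {R : realType}.
Variable P : probability Omega R.
Context {d : nat} (N : nat).
Variable B : nat -> Omega -> 'cV[R]_d.
Hypothesis B_rv : forall k, (0 < k <= N)%N -> random_vector (B k).
Hypothesis B_indep : independent_vectors P N B.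
Variables (p Cp : R).
Hypothesis p_ge2 : 2 <= p.
Hypothesis B_moment : forall k, (0 < k <= N)%N ->
  ('E_P[(fun w => enorm (B k w) `^ p)%R] <= Cp%:E)%E.

Definition adL2 k (f : Omega -> R) :=
  measurable_fun setT (f : Past B k -> R) /\ sqint P f.

Lemma adL2_cst k a : adL2 k (fun=> a).
Proof. by split; [exact: measurable_cst|exact: sqint_cst]. Qed.

Lemma adL2D k f g : adL2 k f -> adL2 k g -> adL2 k (fun w => f w + g w).
Proof.
by move=> [mf f2] [mg g2]; split; [exact: measurable_funD|exact: sqintD].
Qed.

Lemma adL2Z k a f : adL2 k f -> adL2 k (fun w => a * f w).
Proof.
by move=> [mf f2]; split; [exact: measurable_funM|exact: sqintZ].
Qed.

Lemma noise_enorm_meas k : measurable_fun setT ((fun w => enorm (B k.+1 w)) : Noise B k -> R).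
Proof.
by apply: measurable_enorm => i j; rewrite ord1; exact: noise_meas_coord.
Qed.

Lemma noise_enorm_sqint k : (k < N)%N -> sqint P (fun w => enorm (B k.+1 w)).
Proof.
move=> kN; apply: (sqint_of_powR _ _ p_ge2).
- exact: (noise_meas B_rv kN (noise_enorm_meas (k := k))).
- by move=> w; exact: enorm_ge0.
have := @B_moment k.+1 kN; rewrite unlock => /le_lt_trans; apply.
exact: ltry.
Qed.

Lemma noise_coord_sqint k i : (k < N)%N -> sqint P (fun w => B k.+1 w i 0).
Proof.
move=> kN; apply: sqint_bound (noise_enorm_sqint kN).
  exact: (noise_meas B_rv kN (noise_meas_coord (k := k) i)).
by move=> w; rewrite (le_trans (le_enorm _ i 0))// ler_norm.
Qed.

Lemma adL2_mul_noise k f b : (k < N)%N -> adL2 k f ->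
  measurable_fun setT (b : Noise B k -> R) -> sqint P b ->
  adL2 k.+1 (fun w => f w * b w).
Proof.
move=> kN [mf f2] mb b2; split.
  apply: measurable_funM; first exact: past_measW (leqnSn k) mf.
  exact: noise_past_meas.
exact: (sqint_past_noise B_rv B_indep kN mf mb f2 b2).
Qed.

(** The factor K (1 + |B (k+1)|) is independent of the past, so the product
    with an F_k-measurable square integrable variable stays square integrable
    although the noise has only two moments. *)
Lemma adL2_dom K a x k : (k <= N)%N -> (forall j, (j < k)%N -> adL2 j (a j)) ->
  adL2 k (dom B K a x k).
Proof.
elim: k => [|k IH] kN ha; first exact: adL2_cst.
have h : adL2 k (fun w => K * (dom B K a x k w + a k w)).
  apply: adL2Z; apply: adL2D; last exact: ha.
  by apply: IH (ltnW kN) _ => j jk; apply: ha; exact: ltnW.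
have nb : measurable_fun setT ((fun w => 1 + enorm (B k.+1 w)) : Noise B k -> R).
  by apply: measurable_funD => //; exact: noise_enorm_meas.
have nb2 : sqint P (fun w => 1 + enorm (B k.+1 w)).
  by apply: sqintD; [exact: sqint_cst|exact: noise_enorm_sqint].
have := adL2_mul_noise kN h nb nb2; congr (adL2 _ _); apply/funext => w /=.
by rewrite mulrAC.
Qed.

Lemma measurable_dom K a x k : (k <= N)%N ->
  (forall j, (j < k)%N -> measurable_fun setT (a j)) ->
  measurable_fun setT (dom B K a x k).
Proof.
elim: k => [|k IH] kN ha; first exact: measurable_cst.
apply: measurable_funM.
  apply: measurable_funM => //; apply: measurable_funD => //.
  exact: (noise_meas B_rv kN (noise_enorm_meas (k := k))).
apply: measurable_funD; last exact: ha.
by apply: IH (ltnW kN) _ => j jk; apply: ha; exact: ltnW.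
Qed.

Lemma adL2_meas k f : (k <= N)%N -> adL2 k f -> measurable_fun setT f.
Proof. by move=> kN [mf _]; exact: (past_meas B_rv kN mf). Qed.

Lemma adL2_admissible {m : nat} (U : nat -> set 'cV[R]_m) q u k : 2 < q ->
  admissible P N B q U u -> (k < N)%N -> adL2 k (fun w => enorm (u k w)).
Proof.
move=> q2 [u_ad _ u_int] kN.
have mu : measurable_fun setT ((fun w => enorm (u k w)) : Past B k -> R).
  by apply: measurable_enorm => i j; exact: adapted_meas (u_ad k kN).
split=> //; apply: (sqint_of_powR _ _ (ltW q2)).
- exact: (past_meas B_rv (ltnW kN) mu).
- by move=> w; exact: enorm_ge0.
move: u_int; rewrite unlock; apply: le_lt_trans.
have mterm j : (j < N)%N -> measurable_fun setT (fun w => enorm (u j w) `^ q).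
  move=> jN; apply: measurableT_comp (measurable_powR q) _.
  apply: (past_meas B_rv (ltnW jN)).
  by apply: measurable_enorm => i l; exact: adapted_meas (u_ad j jN).
apply: ge0_le_integral => //.
- by move=> w _; rewrite lee_fin powR_ge0.
- by apply/measurable_EFinP; exact: mterm.
- apply/measurable_EFinP; rewrite (_ : (fun w => _)
    = fun w => \sum_(j <- index_enum 'I_N) enorm (u j w) `^ q)//.
  by apply: measurable_sum => j; exact: mterm.
move=> w _; rewrite lee_fin (bigD1 (Ordinal kN))//= lerDl sumr_ge0// => j _.
exact: powR_ge0.
Qed.

End MeanSquare.

(** * Danskin inequality and minimax *)

Section Minimax.
Context {R : realType} (X : topologicalType).
Implicit Types (K : set X) (f : X -> R).

(** Limits of sequences, replaced by cluster points: the weak topology is not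
    assumed to be metrizable. *)
Lemma compact_limit_point K (s : nat -> X) : compact K -> (forall j, K (s j)) ->
  exists2 x, K x & forall f (a : R), continuous f ->
    (forall e : R, 0 < e -> exists j0, forall j, (j0 <= j)%N -> f (s j) <= a + e) ->
    f x <= a.
Proof.
have FK : ProperFilter (s @ \oo) by apply: fmap_proper_filter.
move=> Kc sK; have [|x [Kx clx]] := Kc (s @ \oo) FK.
  by exists 0%N => // j _; exact: sK.
exists x => // f a fc fs; rewrite leNgt; apply/negP => afx.
have e0 : 0 < (f x - a) / 2 by rewrite divr_gt0// subr_gt0.
have [j0 Hj] := fs _ e0.
have N1 : (s @ \oo) [set s j | j in [set j | (j0 <= j)%N]].
  by exists j0 => // j jj; exists j.
have N2 : nbhs x [set y | a + (f x - a) / 2 < f y].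
  have /cvgrPdist_lt/(_ _ e0) : f y @[y --> x] --> f x by exact: fc.
  apply: filterS => y /=; rewrite ltr_distlC => /andP[+ _].
  by apply: le_lt_trans; lra.
have [y [[j /Hj fj <-]]] := clx _ _ N1 N2.
by rewrite /= ltNge fj.
Qed.

(** Almost minimisers accumulate at a minimiser; the first half shows in the
    same way that the function is bounded below. *)
Lemma compact_minimum K f : compact K -> K !=set0 -> continuous f ->
  exists2 x, K x & forall y, K y -> f x <= f y.
Proof.
move=> Kc K0 fc.
have bdd : exists M : R, forall y, K y -> M <= f y.
  apply: contrapT => unb.
  have /choice[s Hs] : forall j : nat, exists y, K y /\ f y < - j%:R.
    move=> j; apply: contrapT => no; apply: unb; exists (- j%:R) => y Ky.
    by rewrite leNgt; apply/negP => fy; apply: no; exists y.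
  have [x Kx Hx] := compact_limit_point Kc (fun j => (Hs j).1).
  suff : f x <= f x - 1 by lra.
  apply: Hx => // e e0; exists (Num.trunc (`|f x| + 1)).+1 => j jj.
  rewrite (le_trans (ltW (Hs j).2))//.
  have h1 : `|f x| + 1 < j%:R.
    apply: lt_le_trans (truncnS_gt _) _; by rewrite ler_nat.
  have h2 := ler_norm (- f x); rewrite normrN in h2.
  lra.
have hinf : has_inf (f @` K).
  have [y Ky] := K0; have [M HM] := bdd; split; first by exists (f y); exists y.
  by exists M => _ [z Kz <-]; exact: HM.
have /choice[s Hs] : forall j : nat, exists y, K y /\ f y < inf (f @` K) + j.+1%:R^-1.
  move=> j; have j0 : 0 < j.+1%:R^-1 :> R by [].
  by have [_ [y Ky <-] fy] := inf_adherent j0 hinf; exists y.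
have [x Kx Hx] := compact_limit_point Kc (fun j => (Hs j).1).
exists x => // y Ky; apply: (@le_trans _ _ (inf (f @` K))); last first.
  by apply: ge_inf; [case: hinf|exists y].
apply: Hx => // e e0; have [j0 Hj0] : exists j0 : nat, j0.+1%:R^-1 < e.
  exists (Num.trunc e^-1); rewrite invf_plt ?posrE//; exact: truncnS_gt.
exists j0 => j jj; rewrite (le_trans (ltW (Hs j).2))// lerD2l (le_trans _ (ltW Hj0))//.
by rewrite lef_pV2 ?posrE// ler_nat ltnS.
Qed.

(** Almost maximisers of the perturbations [Y j] accumulate at some point. It
    maximises [Y0], because [Y j] tends to [Y0] uniformly, and [z] is
    nonnegative there: a negative [z] would make the maximal value decrease to
    first order. *)
Lemma danskin K (Y0 z : X -> R) (Y : nat -> X -> R) (M : R) : compact K ->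
  continuous Y0 -> continuous z -> (forall x, K x -> z x <= M) ->
  (forall e : R, 0 < e -> exists j0, forall j, (j0 <= j)%N -> forall x, K x ->
     `|Y j x - Y0 x - j.+1%:R^-1 * z x| <= j.+1%:R^-1 * e) ->
  (forall j (e : R), 0 < e -> exists2 x, K x & forall y, K y -> Y0 y <= Y j x + e) ->
  exists2 x, K x & (forall y, K y -> Y0 y <= Y0 x) /\ 0 <= z x.
Proof.
move=> Kc Y0c zc zM expand opt.
pose t (j : nat) : R := j.+1%:R^-1.
have t0 j : 0 < t j by rewrite invr_gt0.
have /choice[s Hs] : forall j, exists x, K x /\ forall y, K y -> Y0 y <= Y j x + t j * t j.
  by move=> j; have [x Kx Hx] := opt j _ (mulr_gt0 (t0 j) (t0 j)); exists x.
have [x Kx Hx] := compact_limit_point Kc (fun j => (Hs j).1).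
have tsmall (e : R) : 0 < e -> exists j0, forall j, (j0 <= j)%N -> t j <= e.
  move=> e0; exists (Num.trunc e^-1) => j jj; rewrite /t.
  rewrite invf_ple ?posrE//; apply: ltW; apply: lt_le_trans (truncnS_gt _) _.
  by rewrite ler_nat ltnS.
exists x => //; split.
  move=> y Ky; rewrite -lerN2; apply: (Hx (fun x => - Y0 x)).
    by move=> x'; apply: continuousN; exact: Y0c.
  move=> e e0; have M0 : 0 < `|M| + 2 by rewrite ltr_wpDl.
  have [j1 Hj1] := expand 1 ltr01.
  have [j2 Hj2] := tsmall (e / (`|M| + 2)) (divr_gt0 e0 M0).
  exists (maxn j1 j2) => j; rewrite geq_max => /andP[/Hj1 h1 /Hj2 h2].
  have [Ks /(_ y Ky) h3] := Hs j; have := h1 _ Ks; rewrite ler_norml => /andP[_ h4].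
  rewrite -/(t j) in h4.
  have h5 : t j * (`|M| + 2) <= e by rewrite -ler_pdivlMr.
  have h6 : t j * z (s j) <= t j * `|M|.
    by rewrite ler_pM2l// (le_trans (zM _ Ks))// ler_norm.
  have h7 : t j * t j <= t j by rewrite ger_pMr// invf_le1// ler1n.
  lra.
rewrite -oppr_le0; apply: (Hx (fun x => - z x)).
  by move=> x'; apply: continuousN; exact: zc.
move=> e e0; have e20 : 0 < e / 2 by rewrite divr_gt0.
have [j1 Hj1] := expand _ e20; have [j2 Hj2] := tsmall _ e20.
exists (maxn j1 j2) => j; rewrite geq_max => /andP[/Hj1 h1 /Hj2 h2].
have [Ks /(_ (s j) Ks) h3] := Hs j.
have := h1 _ Ks; rewrite ler_norml -/(t j) => /andP[_ h4].
rewrite add0r -(ler_pM2l (t0 j)).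
have h5 : t j * t j <= t j * (e / 2) by rewrite ler_pM2l.
lra.
Qed.

Variable aff : set (X -> R).
Hypothesis aff_continuous : forall f, aff f -> continuous f.

(** Convexity of [K], in a space without linear structure, as far as the
    functions in [aff] can see it. *)
Definition mixable K := forall x y (t : R), K x -> K y -> 0 <= t <= 1 ->
  exists2 z, K z & forall f, aff f -> f z = t * f x + (1 - t) * f y.

Lemma closed_superlevel f (a : R) : continuous f -> closed [set x | a <= f x].
Proof.
move=> fc; have -> : [set x | a <= f x] = f @^-1` [set r | a <= r] by [].
by apply: closed_comp; [move=> x _; exact: fc|exact: closed_ge].
Qed.

Lemma mixable_superlevel K f (a : R) : aff f -> mixable K ->
  mixable (K `&` [set x | a <= f x]).
Proof.
move=> ff Kmix x y t [Kx fx] [Ky fy] t01; have [z Kz Hz] := Kmix x y t Kx Ky t01.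
exists z => //; split=> //=; rewrite Hz//; have /andP[t0 t1] := t01.
have h1 : t * a <= t * f x by rewrite ler_wpM2l.
have h2 : (1 - t) * a <= (1 - t) * f y by rewrite ler_wpM2l// subr_ge0.
lra.
Qed.

Let neg (s : R) : R := Num.max (- s) 0.

Let neg_continuous f : continuous f -> continuous (fun x => neg (f x) ^+ 2).
Proof.
move=> fc x; apply: (@continuous_comp _ _ _ (fun x => neg (f x)) (fun r => r ^+ 2)).
  apply: (@continuous_max _ _ (fun x => - f x) (fun=> 0)).
    by apply: continuousN; exact: fc.
  exact: cst_continuous.
exact: exprn_continuous.
Qed.

(* Squared distance to the half line: C1 with 2-Lipschitz derivative -2 neg. *)
Let neg_quadratic (s r : R) : neg (s + r) ^+ 2 <= neg s ^+ 2 - 2 * neg s * r + r ^+ 2.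
Proof.
rewrite /neg; case: (lerP (- s) 0) => hs; case: (lerP (- (s + r)) 0) => hr;
  rewrite ?expr0n/= ?mulr0 ?mul0r; nra.
Qed.

(** The point minimises the squared distance of (f1, f2) to the positive
    quadrant. If that distance were positive, the first order condition along
    mixtures would say that the residual (neg f1, neg f2), taken as weights,
    gives a combination of [f1] and [f2] that is negative on all of [K]. *)
Lemma two_inequalities K f1 f2 : compact K -> mixable K -> aff f1 -> aff f2 ->
  (forall t : R, 0 <= t <= 1 -> exists2 x, K x & 0 <= t * f1 x + (1 - t) * f2 x) ->
  exists2 x, K x & 0 <= f1 x /\ 0 <= f2 x.
Proof.
move=> Kc Kmix a1 a2 feas.
have K0 : K !=set0 by have [|x Kx _] := feas 0; [rewrite lexx ler01|exists x].
have Phic : continuous (fun x => neg (f1 x) ^+ 2 + neg (f2 x) ^+ 2).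
  by move=> x; apply: cvgD; apply: neg_continuous; exact: aff_continuous.
have [x0 Kx0 min0] := compact_minimum Kc K0 Phic.
pose r1 := neg (f1 x0); pose r2 := neg (f2 x0).
have r10 : 0 <= r1 by rewrite le_max lexx orbT.
have r20 : 0 <= r2 by rewrite le_max lexx orbT.
have first_order y : K y -> r1 * (f1 y - f1 x0) + r2 * (f2 y - f2 x0) <= 0.
  move=> Ky; rewrite leNgt; apply/negP => D0.
  set D := r1 * _ + _ in D0.
  pose C := (f1 y - f1 x0) ^+ 2 + (f2 y - f2 x0) ^+ 2.
  have C0 : 0 <= C by rewrite addr_ge0 ?sqr_ge0.
  have DC0 : 0 < D + C by rewrite ltr_wpDr.
  pose t := D / (D + C).
  have t0 : 0 < t by rewrite divr_gt0.
  have t1 : t <= 1 by rewrite ler_pdivrMr// mul1r lerDl.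
  have t01 : 0 <= t <= 1 by rewrite ltW.
  have [z Kz Hz] := Kmix y x0 t Ky Kx0 t01.
  have E f : aff f -> f z = f x0 + t * (f y - f x0) by move=> /Hz ->; ring.
  have := min0 z Kz; rewrite (E f1)// (E f2)// leNgt => /negP; apply.
  have q1 := neg_quadratic (f1 x0) (t * (f1 y - f1 x0)).
  have q2 := neg_quadratic (f2 x0) (t * (f2 y - f2 x0)).
  rewrite -/r1 -/r2 in q1 q2 *.
  apply: le_lt_trans (lerD q1 q2) _.
  (* [t] is small enough for the linear gain 2 t D to beat the quadratic loss. *)
  have tC : t * C < 2 * D.
    by rewrite /t mulrAC ltr_pdivrMr//; nra.
  have : t * (t * C) < t * (2 * D) by rewrite ltr_pM2l.
  rewrite /C /D; lra.
have [rpos|r0] := ltrP 0 (r1 + r2); last first.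
  exists x0 => //; have e1 : r1 = 0 by apply/eqP; rewrite eq_le r10 andbT; lra.
  have e2 : r2 = 0 by apply/eqP; rewrite eq_le r20 andbT; lra.
  have neg0 s : neg s = 0 -> 0 <= s.
    by move=> ns; rewrite -oppr_le0 -[leRHS]ns le_max lexx.
  by split; exact: neg0.
pose t := r1 / (r1 + r2).
have t01 : 0 <= t <= 1.
  by rewrite divr_ge0 ?addr_ge0//= ler_pdivrMr// mul1r lerDl.
have [y Ky Hy] := feas t t01.
have : (r1 + r2) * (t * f1 y + (1 - t) * f2 y) = r1 * f1 y + r2 * f2 y.
  by rewrite /t; field; rewrite gt_eqF.
have := mulr_ge0 (ltW rpos) Hy => + E; rewrite E => Hy'.
have nf s : neg s * s = - neg s ^+ 2.
  by rewrite /neg; case: (lerP (- s) 0) => hs; rewrite ?mul0r ?expr0n/= ?oppr0//; ring.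
have h1 := nf (f1 x0); have h2 := nf (f2 x0); rewrite -/r1 -/r2 in h1 h2.
have := first_order y Ky => fo.
have sq0 : r1 ^+ 2 + r2 ^+ 2 <= 0 by lra.
have [s1 s2] : r1 ^+ 2 = 0 /\ r2 ^+ 2 = 0.
  by split; apply/eqP; rewrite eq_le sqr_ge0 andbT; have := sqr_ge0 r1;
    have := sqr_ge0 r2; lra.
have z1 : r1 = 0 by apply/eqP; rewrite -sqrf_eq0; apply/eqP.
have z2 : r2 = 0 by apply/eqP; rewrite -sqrf_eq0; apply/eqP.
by have := rpos; rewrite [X in X + _]z1 [X in _ + X]z2 addr0 ltxx.
Qed.

(** Constraints are imposed one at a time, each cutting [K] down to a smaller
    set of the same kind. The remaining constraints stay feasible on the
    smaller set by [two_inequalities], as the family is convex. Compactness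
    then passes from finitely many constraints to all. *)
Lemma minimax (I : Type) (D : set I) (z : I -> X -> R) K :
  compact K -> K !=set0 -> mixable K -> (forall i, D i -> aff (z i)) ->
  (forall i1 i2 (t : R), D i1 -> D i2 -> 0 <= t <= 1 -> exists2 i, D i &
     forall x, z i x = t * z i1 x + (1 - t) * z i2 x) ->
  (forall i, D i -> exists2 x, K x & 0 <= z i x) ->
  exists2 x, K x & forall i, D i -> 0 <= z i x.
Proof.
move=> Kc K0 Kmix zaff Dconv feas.
pose Ks (s : seq I) := [set x | K x /\ forall i, List.In i s -> 0 <= z i x].
have finite s : (forall i, List.In i s -> D i) -> Ks s !=set0.
  rewrite /Ks => {Ks}; elim: s K Kc K0 Kmix feas => [|i s IH] K Kc [x0 Kx0] Kmix feas sD.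
    by exists x0; split.
  have Di : D i by apply: sD; left.
  pose K1 := K `&` [set x | 0 <= z i x].
  have K1c : compact K1.
    apply: compact_closedI => //; apply: closed_superlevel.
    exact: (aff_continuous (zaff i Di)).
  have K10 : K1 !=set0 by have [x Kx zx] := feas i Di; exists x.
  have K1mix : mixable K1 by apply: mixable_superlevel => //; exact: zaff.
  have K1feas i' : D i' -> exists2 x, K1 x & 0 <= z i' x.
    move=> Di'.
    have [|x Kx [z1 z2]] := two_inequalities Kc Kmix (zaff i Di) (zaff i' Di').
      move=> t t01; have [j Dj zj] := Dconv i i' t Di Di' t01.
      by have [x Kx] := feas j Dj; rewrite zj; exists x.
    by exists x.
  have [x [[Kx zx] Hx]] := IH K1 K1c K10 K1mix K1feas (fun i' h => sD i' (or_intror h)).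
  by exists x; split=> // i' [<-|]; [exact: zx|exact: Hx].
pose F := [set A : set X | exists s, (forall i, List.In i s -> D i) /\ Ks s `<=` A].
have FF : ProperFilter F.
  apply: Build_ProperFilter_ex.
    by move=> A [s [sD sA]]; have [x /sA Ax] := finite s sD; exists x.
  split.
  - by exists [::]; split.
  - move=> A A' [s [sD sA]] [s' [s'D s'A]]; exists (s ++ s'); split.
      by move=> i ii; have [/sD|/s'D] := @List.in_app_or I s s' i ii.
    by move=> x [Kx Hx]; split; [apply: sA|apply: s'A]; split=> // i ii;
      apply: Hx; apply: (@List.in_or_app I s s' i); [left|right].
  - by move=> A A' AA' [s [sD sA]]; exists s; split=> //; exact: subset_trans sA AA'.
have FK : F K by exists [::]; split=> // x [].
have [x [Kx clx]] := Kc F FF FK; exists x => // i Di.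
have cl : closed [set y | 0 <= z i y] by apply: closed_superlevel; exact: aff_continuous (zaff i Di).
apply: cl => B Bx; apply: clx => //.
exists [:: i]; split; first by move=> i' [<-|].
by move=> y [_]; apply; left.
Qed.

End Minimax.

(** * Weak topology and mixtures of measures *)

Section Mixture.
Context dT (T : measurableType dT) {R : realType}.
Variables (m1 m2 : probability T R) (t : R) (t01 : 0 <= t <= 1).

Let t0 : 0 <= t. Proof. by case/andP: t01. Qed.
Let s0 : 0 <= 1 - t. Proof. by rewrite subr_ge0; case/andP: t01. Qed.

Definition mixture : set T -> \bar R :=
  measure_add (mscale (NngNum t0) m1) (mscale (NngNum s0) m2).

HB.instance Definition _ := Measure.on mixture.

Lemma mixtureE A : mixture A = (t%:E * m1 A + (1 - t)%:E * m2 A)%E.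
Proof. exact: measure_addE. Qed.

Let mixture_setT : mixture [set: T] = 1%E.
Proof. by rewrite mixtureE !probability_setT !mule1 -EFinD addrC subrK. Qed.

HB.instance Definition _ := Measure_isProbability.Build _ _ _ mixture mixture_setT.

Lemma integral_mixture (h : T -> R) : measurable_fun setT h ->
  (forall x, 0 <= h x) -> (\int[mixture]_x (h x)%:E
    = t%:E * \int[m1]_x (h x)%:E + (1 - t)%:E * \int[m2]_x (h x)%:E)%E.
Proof.
move=> mh h0; have h0' x : setT x -> (0 <= (h x)%:E)%E by rewrite lee_fin.
have mh' : measurable_fun setT (fun x => (h x)%:E) by exact/measurable_EFinP.
by rewrite ge0_integral_measure_add// !ge0_integral_mscale.
Qed.

End Mixture.

Section WeakTopology.
Context {R : realType} (Gamma : pmetricType R).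
Local Notation borelG := (borel Gamma).

Lemma continuous_borel_measurable (h : Gamma -> R) : continuous h ->
  measurable_fun setT (h : borelG -> R).
Proof.
move=> hc; apply: (measurability _ (RGenOInfty.measurableE R)) => _ [_ [a ->] <-].
rewrite setTI; apply: open_borel.
have -> : h @^-1` [set` `]a, +oo[] = h @^-1` [set r | a < r].
  by apply/seteqP; split => x /=; rewrite in_itv/= andbT.
by apply: open_comp; [move=> x _; exact: hc|exact: open_gt].
Qed.

Lemma probability_integral_cst dT (T : measurableType dT) (lam : probability T R)
  (M : R) : (\int[lam]_(x in setT) M%:E = M%:E)%E.
Proof.
by rewrite integral_cst// -[RHS]mule1; congr (_ * _)%E; exact: probability_setT.
Qed.

Lemma probability_Rintegral_cst dT (T : measurableType dT) (lam : probability T R)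
  (M : R) : \int[lam]_(x in setT) M = M.
Proof. by rewrite /Rintegral probability_integral_cst. Qed.

Lemma bounded_rint dT (T : measurableType dT) (lam : probability T R)
  (h : T -> R) (M : R) : measurable_fun setT h -> (forall x, `|h x| <= M) ->
  rint lam h.
Proof. by move=> mh hM; apply: (rint_le mh hM); exact: rint_cst. Qed.

Lemma bounded_Rintegral dT (T : measurableType dT) (lam : probability T R)
  (h : T -> R) (M : R) : measurable_fun setT h -> (forall x, `|h x| <= M) ->
  `|\int[lam]_x h x| <= M.
Proof.
move=> mh hM; have hi := bounded_rint lam mh hM.
apply: le_trans (le_normr_Rintegral _ hi) _ => //.
apply: (@le_trans _ _ (\int[lam]_x M)); last first.
  by rewrite probability_Rintegral_cst.
by apply: le_Rintegral => //; [exact: integrable_norm|exact: rint_cst].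
Qed.

(** Weak continuity and compatibility with mixtures of measures are the only
    properties of the integrals of bounded continuous functions that the
    minimax argument needs. *)
Definition weak_linear : set (weak_probability Gamma -> R) :=
  [set f | exists h : Gamma -> R, [/\ continuous h,
     exists M : R, forall g, `|h g| <= M &
     forall lam : probability borelG R, f lam = \int[lam]_g h g]].

Lemma weak_linear_continuous f : weak_linear f -> continuous f.
Proof.
move=> [h [hc hM fE]]; pose hb : bounded_continuous Gamma := exist _ h (conj hc hM).
have -> : f = (fun x : {ptws bounded_continuous Gamma -> R} => x hb)
    \o (@weak_pairing _ Gamma : weak_probability Gamma -> _).
  by apply/funext => lam /=; rewrite fE.
move=> lam; apply: continuous_comp; first exact: initial_continuous.
exact: (@proj_continuous {classic (bounded_continuous Gamma)} (fun=> R) hb).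
Qed.

(** Integrals against a mixture are computed for nonnegative functions first; a
    bounded function is reduced to that case by adding a constant. *)
Lemma convex_mixable (Lam : set (probability borelG R)) :
  convex_probabilities Lam -> mixable weak_linear Lam.
Proof.
move=> Lconv m1 m2 t L1 L2 t01; pose lam : probability borelG R := mixture m1 m2 t01.
exists lam; first by apply: (Lconv m1 m2 lam t) => // A _; exact: mixtureE.
move=> f [h [hc [M hM] fE]]; have mh := continuous_borel_measurable hc.
have mhM : measurable_fun setT ((fun x => h x + M) : borelG -> R).
  exact: measurable_funD.
have hM0 x : 0 <= h x + M.
  by have := hM x; rewrite ler_norml -lerBlDr sub0r => /andP[].
have hi (m : probability borelG R) := bounded_rint m mh hM.
have split_int (m : probability borelG R) :
    (\int[m]_x (h x + M)%:E = (\int[m]_x h x + M)%:E)%E.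
  rewrite RintegralE; last by apply: rintD; [exact: hi|exact: rint_cst].
  rewrite RintegralD//; [|exact: hi|exact: rint_cst].
  by rewrite probability_Rintegral_cst.
have := integral_mixture m1 m2 t01 mhM hM0; rewrite !split_int -!EFinM -EFinD => -[].
by rewrite !fE; lra.
Qed.

End WeakTopology.

(** * Localisation on events *)

Section Localization.
Local Open Scope ereal_scope.
Context d1 (M : measurableType d1) {R : realType} (lam : probability M R).
Context d2 (Omega : measurableType d2) (P : probability Omega R).
Context d3 (S : measurableType d3) (pi : Omega -> S).
Hypothesis mpi : measurable_fun setT pi.
Variable F : M -> S -> R.
Hypothesis mF : measurable_fun setT (fun z : M * S => F z.1 z.2).
Variable C : R.
Hypothesis F_le : forall g, \int[P]_w `|(F g (pi w))%:E| <= C%:E.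

Let meas_mean : measurable_fun setT (fun s => \int[lam]_g (F g s)%:E).
Proof.
have mE : measurable_fun setT (fun z : M * S => (F z.1 z.2)%:E).
  exact/measurable_EFinP.
have -> : (fun s => \int[lam]_g (F g s)%:E)
    = (fun s => \int[lam]_g (fun z : M * S => (F z.1 z.2)%:E)^\+ (g, s)
              - \int[lam]_g (fun z : M * S => (F z.1 z.2)%:E)^\- (g, s)).
  by apply/funext => s; rewrite [LHS]integralE funepos.unlock funeneg.unlock.
apply: emeasurable_funB.
  apply: (measurable_fun_fubini_tonelli_G (m1 := lam)
    ((fun z : M * S => (F z.1 z.2)%:E)^\+)) => //.
  exact: measurable_funepos.
apply: (measurable_fun_fubini_tonelli_G (m1 := lam)
    ((fun z : M * S => (F z.1 z.2)%:E)^\-)) => //.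
exact: measurable_funeneg.
Qed.

(** The hypothesis is tested on the event where the average over [g] is
    negative. The average is a function of [pi], so this is an event of the
    sub-sigma-algebra generated by [pi]; Fubini then makes the integral of the
    negative part vanish. *)
Lemma ae_nonneg_average :
  (forall A : set S, measurable A ->
     0 <= \int[lam]_g \int[P]_w (\1_A (pi w) * F g (pi w))%:E) ->
  {ae P, forall w, lam.-integrable setT (fun g => (F g (pi w))%:E) /\
    0 <= \int[lam]_g (F g (pi w))%:E}.
Proof.
move=> Fpos.
have mpi2 : measurable_fun setT (fun z : M * Omega => (z.1, pi z.2)).
  by apply: measurable_fun_pair => //; exact: measurableT_comp.
have mG : measurable_fun setT (fun z : M * Omega => (F z.1 (pi z.2))%:E).
  by apply/measurable_EFinP; exact: (measurableT_comp mF mpi2).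
have Gint : (lam \x P).-integrable setT (fun z : M * Omega => (F z.1 (pi z.2))%:E).
  apply/(integrable12ltyP _ _ mG).
  apply: (@le_lt_trans _ _ (\int[lam]_g C%:E)).
    have mabs0 : measurable_fun setT
        (abse \o (fun z : M * Omega => (F z.1 (pi z.2))%:E)).
      exact: measurableT_comp.
    have mabs : measurable_fun setT (fun g => \int[P]_w `|(F g (pi w))%:E|).
      apply: (measurable_fun_fubini_tonelli_F (m2 := P)
        (abse \o (fun z : M * Omega => (F z.1 (pi z.2))%:E))) => // z.
      exact: abse_ge0.
    apply: ge0_le_integral => //; last by move=> g _; exact: F_le.
    by move=> g _; apply: integral_ge0.
  by rewrite probability_integral_cst ltry.
pose E s := \int[lam]_g (F g s)%:E.
pose A := [set s | E s < 0].
have mA : measurable A.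
  have := measurable_lte measurableT meas_mean (measurable_cst 0).
  by rewrite setTI.
pose G z := (\1_A (pi z.2) * F z.1 (pi z.2))%:E.
have mG' : measurable_fun setT (G : M * Omega -> \bar R).
  apply/measurable_EFinP; apply: measurable_funM; last exact/measurable_EFinP.
  have mp : measurable_fun setT (fun z : M * Omega => pi z.2) by exact: measurableT_comp.
  have m1 : measurable_fun setT (\1_A : S -> R) by exact: measurable_indic.
  exact: (measurableT_comp m1 mp).
have G_int : (lam \x P).-integrable setT G.
  apply: (le_integrable measurableT mG' _ Gint) => z _.
  rewrite /G /= lee_fin normrM ler_piMl//.
  by rewrite /indic; case: (_ \in _); rewrite ?normr1// normr0.
pose H w := if E (pi w) < 0 then E (pi w) else 0.
have HE w : \int[lam]_g G (g, w) = H w.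
  rewrite /G /H /=; case: ifPn => h.
    by apply: eq_integral => g _; rewrite indicE mem_set//= mul1r.
  rewrite (eq_integral (cst 0)) ?integral0// => g _.
  by rewrite indicE memNset ?mul0r//; exact/negP.
have H0 : 0 <= \int[P]_w H w.
  rewrite (eq_integral _ _ (fun w _ => esym (HE w))) -(Fubini G_int).
  exact: Fpos.
have mH : measurable_fun setT H.
  have := measurable_fubini_G G_int; congr (measurable_fun _ _).
  by apply/funext => w; rewrite /fubini_G HE.
have Hle w : H w <= 0 by rewrite /H; case: ifPn => // /ltW.
have H00 : \int[P]_w `|H w| = 0.
  apply/eqP; rewrite eq_le integral_ge0// andbT -leeN2 oppe0.
  rewrite -integral_ge0N// (eq_integral H)// => w _.
  by rewrite lee0_abs ?oppeK.
have := (ae_eq_integral_abs P measurableT mH).1 H00.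
have := ae_integrable2 Gint.
apply: filterS2 => w w1 /(_ I) w2; split=> //.
by move: w2; rewrite /H /=; case: ltP => // + E0; rewrite E0 ltxx.
Qed.

End Localization.

(** * Families that are square integrable uniformly over the parameter *)

(** Dominated convergence speaks of sequences; continuity in the parameter is
    recovered from it here. *)
Lemma sequential_continuity {R : realType} {Gamma : pmetricType R} (h : Gamma -> R) :
  (forall g (s : nat -> Gamma), (fun j => mdist g (s j)) @ \oo --> 0 ->
     (fun j => h (s j)) @ \oo --> h g) -> continuous h.
Proof.
move=> H g; apply/cvgrPdist_lt => e e0.
have [[delta d0 Hd]|no] := pselect (exists2 delta : R, 0 < delta &
    forall g', mdist g g' < delta -> `|h g - h g'| < e).
  apply/nbhs_ballP; exists delta => //= g'; rewrite ballEmdist/=; exact: Hd.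
have /choice[s Hs] : forall j : nat, exists g',
    mdist g g' < j.+1%:R^-1 /\ ~ `|h g - h g'| < e.
  move=> j; apply/not_existsP => Hj; apply: no; exists j.+1%:R^-1 => // g' gg'.
  by apply: contrapT => eg'; apply: (Hj g').
have sg : (fun j => mdist g (s j)) @ \oo --> 0.
  apply: (@squeeze_cvgr _ _ _ _ (fun=> 0) (@harmonic R)).
  - by apply: nearW => j; rewrite mdist_ge0/= ltW// (Hs j).1.
  - exact: cvg_cst.
  - exact: cvg_harmonic.
have /cvgrPdist_lt/(_ e e0) := H g s sg.
by move=> [j0 _ /(_ j0 (leqnn _))] /(Hs j0).2.
Qed.

Lemma integral_in_indic dT (T : measurableType dT) {R : realType}
  (mu : {measure set T -> \bar R}) (A : set T) (f : T -> R) :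
  (\int[mu]_(w in A) (f w)%:E = \int[mu]_w (\1_A w * f w)%:E)%E.
Proof.
rewrite integral_mkcond epatch_indic; apply: eq_integral => w _ /=.
by rewrite -EFinM mulrC.
Qed.

Section UniformMeanSquare.
Context dO (Omega : measurableType dO) {R : realType} (I : Type).
Variable P : probability Omega R.

(** A single constant for all parameters, so that the bound survives
    integration against any probability measure on the parameters. *)
Definition ubL2 (F : I -> Omega -> R) := exists K, forall g, sqint_le P K (F g).

Lemma ubL2_sqint F g : ubL2 F -> sqint P (F g).
Proof. by move=> [K FK]; exists K. Qed.

Lemma ubL2D (F F' : I -> Omega -> R) : ubL2 F -> ubL2 F' -> ubL2 (fun g w => F g w + F' g w).
Proof.
by move=> [K FK] [K' FK']; exists (2 * K + 2 * K') => g; exact: sqint_leD.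
Qed.

Lemma ubL2_cst (f : Omega -> R) : sqint P f -> ubL2 (fun _ => f).
Proof. by move=> [K fK]; exists K. Qed.

Lemma ubL2_sum (J : Type) (s : seq J) (F : J -> I -> Omega -> R) :
  (forall j, ubL2 (F j)) -> ubL2 (fun g w => \sum_(j <- s) F j g w).
Proof.
move=> FL2; elim: s => [|j s IH].
  have -> : (fun g w => \sum_(j <- [::]) F j g w) = (fun _ _ => 0).
    by apply/funext => g; apply/funext => w; rewrite big_nil.
  exact: (ubL2_cst (sqint_cst P 0)).
have -> : (fun g w => \sum_(i <- j :: s) F i g w)
    = (fun g w => F j g w + \sum_(i <- s) F i g w).
  by apply/funext => g; apply/funext => w; rewrite big_cons.
exact: ubL2D.
Qed.

Lemma ubL2_bound (F : I -> Omega -> R) (h : Omega -> R) : (forall g, measurable_fun setT (F g)) ->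
  (forall g w, `|F g w| <= `|h w|) -> sqint P h -> ubL2 F.
Proof. by move=> mF Fh [K hK]; exists K => g; exact: (sqint_le_bound (mF g) (Fh g) hK). Qed.

Lemma ubL2_mul_bounded (M : R) (a F : I -> Omega -> R) :
  (forall g, measurable_fun setT (a g)) -> (forall g w, `|a g w| <= M) ->
  ubL2 F -> ubL2 (fun g w => a g w * F g w).
Proof.
move=> ma aM [K FK]; exists (M ^+ 2 * K) => g.
apply: (sqint_le_bound _ _ (sqint_leZ M (FK g))).
  by apply: measurable_funM => //; case: (FK g).
move=> w; rewrite !normrM ler_wpM2r//.
by rewrite (le_trans (aM g w))// ler_norm.
Qed.

End UniformMeanSquare.

Section PairingIntegrable.
Context dO (Omega : measurableType dO) {R : realType}.
Variable P : probability Omega R.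

Lemma rint_row_mul a (J : Omega -> 'rV[R]_a) (y : Omega -> 'cV[R]_a) :
  (forall i, sqint P (fun w => J w 0 i)) -> (forall i, sqint P (fun w => y w i 0)) ->
  rint P (fun w => (J w *m y w) 0 0).
Proof.
move=> J2 y2.
have : rint P (fun w => \sum_i J w 0 i * y w i 0).
  by apply: rint_sum => i; exact: sqint_mul (J2 i) (y2 i).
by congr (rint _ _); apply/funext => w; rewrite mxE.
Qed.

Lemma rint_inner a (x y : Omega -> 'cV[R]_a) :
  (forall i, sqint P (fun w => x w i 0)) -> (forall i, sqint P (fun w => y w i 0)) ->
  rint P (fun w => inner (x w) (y w)).
Proof. by move=> x2 y2; apply: rint_sum => i; exact: sqint_mul (x2 i) (y2 i). Qed.

End PairingIntegrable.

Section Controls.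
Context {R : realType} {m d : nat} (N : nat).
Context {dO : measure_display} {Omega : measurableType dO}.
Variable P : probability Omega R.
Variable B : nat -> Omega -> 'cV[R]_d.
Hypothesis B_rv : forall k, (0 < k <= N)%N -> random_vector (B k).
Variables (U : nat -> set 'cV[R]_m) (q : R).

Let power_sum_meas (u : nat -> Omega -> 'cV[R]_m) :
  (forall k, (k < N)%N -> adapted_to (filtration B k) (u k)) ->
  measurable_fun setT (fun w => \sum_(k < N) enorm (u k w) `^ q).
Proof.
move=> ua; apply: (@measurable_sum _ _ _ _ _ (index_enum 'I_N)
  (fun (k : 'I_N) w => enorm (u k w) `^ q)) => k.
apply: measurableT_comp (measurable_powR q) _.
apply: (past_meas B_rv (ltnW (ltn_ord k))).
by apply: measurable_enorm => i l; exact: adapted_meas (ua k (ltn_ord k)).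
Qed.

Let power_sum_ge0 (u : nat -> Omega -> 'cV[R]_m) w :
  0 <= \sum_(k < N) enorm (u k w) `^ q.
Proof. by apply: sumr_ge0 => k _; exact: powR_ge0. Qed.

Lemma admissible_rint u : admissible P N B q U u ->
  rint P (fun w => \sum_(k < N) enorm (u k w) `^ q).
Proof.
move=> [ua _ ui]; rewrite unlock in ui; apply/integrableP; split.
  by apply/measurable_EFinP; exact: power_sum_meas.
by under eq_integral => w _ do rewrite /= (ger0_norm (power_sum_ge0 u w)).
Qed.

Lemma rint_admissible u (h : Omega -> R) :
  (forall k, (k < N)%N -> forall w, U k (u k w)) ->
  (forall k, (k < N)%N -> adapted_to (filtration B k) (u k)) -> rint P h ->
  (forall w, \sum_(k < N) enorm (u k w) `^ q <= h w) -> admissible P N B q U u.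
Proof.
move=> Uu ua hi uh; split=> //; rewrite unlock.
have : rint P (fun w => \sum_(k < N) enorm (u k w) `^ q).
  apply: (rint_le (power_sum_meas ua) _ hi) => w.
  by rewrite (ger0_norm (power_sum_ge0 u w)).
move=> /integrableP[_]; congr (_ < _)%E; apply: eq_integral => w _ /=.
by rewrite (ger0_norm (power_sum_ge0 u w)).
Qed.

(** Written as an increment of [u], so that the direction [spike - u] is an
    indicator times [a - u]. *)
Definition spike (u : nat -> Omega -> 'cV[R]_m) (k : nat) (A : set Omega)
    (a : 'cV[R]_m) (j : nat) (w : Omega) : 'cV[R]_m :=
  u j w + (if j == k then \1_A w *: (a - u j w) else 0).

Lemma spikeE u k A a j w :
  spike u k A a j w = if (j == k) && (w \in A) then a else u j w.
Proof.
rewrite /spike indicE; case: eqP => _ /=; last by rewrite addr0.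
by case: (w \in A); rewrite ?scale1r ?scale0r ?addr0// addrC subrK.
Qed.

Lemma spike_admissible u k (A : set Omega) a : admissible P N B q U u ->
  (k < N)%N -> filtration B k A -> U k a -> admissible P N B q U (spike u k A a).
Proof.
move=> u_adm kN FA Ua; have [ua Uu _] := u_adm.
have ad j : (j < N)%N -> adapted_to (filtration B j) (spike u k A a j).
  move=> jN; have [jk|jk] := eqVneq j k; last first.
    have -> : spike u k A a j = u j.
      by apply/funext => w; rewrite spikeE (negbTE jk).
    exact: ua.
  rewrite jk in jN *; apply: meas_adapted => i l; rewrite ord1.
  have mu := adapted_meas i 0 (ua k kN).
  have mA : measurable_fun setT (\1_A : Past B k -> R) by exact: measurable_indic.
  have : measurable_fun setT
      ((fun w => u k w i 0 + \1_A w * (a i 0 - u k w i 0)) : Past B k -> R).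
    by apply: measurable_funD => //; apply: measurable_funM => //; exact: measurable_funB.
  by congr (measurable_fun _ _); apply/funext => w; rewrite /spike eqxx !mxE.
apply: (rint_admissible _ ad).
- move=> j jN w; rewrite spikeE; case: eqP => [->|_] /=; last exact: Uu.
  by case: ifP => // _; exact: Uu.
- exact: (rintD (admissible_rint u_adm) (rint_cst P (\sum_(j < N) enorm a `^ q))).
- move=> w; rewrite /= -big_split; apply: ler_sum => j _.
  rewrite spikeE; case: ifP => _; first by rewrite lerDr powR_ge0.
  by rewrite lerDl powR_ge0.
Qed.

End Controls.

Lemma ubL2_inner_bound dO (Omega : measurableType dO) {R : realType}
  (P : probability Omega R) (I : Type) a (h : I -> Omega -> 'cV[R]_a)
  (y : Omega -> 'cV[R]_a) :
  (forall i, ubL2 P (fun g w => h g w i 0)) -> (forall i, sqint P (fun w => y w i 0)) ->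
  exists C : R, forall g, (\int[P]_w `|(inner (h g w) (y w))%:E| <= C%:E)%E.
Proof.
move=> /choice[K hK] /[dup] y2 /choice[K' yK'].
exists (\sum_i (K i + K' i)) => g.
have h2 i : sqint P (fun w => h g w i 0) by exists (K i); exact: hK.
have hy := rint_inner h2 y2.
have sq_int i : rint P (fun w => h g w i 0 ^+ 2 + y w i 0 ^+ 2).
  by apply: rintD; exact: sqint_rint.
rewrite (_ : (\int[P]_w _)%E = (\int[P]_w `|inner (h g w) (y w)|)%:E); last first.
  by rewrite -RintegralE//; exact: integrable_norm.
rewrite lee_fin.
apply: (@le_trans _ _ (\int[P]_w \sum_i (h g w i 0 ^+ 2 + y w i 0 ^+ 2))).
  apply: le_Rintegral => //; [exact: integrable_norm|exact: rint_sum|].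
  move=> w _; rewrite (le_trans (ler_norm_sum _ _ _))//; apply: ler_sum => i _.
  rewrite ler_norml; have := sqr_ge0 (h g w i 0 - y w i 0).
  by have := sqr_ge0 (h g w i 0 + y w i 0) => s1 s2; apply/andP; split; nra.
rewrite Rintegral_sum//; apply: ler_sum => i _.
rewrite RintegralD//; [|exact: sqint_rint|exact: sqint_rint].
by apply: lerD; apply: sqint_le_Rintegral; [exact: hK|exact: yK'].
Qed.

(** The sigma-algebra of Omega is finer than F_k. *)
Lemma jmeas_joint {R : realType} {Gamma : pmetricType R} {d N : nat}
  {dO} {Omega : measurableType dO} (B : nat -> Omega -> 'cV[R]_d)
  (B_rv : forall k, (0 < k <= N)%N -> random_vector (B k)) k
  (F : Gamma -> Omega -> R) : (k <= N)%N -> jmeas B k F ->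
  measurable_fun setT (fun z : borel Gamma * Omega => F z.1 z.2).
Proof.
move=> kN mF.
have mid : measurable_fun setT
    (fun z : borel Gamma * Omega => ((z.1, z.2) : borel Gamma * Past B k)).
  have m1 : measurable_fun setT (fun z : borel Gamma * Omega => z.1).
    exact: measurable_fst.
  have m2 : measurable_fun setT (fun z : borel Gamma * Omega => z.2).
    exact: measurable_snd.
  have m2' := measurableT_comp (measurable_past_id B_rv kN) m2.
  exact: (measurable_fun_pair m1 m2').
exact: (measurableT_comp mF mid).
Qed.

(** * Expansion of the mean cost, adjoint pair and worst-case measure *)

Section Model.
Context {R : realType} {n m d : nat} (N : nat).
Context {dO : measure_display} {Omega : measurableType dO}.
Variable P : probability Omega R.
Variable B : nat -> Omega -> 'cV[R]_d.
Hypothesis B_rv : forall k, (0 < k <= N)%N -> random_vector (B k).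
Hypothesis B_indep : independent_vectors P N B.
Variables (p Cp : R).
Hypothesis p_ge2 : 2 <= p.
Hypothesis B_moment : forall k, (0 < k <= N)%N ->
  ('E_P[(fun w => enorm (B k w) `^ p)%R] <= Cp%:E)%E.
Variable U : nat -> set 'cV[R]_m.
Hypothesis U_segment : forall k u u' (t : R), (k < N)%N -> U k u -> U k u' ->
  0 <= t <= 1 -> U k (u + t *: (u' - u)).
Variable q : R.
Hypothesis q_gt2 : 2 < q.
Context {Gamma : pmetricType R}.
Hypothesis Gamma_polish : polish R Gamma.
Variables (c : coefficients R Gamma n m d) (x0 : 'cV[R]_n) (L : R).
Hypothesis L_ge0 : 0 <= L.
Variable v : nat -> 'cV[R]_m.
Hypothesis v_in : forall k, (k < N)%N -> U k (v k).
Hypotheses (hH1 : H1 c N U L v) (hH2 : H2 c N U L v).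
Hypothesis phi_bounded_at_0 : forall g, `|cphi c g 0| <= L.
Hypotheses (hH3 : H3 c N U) (hH4 : H4 c N U).

Section Expansion.
Local Notation adm := (admissible P N B q U).
Local Notation adL2 := (adL2 P B).
Local Notation K := (@step_const R n d L).
Local Notation growth := (growth L v B x0).
Local Notation gap := (gap (n := n) L B).
Local Notation incr := (incr (n := n) L B).

Lemma admissible_Ubar u : adm u -> Ubar N U u.
Proof. by case. Qed.

Lemma admissible_adapted u k : adm u -> (k < N)%N -> adapted_to (filtration B k) (u k).
Proof. by case=> + _ _ kN; exact. Qed.

Lemma admissible_adL2 u k : adm u -> (k < N)%N -> adL2 k (fun w => enorm (u k w)).
Proof. exact: adL2_admissible. Qed.

Lemma growth_adL2 u k : adm u -> (k <= N)%N -> adL2 k (growth u k).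
Proof.
move=> u_adm kN; apply: (adL2_dom B_rv B_indep p_ge2 B_moment) => // j jk.
apply: adL2D; last exact: adL2_cst.
apply: adL2D; first exact: adL2_cst.
by apply: admissible_adL2 => //; exact: leq_trans jk kN.
Qed.

Lemma cost_bound_rint u : adm u -> rint P (cost_bound N L v B x0 u).
Proof.
move=> u_adm; apply: rintD.
  apply: rint_sum => k; apply: rintZ; apply: sqint_rint.
  have [] : adL2 k (fun w => 1 + growth u k w + enorm (u k w) + enorm (v k)).
    apply: adL2D; last exact: adL2_cst.
    apply: adL2D; last exact: admissible_adL2.
    by apply: adL2D; [exact: adL2_cst|exact: growth_adL2 u_adm (ltnW (ltn_ord k))].
  by [].
apply: rintZ; apply: sqint_rint.
have [] : adL2 N (fun w => 1 + growth u N w).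
  by apply: adL2D; [exact: adL2_cst|exact: growth_adL2].
by [].
Qed.

Definition mean_cost u g : R := \int[P]_w cost c N B x0 u g w.

Lemma jmeas_admissible_cost u : adm u -> jmeas B N (cost c N B x0 u).
Proof.
move=> u_adm; apply: (jmeas_cost (U := U) (L := L) (v := v)) => //.
- exact: admissible_Ubar.
- by move=> k kN; exact: admissible_adapted.
Qed.

Lemma cost_meas u g : adm u -> measurable_fun setT (cost c N B x0 u g).
Proof.
move=> u_adm; apply: (past_meas B_rv (leqnn N)).
exact: jmeas_section (jmeas_admissible_cost u_adm).
Qed.

Lemma cost_le_bound u g w : adm u ->
  `|cost c N B x0 u g w| <= cost_bound N L v B x0 u w.
Proof.
by move=> /admissible_Ubar Uu; exact: (cost_growth B x0 hH1 hH2 L_ge0 v_in U_segment phi_bounded_at_0).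
Qed.

Lemma cost_rint u g : adm u -> rint P (cost c N B x0 u g).
Proof.
move=> u_adm; apply: rint_le (cost_bound_rint u_adm); first exact: cost_meas.
by move=> w; exact: cost_le_bound.
Qed.

Lemma valueE u g : adm u -> value P c N B x0 u g = (mean_cost u g)%:E.
Proof. by move=> u_adm; rewrite /value unlock -RintegralE//; exact: cost_rint. Qed.

Lemma mean_cost_bound u g : adm u ->
  `|mean_cost u g| <= \int[P]_w cost_bound N L v B x0 u w.
Proof.
move=> u_adm; apply: le_trans (le_normr_Rintegral _ _) _ => //.
  exact: cost_rint.
apply: le_Rintegral => //.
- by apply: integrable_norm; exact: cost_rint.
- exact: cost_bound_rint.
- by move=> w _; exact: cost_le_bound.
Qed.

(** The pathwise bound on the cost does not depend on the parameter, so
    dominated convergence applies. *)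
Lemma mean_cost_continuous u : adm u -> continuous (mean_cost u).
Proof.
move=> u_adm; apply: sequential_continuity => g s sg.
apply: (Rintegral_dominated_cvg (g := cost_bound N L v B x0 u)).
- by move=> j; exact: cost_meas.
- exact: cost_meas.
- move=> w; apply: (cost_parameter_cvg (U := U) (L := L) (v := v)) => //.
  exact: admissible_Ubar.
- exact: cost_bound_rint.
- by move=> j w; exact: cost_le_bound.
Qed.

(** The norm of the combination is at most the larger of the two norms, hence
    its power at most the sum of the two powers. *)
Lemma perturbed_admissible u u' (t : R) : adm u -> adm u' -> 0 <= t <= 1 ->
  adm (fun k w => u k w + t *: (u' k w - u k w)).
Proof.
move=> u_adm u'_adm t01; have /andP[t0 t1] := t01.
have [ua Uu _] := u_adm; have [u'a Uu' _] := u'_adm.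
have ad k : (k < N)%N -> adapted_to (filtration B k)
    (fun w => u k w + t *: (u' k w - u k w)).
  move=> kN; apply: meas_adapted => i j.
  have mu : measurable_fun setT ((fun w => u k w i j) : Past B k -> R).
    by rewrite ord1; exact: adapted_meas (ua k kN).
  have mu' : measurable_fun setT ((fun w => u' k w i j) : Past B k -> R).
    by rewrite ord1; exact: adapted_meas (u'a k kN).
  have : measurable_fun setT
      ((fun w => u k w i j + t * (u' k w i j - u k w i j)) : Past B k -> R).
    by apply: measurable_funD => //; apply: measurable_funM => //;
      exact: measurable_funB.
  by congr (measurable_fun _ _); apply/funext => w; rewrite !mxE.
apply: (rint_admissible B_rv _ ad
  (rintD (admissible_rint B_rv u_adm) (admissible_rint B_rv u'_adm))).
  by move=> k kN w; apply: (U_segment kN _ _ t01); [exact: Uu|exact: Uu'].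
have q0 : 0 <= q by rewrite ltW// (lt_trans _ q_gt2).
move=> w; rewrite /= -big_split.
apply: ler_sum => k _.
set a := u k w; set b := u' k w.
have le_max : enorm (a + t *: (b - a)) <= Num.max (enorm a) (enorm b).
  have -> : a + t *: (b - a) = (1 - t) *: a + t *: b.
    by rewrite scalerBr scalerBl scale1r addrA addrAC.
  rewrite (le_trans (enormD _ _))// !enormZ !ger0_norm ?subr_ge0//.
  set M := Num.max _ _.
  have -> : M = (1 - t) * M + t * M by ring.
  by rewrite lerD// ler_wpM2l ?subr_ge0// le_max lexx ?orbT.
apply: (@le_trans _ _ (Num.max (enorm a) (enorm b) `^ q)).
  apply: (ge0_ler_powR q0) le_max; first by rewrite nnegrE enorm_ge0.
  by rewrite nnegrE le_max enorm_ge0.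
rewrite /Num.max; case: ifP => _; first by rewrite lerDr powR_ge0.
by rewrite lerDl powR_ge0.
Qed.

Section Direction.
Variables (u u' : nat -> Omega -> 'cV[R]_m).
Hypotheses (u_adm : adm u) (u'_adm : adm u').

Local Notation du := (fun k w => u' k w - u k w).
Local Notation ut t := (perturbed u du t).

Let Uu : Ubar N U u. Proof. exact: admissible_Ubar. Qed.
Let Uu1 : Ubar N U (fun k w => u k w + du k w).
Proof. by move=> k kN w; rewrite addrC subrK; exact: admissible_Ubar. Qed.

Let ut_adm t : 0 <= t <= 1 -> adm (ut t).
Proof. exact: perturbed_admissible. Qed.

Lemma direction_adapted k : (k < N)%N -> adapted_to (filtration B k) (du k).
Proof.
move=> kN; apply: meas_adapted => i j; rewrite ord1.
have mu := adapted_meas i 0 (admissible_adapted u_adm kN).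
have mu' := adapted_meas i 0 (admissible_adapted u'_adm kN).
have := measurable_funB mu' mu.
by congr (measurable_fun _ _); apply/funext => w; rewrite !mxE.
Qed.

Lemma direction_adL2 k : (k < N)%N -> adL2 k (fun w => enorm (du k w)).
Proof.
move=> kN; have [_ h2] := adL2D (admissible_adL2 u'_adm kN) (admissible_adL2 u_adm kN).
have mdu : measurable_fun setT ((fun w => enorm (du k w)) : Past B k -> R).
  by apply: measurable_enorm => i j; exact: adapted_meas (direction_adapted kN).
split=> //; apply: sqint_bound h2; first exact: (past_meas B_rv (ltnW kN) mdu).
move=> w; rewrite !ger0_norm ?addr_ge0 ?enorm_ge0//.
by rewrite (le_trans (enormD _ _))// enormN.
Qed.

Lemma gap_adL2 k : (k <= N)%N -> adL2 k (gap du k).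
Proof.
move=> kN; apply: (adL2_dom B_rv B_indep p_ge2 B_moment) => // j jk.
by apply: direction_adL2; exact: leq_trans jk kN.
Qed.

Lemma incr_adL2 k : (k < N)%N -> adL2 k (incr du k).
Proof. by move=> kN; apply: adL2D; [exact: gap_adL2 (ltnW kN)|exact: direction_adL2]. Qed.

Definition mean_variation g : R := \int[P]_w cost_variation c N B x0 u du g w.

Lemma jmeas_cost_variation : jmeas B N (cost_variation c N B x0 u du).
Proof.
have ua k (kN : (k < N)%N) := admissible_adapted u_adm kN.
have mV k i : (k <= N)%N -> jmeas B k (fun g w => variation c B x0 u du g k w i 0).
  apply: (jmeas_variation (U := U) (L := L) (v := v)) => //.
  exact: direction_adapted.
have mC k chi (kN : (k < N)%N) := @jmeas_state_coef _ _ _ _ _ _ _ c N U L v B x0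
  Gamma_polish hH1 L_ge0 U_segment hH4 u Uu ua k chi kN.
have mul00 a k (J : Gamma -> Omega -> 'rV[R]_a) (y : Gamma -> Omega -> 'cV[R]_a) :
    (forall j, jmeas B k (fun g w => J g w 0 j)) ->
    (forall j, jmeas B k (fun g w => y g w j 0)) ->
    jmeas B k (fun g w => (J g w *m y g w) 0 0).
  move=> mJ my; have mS : jmeas B k (fun g w => \sum_j J g w 0 j * y g w j 0).
    by apply: jmeas_sum => j; exact: jmeasM (mJ j) (my j).
  by rewrite /jmeas; under eq_fun do rewrite /= !mxE.
apply: jmeasD.
  apply: jmeas_sum => k; have kN := ltn_ord k; apply: (jmeasW (ltnW kN)).
  apply: jmeasD; apply: mul00 => j.
  - exact: (mC _ _ _ (regular_fx hH3 hH4 kN 0 j)).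
  - exact: (mV _ _ (ltnW kN)).
  - exact: (mC _ _ _ (regular_fu hH3 hH4 kN 0 j)).
  - by apply: jmeas_past; exact: (adapted_meas _ _ (direction_adapted kN)).
apply: mul00 => j; last exact: mV.
exact: (jmeas_state_terminal x0 Gamma_polish hH1 L_ge0
  U_segment hH4 Uu ua (regular_phix hH3 hH4 setT 0 j)).
Qed.

Lemma cost_variation_meas g : measurable_fun setT (cost_variation c N B x0 u du g).
Proof.
apply: (past_meas B_rv (leqnn N)); exact: jmeas_section jmeas_cost_variation.
Qed.

Lemma cost_variation_rint g : rint P (cost_variation c N B x0 u du g).
Proof.
apply: (@rint_le _ _ _ _ _ (cost_variation_bound N L v B x0 u du)).
- exact: cost_variation_meas.
- by move=> w; apply: (cost_variation_le B x0 hH1 hH2 L_ge0 v_in U_segment).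
apply: rintD.
  apply: rint_sum => k; have kN := ltn_ord k.
  apply: sqint_mul; last by have [] := incr_adL2 kN.
  apply: sqintZ; have [] : adL2 k (fun w => 1 + growth u k w + enorm (u k w)).
    apply: adL2D; last exact: admissible_adL2.
    by apply: adL2D; [exact: adL2_cst|exact: growth_adL2 u_adm (ltnW kN)].
  by [].
apply: sqint_mul; last by have [] := gap_adL2 (leqnn N).
apply: sqintZ; have [] : adL2 N (fun w => 1 + growth u N w).
  by apply: adL2D; [exact: adL2_cst|exact: growth_adL2].
by [].
Qed.

Section WithModulus.
Variable psi : R -> R.
Hypothesis psi_mod : modulus psi.
Hypothesis psi_coef : forall g,
  (forall k x x' u u', (k < N)%N -> U k u -> U k u' ->
     let r := psi (enorm (x - x') + enorm (u - u')) in
     enorm (cbx c g k x u - cbx c g k x' u') <= r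
     /\ enorm (cbu c g k x u - cbu c g k x' u') <= r
     /\ (forall i, enorm (csx c i g k x u - csx c i g k x' u') <= r)
     /\ (forall i, enorm (csu c i g k x u - csu c i g k x' u') <= r)
     /\ enorm (cfx c g k x u - cfx c g k x' u') <= r
     /\ enorm (cfu c g k x u - cfu c g k x' u') <= r)
  /\ (forall x x', enorm (cphix c g x - cphix c g x') <= psi (enorm (x - x'))).

Local Notation err := (cost_error N L v psi B x0 u du).

Let incr_ge0' k w : 0 <= incr du k w. Proof. exact: incr_ge0. Qed.
Let gap_ge0' k w : 0 <= gap du k w. Proof. exact: gap_ge0. Qed.

Let meas_incr k : (k < N)%N -> measurable_fun setT (incr du k).
Proof. by move=> kN; apply: (adL2_meas B_rv (ltnW kN)); exact: incr_adL2. Qed.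
Let meas_gap k : (k <= N)%N -> measurable_fun setT (gap du k).
Proof. by move=> kN; apply: (adL2_meas B_rv kN); exact: gap_adL2. Qed.

Let meas_psi (t : R) (f : Omega -> R) : 0 <= t -> measurable_fun setT f ->
  (forall w, 0 <= f w) -> measurable_fun setT (fun w => psi (t * f w) * f w).
Proof.
move=> t0 mf f0; apply: measurable_funM => //.
apply: measurable_modulus => //; first exact: measurable_funM.
by move=> w; rewrite mulr_ge0.
Qed.

Let meas_error t k : 0 <= t -> (k <= N)%N ->
  measurable_fun setT (error (n := n) L psi B du t k).
Proof.
move=> t0 kN; apply: measurable_minr.
  apply: (measurable_dom B_rv) => // j jk; apply: meas_psi => //.
  by apply: meas_incr; exact: leq_trans jk kN.
by apply: measurable_funM => //; exact: meas_gap.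
Qed.

Lemma cost_error_meas t : 0 <= t -> measurable_fun setT (err t).
Proof.
move=> t0; apply: measurable_funD.
  apply: (@measurable_sum _ _ _ _ _ (index_enum 'I_N)
    (fun (k : 'I_N) w => psi (t * incr du k w) * incr du k w
    + L * (1 + growth u k w + enorm (u k w)) * error (n := n) L psi B du t k w)) => k.
  have kN := ltn_ord k.
  apply: measurable_funD; first by apply: meas_psi => //; exact: meas_incr.
  apply: measurable_funM; last exact: meas_error t0 (ltnW kN).
  apply: measurable_funM => //; apply: (adL2_meas B_rv (ltnW kN)).
  apply: adL2D; last exact: admissible_adL2.
  by apply: adL2D; [exact: adL2_cst|exact: growth_adL2 u_adm (ltnW kN)].
apply: measurable_funD; first by apply: meas_psi => //; exact: meas_gap.
apply: measurable_funM; last exact: meas_error.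
apply: measurable_funM => //; apply: (adL2_meas B_rv (leqnn N)).
by apply: adL2D; [exact: adL2_cst|exact: growth_adL2].
Qed.

Let dominator w : R :=
  \sum_(k < N) (psi 1 * (1 + incr du k w) * incr du k w
    + L * (1 + growth u k w + enorm (u k w)) * (2 * gap du k w))
  + (psi 1 * (1 + gap du N w) * gap du N w
    + L * (1 + growth u N w) * (2 * gap du N w)).

Let dominator_rint : rint P dominator.
Proof.
have quad k f : (k <= N)%N -> adL2 k f -> rint P (fun w => psi 1 * (1 + f w) * f w).
  move=> kN fL2; apply: sqint_mul; last by case: fL2.
  by apply: sqintZ; apply: sqintD; [exact: sqint_cst|case: fL2].
have cross k f h : adL2 k f -> adL2 k h -> rint P (fun w => L * f w * (2 * h w)).
  by move=> [_ f2] [_ h2]; apply: sqint_mul; exact: sqintZ.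
apply: rintD.
  apply: rint_sum => k; have kN := ltn_ord k; apply: rintD.
    exact: quad (ltnW kN) (incr_adL2 kN).
  apply: (cross k); last exact: gap_adL2 (ltnW kN).
  apply: adL2D; last exact: admissible_adL2.
  by apply: adL2D; [exact: adL2_cst|exact: growth_adL2 u_adm (ltnW kN)].
apply: rintD; first exact: quad (leqnn N) (gap_adL2 (leqnn N)).
apply: (cross N); last exact: gap_adL2.
by apply: adL2D; [exact: adL2_cst|exact: growth_adL2].
Qed.

Let psi_le (t a : R) : 0 <= t <= 1 -> 0 <= a -> psi (t * a) * a <= psi 1 * (1 + a) * a.
Proof.
move=> /andP[t0 t1] a0; rewrite ler_wpM2r//.
apply: le_trans (modulus_linear_growth psi_mod a0).
by apply: (modulus_le psi_mod); rewrite ?mulr_ge0// ler_piMl.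
Qed.

Lemma cost_error_ge0 t w : 0 <= t -> 0 <= err t w.
Proof.
move=> t0.
have psi0 a : 0 <= a -> 0 <= psi (t * a) * a.
  by move=> a0; rewrite mulr_ge0//; apply: (modulus_ge0 psi_mod); rewrite mulr_ge0.
have e0 k : 0 <= error (n := n) L psi B du t k w by exact: error_ge0.
have g0 k : 0 <= growth u k w by exact: growth_ge0.
rewrite addr_ge0//.
  apply: sumr_ge0 => k _; rewrite addr_ge0 ?psi0// mulr_ge0//.
  by rewrite mulr_ge0// !addr_ge0 ?enorm_ge0.
by rewrite addr_ge0 ?psi0// mulr_ge0// mulr_ge0// addr_ge0.
Qed.

Let cost_error_le t w : 0 <= t <= 1 -> `|err t w| <= dominator w.
Proof.
move=> t01; have /andP[t0 _] := t01.
rewrite ger0_norm ?cost_error_ge0//.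
have g0 k : 0 <= growth u k w by exact: growth_ge0.
have e2 k : error (n := n) L psi B du t k w <= 2 * gap du k w.
  by rewrite /error ge_min lexx orbT.
rewrite lerD//.
  apply: ler_sum => k _; rewrite lerD ?psi_le// ler_wpM2l//.
  by rewrite mulr_ge0// !addr_ge0 ?enorm_ge0.
by rewrite lerD ?psi_le// ler_wpM2l// mulr_ge0// addr_ge0.
Qed.

Let t_ (j : nat) : R := j.+1%:R^-1.
Let t01 j : 0 <= t_ j <= 1.
Proof. by rewrite /t_ invr_ge0 ler0n/= invf_le1// ler1n. Qed.

Lemma mean_cost_error_cvg : (fun j => \int[P]_w err (t_ j) w) @ \oo --> 0.
Proof.
have t0 j : 0 <= t_ j by have /andP[] := t01 j.
have -> : 0 = \int[P]_w (fun=> 0 : R) w :> R by rewrite Rintegral_cst// mul0r.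
apply: (Rintegral_dominated_cvg (g := dominator)) => //.
- by move=> j; exact: cost_error_meas.
- move=> w.
  have psi_cvg a : 0 <= a -> (fun j => psi (t_ j * a) * a) @ \oo --> 0.
    move=> a0; rewrite -[X in _ --> X](mul0r a); apply: cvgM; last exact: cvg_cst.
    apply: (modulus_cvg0 psi_mod); first by move=> j; rewrite mulr_ge0.
    rewrite -[X in _ --> X](mul0r a); apply: cvgM; last exact: cvg_cst.
    exact: cvg_harmonic.
  have err_cvg k (M : R) :
      (fun j => M * error (n := n) L psi B du (t_ j) k w) @ \oo --> 0.
    rewrite -[X in _ --> X](mulr0 M); apply: cvgM; first exact: cvg_cst.
    apply: (@squeeze_cvgr _ _ _ _ (fun=> 0)
      (fun j => remainder (n := n) L psi B du (t_ j) k w)).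
    - by apply: nearW => j; rewrite error_ge0//= ge_min lexx.
    - exact: cvg_cst.
    apply: (@dom_cvg0 _ _ _ B K
      (fun j k w => psi (t_ j * incr du k w) * incr du k w)).
    by move=> l; exact: psi_cvg.
  rewrite -[X in _ --> X](addr0 0); apply: cvgD.
    rewrite -[X in _ --> X](_ : \sum_(k < N) (0 : R) = 0); last by rewrite big1.
    apply: cvg_finite_sum => k; rewrite -[X in _ --> X](addr0 0).
    by apply: cvgD; [exact: psi_cvg|exact: err_cvg].
  rewrite -[X in _ --> X](addr0 0).
  by apply: cvgD; [exact: psi_cvg|exact: err_cvg].
- by move=> j w; exact: cost_error_le.
Qed.

Lemma mean_cost_expansion t g : 0 <= t <= 1 ->
  `|mean_cost (ut t) g - mean_cost u g - t * mean_variation g|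
    <= t * \int[P]_w err t w.
Proof.
move=> t01'; have /andP[t0 _] := t01'.
have err_int : rint P (err t).
  apply: rint_le dominator_rint; first exact: cost_error_meas.
  by move=> w; exact: cost_error_le.
have i1 := cost_rint g (ut_adm t01'); have i2 := cost_rint g u_adm.
have i3 := cost_variation_rint g.
rewrite /mean_cost /mean_variation -RintegralZl// -RintegralB//.
rewrite -RintegralB//; [|exact: rintB|exact: rintZ].
rewrite -RintegralZl//.
apply: le_trans (le_normr_Rintegral _ _) _ => //.
  by apply: rintB; [exact: rintB|exact: rintZ].
apply: le_Rintegral => //.
- by apply: integrable_norm; apply: rintB; [exact: rintB|exact: rintZ].
- exact: rintZ.
move=> w _; exact: (cost_taylor B x0 hH1 hH2 L_ge0 v_in U_segment psi_mod psi_coef Uu Uu1).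
Qed.

End WithModulus.

(** The pathwise error is dominated by an integrable variable and tends to
    zero, both independently of the parameter; so does its mean. *)
Lemma uniform_expansion : forall e : R, 0 < e -> exists j0, forall j, (j0 <= j)%N ->
  forall g, `|mean_cost (ut j.+1%:R^-1) g - mean_cost u g
              - j.+1%:R^-1 * mean_variation g| <= j.+1%:R^-1 * e.
Proof.
have [psi psi_mod psi_coef] := hH3.
move=> e e0; have /cvgrPdist_lt/(_ e e0) := mean_cost_error_cvg psi_mod.
move=> [j0 _ Hj0]; exists j0 => j jj0 g.
have t01 : 0 <= (j.+1%:R^-1 : R) <= 1.
  by rewrite invr_ge0 ler0n/= invf_le1// ler1n.
apply: le_trans (mean_cost_expansion psi_mod psi_coef g t01) _.
rewrite ler_wpM2l ?invr_ge0//; have := Hj0 j jj0.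
by rewrite sub0r normrN => /ltW; apply: le_trans; rewrite ler_norm.
Qed.

(** A uniform limit of difference quotients of the continuous functions
    [mean_cost]. *)
Lemma mean_variation_continuous : continuous mean_variation.
Proof.
move=> g; apply/cvgrPdist_lt => e e0.
have e40 : 0 < e / 4 by rewrite divr_gt0.
have [j Hj] := uniform_expansion e40.
pose t : R := j.+1%:R^-1.
have t0 : 0 < t by rewrite invr_gt0.
have t01 : 0 <= t <= 1 by rewrite ltW//= invf_le1// ler1n.
have te : 0 < t * (e / 4) by rewrite mulr_gt0.
have c1 : mean_cost (ut t) @ g --> mean_cost (ut t) g.
  exact: (mean_cost_continuous (ut_adm t01)).
have c2 : mean_cost u @ g --> mean_cost u g by exact: (mean_cost_continuous u_adm).
move/cvgrPdist_lt : c1 => /(_ _ te) c1; move/cvgrPdist_lt : c2 => /(_ _ te) c2.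
near=> g'.
have h1 : `|mean_cost (ut t) g - mean_cost (ut t) g'| < t * (e / 4) by near: g'.
have h2 : `|mean_cost u g - mean_cost u g'| < t * (e / 4) by near: g'.
have := Hj j (leqnn j) g; have := Hj j (leqnn j) g'; rewrite -/t => h3 h4.
rewrite -(ltr_pM2l t0) -[X in X * _](gtr0_norm t0) -normrM.
move: h1 h2 h3 h4; rewrite mulrBr !ltr_norml !ler_norml.
set a1 := mean_cost (ut t) g; set a2 := mean_cost (ut t) g'.
set b1 := mean_cost u g; set b2 := mean_cost u g'.
set y1 := t * mean_variation g; set y2 := t * mean_variation g'.
move=> /andP[h1 h1'] /andP[h2 h2'] /andP[h3 h3'] /andP[h4 h4'].
by apply/andP; split; lra.
Unshelve. all: by end_near.
Qed.

Lemma mean_variation_bound g : `|mean_variation g|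
  <= \int[P]_w cost_variation_bound N L v B x0 u du w.
Proof.
have bi : rint P (cost_variation_bound N L v B x0 u du).
  apply: rintD.
    apply: rint_sum => k; have kN := ltn_ord k.
    apply: sqint_mul; last by have [] := incr_adL2 kN.
    apply: sqintZ; have [] : adL2 k (fun w => 1 + growth u k w + enorm (u k w)).
      apply: adL2D; last exact: admissible_adL2.
      by apply: adL2D; [exact: adL2_cst|exact: growth_adL2 u_adm (ltnW kN)].
    by [].
  apply: sqint_mul; last by have [] := gap_adL2 (leqnn N).
  apply: sqintZ; have [] : adL2 N (fun w => 1 + growth u N w).
    by apply: adL2D; [exact: adL2_cst|exact: growth_adL2].
  by [].
apply: le_trans (le_normr_Rintegral _ _) _ => //.
  exact: cost_variation_rint.
apply: le_Rintegral => //.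
- by apply: integrable_norm; exact: cost_variation_rint.
- by move=> w _; apply: (cost_variation_le B x0 hH1 hH2 L_ge0 v_in U_segment).
Qed.

End Direction.
End Expansion.

Section Adjoint.
Local Notation adm := (admissible P N B q U).
Local Notation adL2 := (adL2 P B).
Local Notation jmeas := (jmeas (Gamma := Gamma) B).
Local Notation ubL2 := (@ubL2 _ _ _ Gamma P).

(** The conditional expectation of [F * b] given F_k, in a version that is
    jointly measurable in the parameter. It is recorded through its pairings
    with F_k-measurable factors, since this is the form in which duality uses
    it. *)
Definition cexp k (F : Gamma -> Omega -> R) (b : Omega -> R)
    (H : Gamma -> Omega -> R) :=
  [/\ jmeas k H,
      forall g (s : Omega -> R), measurable_fun setT (s : Past B k -> R) ->
        rint P (fun w => s w * (F g w * b w)) ->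
        rint P (fun w => s w * H g w) /\
        \int[P]_w (s w * (F g w * b w)) = \int[P]_w (s w * H g w) &
      sqint P b -> ubL2 F -> ubL2 H].

Lemma cexp_exists k F b : (k < N)%N -> jmeas k.+1 F ->
  measurable_fun setT (b : Noise B k -> R) -> exists H, cexp k F b H.
Proof.
move=> kN mF mb.
have [H [mH pair bd]] := joint_condexp B_rv B_indep (M := borel Gamma) kN mF mb.
exists H; split=> // -[Kb [mb' bK]] [K FK]; exists (K * (Kb + 1)) => g.
have Kb0 : 0 <= Kb.
  rewrite -lee_fin; apply: le_trans bK; apply: integral_ge0 => w _.
  by rewrite lee_fin sqr_ge0.
apply: bd; [by rewrite ltr_wpDl|exact: FK|split=> //].
by apply: le_trans bK _; rewrite lee_fin lerDl.
Qed.

(** The integrability that [cexp] asks for holds because [b] is independent of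
    F_k: [s * b] is square integrable, and so is [F]. *)
Lemma cexp_pairing k F b H g s : (k < N)%N -> cexp k F b H ->
  measurable_fun setT (b : Noise B k -> R) -> sqint P b ->
  adL2 k s -> ubL2 F ->
  \int[P]_w (s w * (F g w * b w)) = \int[P]_w (s w * H g w).
Proof.
move=> kN [_ pair _] mb b2 s_ad F2; have [ms s2] := s_ad.
apply: (pair g s ms _).2.
have [_ sb2] := adL2_mul_noise B_rv B_indep kN s_ad mb b2.
have := sqint_mul sb2 (ubL2_sqint g F2).
by congr (rint _ _); apply/funext => w; rewrite mulrAC mulrA.
Qed.

Lemma jmeas_meas k F g : (k <= N)%N -> jmeas k F -> measurable_fun setT (F g).
Proof.
move=> kN mF; apply: (past_meas B_rv kN); exact: (jmeas_section g mF).
Qed.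

Lemma cexp_is_condexp k a e (F : Gamma -> Omega -> 'M[R]_(a, e))
    (H : Gamma -> Omega -> 'M[R]_(a, e))
    (F0 : 'I_a -> 'I_e -> Gamma -> Omega -> R) (b : 'I_a -> 'I_e -> Omega -> R) g :
  (k < N)%N ->
  (forall i j w, F g w i j = F0 i j g w * b i j w) ->
  (forall i j, cexp k (F0 i j) (b i j) (fun g w => H g w i j)) ->
  (forall i j, ubL2 (F0 i j)) ->
  (forall i j, sqint P (b i j)) ->
  is_condexp P (filtration B k) (F g) (H g).
Proof.
move=> kN FE FH F2 b2; split.
  apply: meas_adapted => i j; have [mH _ _] := FH i j.
  exact: (jmeas_section g mH).
move=> i j.
have E : (fun w => F g w i j) = (fun w => F0 i j g w * b i j w).
  by apply/funext => w; exact: FE.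
have Fint : rint P (fun w => F g w i j).
  by rewrite E; exact: (sqint_mul (ubL2_sqint g (F2 i j)) (b2 i j)).
have [mH pair bd] := FH i j.
have Hint : rint P (fun w => H g w i j).
  exact: (sqint_rint1 (ubL2_sqint g (bd (b2 i j) (F2 i j)))).
split=> // A FA.
have mA : measurable A by exact: (filtration_measurable B_rv (ltnW kN) FA).
have ms : measurable_fun setT (\1_A : Past B k -> R) by exact: measurable_indic.
have sF : rint P (fun w => \1_A w * (F0 i j g w * b i j w)).
  apply: (@rint_le _ _ _ _ _ (fun w => `|F g w i j|)).
  - apply: measurable_funM; first exact: measurable_indic.
    by rewrite -E; exact: (rint_meas Fint).
  - move=> w; rewrite -FE normrM ler_piMl//.
    by rewrite /indic; case: (_ \in _); rewrite ?normr1// normr0.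
  - exact: integrable_norm.
have [sH sE] := pair g _ ms sF.
rewrite [LHS]integral_in_indic [RHS]integral_in_indic (RintegralE sH) -sE -(RintegralE sF).
by apply: eq_integral => w _; rewrite FE.
Qed.

Variable u : nat -> Omega -> 'cV[R]_m.
Hypothesis u_adm : adm u.

Local Notation state := (state c B x0 u).
Let Uu : Ubar N U u. Proof. by case: u_adm. Qed.
Let ua k (kN : (k < N)%N) : adapted_to (filtration B k) (u k).
Proof. by case: u_adm => + _ _; exact. Qed.

Let coef_jmeas k chi (kN : (k < N)%N) (reg : regular_coef (U k) chi) :
  jmeas k (fun g w => chi g (state g k w) (u k w)) :=
  jmeas_state_coef x0 Gamma_polish hH1 L_ge0 U_segment hH4 Uu ua kN reg.

Section Solution.
Variables (pa : Gamma -> nat -> Omega -> 'cV[R]_n).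
Variables (qa : Gamma -> nat -> Omega -> 'M[R]_(n, d)).

(** The variable whose conditional expectations define the adjoint pair at the
    previous time, with the terminal time included. *)
Definition zeta (g : Gamma) (k : nat) (w : Omega) : 'cV[R]_n :=
  if k == N then (cphix c g (state g N w))^T else adjoint_Z c B x0 u pa qa g k w.

Definition adjoint_step k :=
  (forall i, cexp k (fun g w => zeta g k.+1 w i 0) (fun=> 1) (fun g w => pa g k w i 0))
  /\ (forall i j, cexp k (fun g w => zeta g k.+1 w i 0) (fun w => B k.+1 w j 0)
       (fun g w => qa g k w i j)).

Lemma adjoint_ZE g k w i : adjoint_Z c B x0 u pa qa g k w i 0 =
  \sum_j cbx c g k (state g k w) (u k w) j i * pa g k w j 0
  + \sum_l \sum_j csx c l g k (state g k w) (u k w) j i * qa g k w j l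
  + cfx c g k (state g k w) (u k w) 0 i.
Proof.
rewrite /adjoint_Z !mxE summxE; congr (_ + _ + _).
  by apply: eq_bigr => j _; rewrite mxE.
apply: eq_bigr => l _; rewrite mxE; apply: eq_bigr => j _.
by rewrite !mxE.
Qed.

Lemma jmeas_zeta k i : (k <= N)%N ->
  ((k < N)%N -> (forall i, jmeas k (fun g w => pa g k w i 0))
     /\ (forall i j, jmeas k (fun g w => qa g k w i j))) ->
  jmeas k (fun g w => zeta g k w i 0).
Proof.
move=> kN' hk; rewrite /zeta; have [->|kN] := eqVneq k N.
  have := jmeas_state_terminal x0 Gamma_polish hH1 L_ge0 U_segment hH4 Uu ua
    (regular_phix hH3 hH4 setT 0 i).
  by congr (measurable_fun _ _); apply/funext => z; rewrite mxE.
have {kN' kN}kN : (k < N)%N by rewrite ltn_neqAle kN.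
have [mp mq] := hk kN.
have mS : jmeas k (fun g w =>
    \sum_j cbx c g k (state g k w) (u k w) j i * pa g k w j 0
    + \sum_l \sum_j csx c l g k (state g k w) (u k w) j i * qa g k w j l
    + cfx c g k (state g k w) (u k w) 0 i).
  apply: jmeasD; last exact: (coef_jmeas kN (regular_fx hH3 hH4 kN 0 i)).
  apply: jmeasD; apply: jmeas_sum => j.
    by apply: jmeasM => //; exact: (coef_jmeas kN (regular_bx hH3 hH4 kN j i)).
  apply: jmeas_sum => l; apply: jmeasM => //.
  exact: (coef_jmeas kN (regular_sx hH3 hH4 kN j l i)).
by move: mS; congr (measurable_fun _ _); apply/funext => z; rewrite adjoint_ZE.
Qed.

Let growth_sq k : (k < N)%N ->
  sqint P (fun w => L * (1 + growth L v B x0 u k w + enorm (u k w))).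
Proof.
move=> kN; apply: sqintZ; apply: sqintD; last first.
  by have [] := adL2_admissible B_rv q_gt2 u_adm kN.
apply: sqintD; first exact: sqint_cst.
by have [] := growth_adL2 u_adm (ltnW kN).
Qed.

Let entry_le a e (A : 'M[R]_(a, e)) i j (M : R) : enorm A <= M -> `|A i j| <= M.
Proof. exact: (le_trans (le_enorm _ _ _)). Qed.

Let coef_meas k chi g (kN : (k < N)%N) (reg : regular_coef (U k) chi) :
  measurable_fun setT (fun w => chi g (state g k w) (u k w)).
Proof. exact: (jmeas_meas g (ltnW kN) (coef_jmeas kN reg)). Qed.

Lemma ubL2_fx k i : (k < N)%N ->
  ubL2 (fun g w => cfx c g k (state g k w) (u k w) 0 i).
Proof.
move=> kN; apply: (ubL2_bound _ _ (growth_sq kN)) => [g|g w].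
  exact: (coef_meas g kN (regular_fx hH3 hH4 kN 0 i)).
have [_ [_ Hf]] := hH2.1 k kN g; have [h _] := Hf (state g k w) _ (Uu kN w).
rewrite (le_trans (entry_le _ _ h))// (le_trans _ (ler_norm _))//.
rewrite ler_wpM2l// lerD2r lerD2l.
exact: (state_growth B x0 hH1 L_ge0 v_in U_segment g w Uu (ltnW kN)).
Qed.

Lemma ubL2_fu k i : (k < N)%N ->
  ubL2 (fun g w => cfu c g k (state g k w) (u k w) 0 i).
Proof.
move=> kN; apply: (ubL2_bound _ _ (growth_sq kN)) => [g|g w].
  exact: (coef_meas g kN (regular_fu hH3 hH4 kN 0 i)).
have [_ [_ Hf]] := hH2.1 k kN g; have [_ h] := Hf (state g k w) _ (Uu kN w).
rewrite (le_trans (entry_le _ _ h))// (le_trans _ (ler_norm _))//.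
rewrite ler_wpM2l// lerD2r lerD2l.
exact: (state_growth B x0 hH1 L_ge0 v_in U_segment g w Uu (ltnW kN)).
Qed.

Lemma ubL2_phix i : ubL2 (fun g w => cphix c g (state g N w) 0 i).
Proof.
have gN := growth_adL2 u_adm (leqnn N).
have sq : sqint P (fun w => L * (1 + growth L v B x0 u N w)).
  by apply: sqintZ; apply: sqintD; [exact: sqint_cst|case: gN].
apply: (ubL2_bound _ _ sq) => [g|g w].
  have mN := jmeas_state_terminal x0 Gamma_polish hH1 L_ge0 U_segment hH4 Uu ua
    (regular_phix hH3 hH4 setT 0 i).
  exact: (jmeas_meas g (leqnn N) mN).
rewrite (le_trans (entry_le _ _ ((hH2.2 g).2 _)))// (le_trans _ (ler_norm _))//.
rewrite ler_wpM2l// lerD2l.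
exact: (state_growth B x0 hH1 L_ge0 v_in U_segment g w Uu (leqnn N)).
Qed.

Let bd_coef k g w (kN : (k < N)%N) := (hH1 kN g).2.2.2 (state g k w) (u k w) (Uu kN w).

Lemma ubL2_zeta k i : (k <= N)%N ->
  ((k < N)%N -> (forall i, ubL2 (fun g w => pa g k w i 0))
     /\ (forall i j, ubL2 (fun g w => qa g k w i j))) ->
  ubL2 (fun g w => zeta g k w i 0).
Proof.
move=> kN' hk; rewrite /zeta; have [_|kN] := eqVneq k N.
  have [K HK] := ubL2_phix i; exists K => g; have := HK g.
  by congr (sqint_le _ _ _); apply/funext => w; rewrite mxE.
have {kN' kN}kN : (k < N)%N by rewrite ltn_neqAle kN.
have [p2 q2] := hk kN.
have [K HK] : ubL2 (fun g w =>
    \sum_j cbx c g k (state g k w) (u k w) j i * pa g k w j 0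
    + \sum_l \sum_j csx c l g k (state g k w) (u k w) j i * qa g k w j l
    + cfx c g k (state g k w) (u k w) 0 i).
  apply: ubL2D; last exact: ubL2_fx.
  apply: ubL2D; apply: ubL2_sum => j.
    apply: (ubL2_mul_bounded (M := L)) => // [g|g w].
      exact: (coef_meas g kN (regular_bx hH3 hH4 kN j i)).
    by apply: entry_le; have [] := bd_coef g w kN.
  apply: ubL2_sum => l; apply: (ubL2_mul_bounded (M := L)) => // [g|g w].
    exact: (coef_meas g kN (regular_sx hH3 hH4 kN j l i)).
  by apply: entry_le; have [_ _ + _] := bd_coef g w kN; exact.
exists K => g; have := HK g.
by congr (sqint_le _ _ _); apply/funext => w; rewrite adjoint_ZE.
Qed.

Hypothesis step : forall k, (k < N)%N -> adjoint_step k.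

Let one_sq : sqint P (fun=> 1 : R). Proof. exact: sqint_cst. Qed.
Let noise_sq k j : (k < N)%N -> sqint P (fun w => B k.+1 w j 0).
Proof. by move=> kN; exact: (noise_coord_sqint B_rv p_ge2 B_moment j kN). Qed.

(** Backward induction: the coefficients are bounded by [L] and conditional
    expectation does not increase mean square bounds, except by the second
    moment of the noise. *)
Lemma adjoint_ubL2 k : (k < N)%N -> (forall i, ubL2 (fun g w => pa g k w i 0))
  /\ (forall i j, ubL2 (fun g w => qa g k w i j)).
Proof.
move=> kN; have [r rE] : exists r, (N = k + r.+1)%N.
  by exists (N - k.+1)%N; rewrite addnS -addSn subnKC.
have finish k' (k'N : (k' < N)%N) :
    (forall i, ubL2 (fun g w => zeta g k'.+1 w i 0)) ->
    (forall i, ubL2 (fun g w => pa g k' w i 0))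
    /\ (forall i j, ubL2 (fun g w => qa g k' w i j)).
  move=> z2; have [sp sq] := step k'N; split=> [i|i j].
    by have [_ _ bd] := sp i; exact: (bd one_sq (z2 i)).
  by have [_ _ bd] := sq i j; exact: (bd (noise_sq j k'N) (z2 i)).
elim: r k kN rE => [|r IH] k kN rE; apply: (finish k kN) => i.
  by apply: ubL2_zeta => //; rewrite rE addn1 ltnn.
by apply: ubL2_zeta => // k1N; apply: IH => //; rewrite rE addSn addnS.
Qed.

Lemma zeta_ubL2 k i : (k <= N)%N -> ubL2 (fun g w => zeta g k w i 0).
Proof. by move=> kN; apply: ubL2_zeta => // kN'; exact: adjoint_ubL2. Qed.

Lemma adjoint_jmeas k : (k < N)%N -> (forall i, jmeas k (fun g w => pa g k w i 0))
  /\ (forall i j, jmeas k (fun g w => qa g k w i j)).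
Proof.
move=> kN; have [sp sq] := step kN.
by split=> [i|i j]; [case: (sp i)|case: (sq i j)].
Qed.

Lemma adjoint_condexp k g : (k < N)%N ->
  is_condexp P (filtration B k) (zeta g k.+1) (pa g k)
  /\ is_condexp P (filtration B k) (fun w => zeta g k.+1 w *m (B k.+1 w)^T) (qa g k).
Proof.
move=> kN; have [sp sq] := step kN; split.
  apply: (cexp_is_condexp (F := fun g => zeta g k.+1) (H := fun g => pa g k)
    (F0 := fun i _ g w => zeta g k.+1 w i 0) (b := fun _ _ _ => 1) kN).
  - by move=> i j w; rewrite mulr1 ord1.
  - by move=> i j; rewrite ord1; exact: sp.
  - by move=> i j; exact: zeta_ubL2.
  - by move=> i j; exact: one_sq.
apply: (cexp_is_condexp (F := fun g w => zeta g k.+1 w *m (B k.+1 w)^T)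
    (H := fun g => qa g k)
    (F0 := fun i _ g w => zeta g k.+1 w i 0) (b := fun _ j w => B k.+1 w j 0) kN).
- by move=> i j w; rewrite mxE big_ord1 mxE.
- by move=> i j; exact: sq.
- by move=> i j; exact: zeta_ubL2.
- by move=> i j; exact: noise_sq.
Qed.

Lemma adjoint_solution_of_steps : (0 < N)%N -> adjoint_solution P c N B x0 u pa qa.
Proof.
move=> N0 g; have N1 : (N.-1 < N)%N by rewrite prednK.
have [c1 c2] := adjoint_condexp g N1.
have zN w : zeta g N.-1.+1 w = (cphix c g (state g N w))^T.
  by rewrite /zeta prednK// eqxx.
split; first by move: c1; congr (is_condexp _ _ _ _); apply/funext => w.
split.
  move: c2; congr (is_condexp _ _ _ _); apply/funext => w.
  by rewrite zN prednK.
move=> k k1N; have [e1 e2] := adjoint_condexp g (ltnW k1N).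
have zk w : zeta g k.+1 w = adjoint_Z c B x0 u pa qa g k.+1 w.
  by rewrite /zeta ltn_eqF.
split; first by move: e1; congr (is_condexp _ _ _ _); apply/funext => w.
by move: e2; congr (is_condexp _ _ _ _); apply/funext => w; rewrite zk.
Qed.

Definition ham_u g k w : 'rV[R]_m :=
  hamiltonian_u c g k (state g k w) (u k w) (pa g k w) (qa g k w).

Lemma ham_uE g k w i : ham_u g k w 0 i =
  cfu c g k (state g k w) (u k w) 0 i
  + \sum_j pa g k w j 0 * cbu c g k (state g k w) (u k w) j i
  + \sum_l \sum_j qa g k w j l * csu c l g k (state g k w) (u k w) j i.
Proof.
rewrite /ham_u /hamiltonian_u !mxE summxE; congr (_ + _ + _).
  by apply: eq_bigr => j _; rewrite mxE.
apply: eq_bigr => l _; rewrite mxE; apply: eq_bigr => j _.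
by rewrite !mxE.
Qed.

Lemma jmeas_ham_u k i : (k < N)%N -> jmeas k (fun g w => ham_u g k w 0 i).
Proof.
move=> kN; have [mp mq] := adjoint_jmeas kN.
have mS : jmeas k (fun g w => cfu c g k (state g k w) (u k w) 0 i
  + \sum_j pa g k w j 0 * cbu c g k (state g k w) (u k w) j i
  + \sum_l \sum_j qa g k w j l * csu c l g k (state g k w) (u k w) j i).
  apply: jmeasD.
    apply: jmeasD; first exact: (coef_jmeas kN (regular_fu hH3 hH4 kN 0 i)).
    apply: jmeas_sum => j; apply: jmeasM => //.
    exact: (coef_jmeas kN (regular_bu hH3 hH4 kN j i)).
  apply: jmeas_sum => l; apply: jmeas_sum => j; apply: jmeasM => //.
  exact: (coef_jmeas kN (regular_su hH3 hH4 kN l j i)).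
by move: mS; congr (measurable_fun _ _); apply/funext => z; rewrite ham_uE.
Qed.

Lemma ubL2_ham_u k i : (k < N)%N -> ubL2 (fun g w => ham_u g k w 0 i).
Proof.
move=> kN; have [p2 q2] := adjoint_ubL2 kN.
have [K HK] : ubL2 (fun g w => cfu c g k (state g k w) (u k w) 0 i
  + \sum_j cbu c g k (state g k w) (u k w) j i * pa g k w j 0
  + \sum_l \sum_j csu c l g k (state g k w) (u k w) j i * qa g k w j l).
  apply: ubL2D.
    apply: ubL2D; first exact: ubL2_fu.
    apply: ubL2_sum => j; apply: (ubL2_mul_bounded (M := L)) => // [g|g w].
      exact: (coef_meas g kN (regular_bu hH3 hH4 kN j i)).
    by apply: entry_le; have [] := bd_coef g w kN.
  apply: ubL2_sum => l; apply: ubL2_sum => j.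
  apply: (ubL2_mul_bounded (M := L)) => // [g|g w].
    exact: (coef_meas g kN (regular_su hH3 hH4 kN l j i)).
  by apply: entry_le; have [_ _ _ +] := bd_coef g w kN; exact.
exists K => g; have := HK g; congr (sqint_le _ _ _); apply/funext => w.
rewrite ham_uE; congr (_ + _ + _); first by apply: eq_bigr => j _; rewrite mulrC.
by apply: eq_bigr => l _; apply: eq_bigr => j _; rewrite mulrC.
Qed.

End Solution.

(** Backward induction on time. The pair is redefined at time [k0] only, which
    leaves [zeta] unchanged at later times. *)
Lemma adjoint_exists : exists pa qa, forall k, (k < N)%N -> adjoint_step pa qa k.
Proof.
suff H r : exists pa qa, forall k, (k < N)%N -> (N <= k + r)%N -> adjoint_step pa qa k.
  have [pa [qa Hpq]] := H N; exists pa, qa => k kN; apply: Hpq => //.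
  exact: leq_addl.
elim: r => [|r [pa [qa IH]]].
  by exists (fun _ _ _ => 0), (fun _ _ _ => 0) => k kN; rewrite addn0 leqNgt kN.
have [Nr|rN] := leqP N r.
  by exists pa, qa => k kN _; apply: IH => //; exact: leq_trans Nr (leq_addl _ _).
pose k0 := (N - r.+1)%N.
have k0N : (k0 < N)%N by rewrite /k0 ltn_subrL (leq_ltn_trans (leq0n r) rN).
have k0r : (k0 + r.+1 = N)%N by rewrite subnK.
have mz i : jmeas k0.+1 (fun g w => zeta pa qa g k0.+1 w i 0).
  apply: jmeas_zeta => // k1N; have [|sp sq] := IH _ k1N.
    by rewrite addSn -addnS k0r.
  by split=> [i'|i' j]; [case: (sp i')|case: (sq i' j)].
have /choice[p0 Hp] : forall i, exists H,
    cexp k0 (fun g w => zeta pa qa g k0.+1 w i 0) (fun=> 1) H.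
  by move=> i; apply: cexp_exists => //; exact: measurable_cst.
have /choice[q0 Hq] : forall ij : 'I_n * 'I_d, exists H,
    cexp k0 (fun g w => zeta pa qa g k0.+1 w ij.1 0) (fun w => B k0.+1 w ij.2 0) H.
  by move=> ij; apply: cexp_exists => //; exact: noise_meas_coord.
pose pa' g k w := if k == k0 then \col_i p0 i g w else pa g k w.
pose qa' g k w := if k == k0 then \matrix_(i, j) q0 (i, j) g w else qa g k w.
have zE k g w : (k0 <= k)%N -> zeta pa' qa' g k.+1 w = zeta pa qa g k.+1 w.
  move=> kk; rewrite /zeta /adjoint_Z /pa' /qa'.
  by rewrite (gtn_eqF (_ : k0 < k.+1)%N).
exists pa', qa' => k kN Nk; have k0k : (k0 <= k)%N.
  by rewrite /k0 leq_subLR addnC.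
have zE' i : (fun g w => zeta pa' qa' g k.+1 w i 0)
    = (fun g w => zeta pa qa g k.+1 w i 0).
  by apply/funext => g; apply/funext => w; rewrite zE.
have [kk0|kk0] := eqVneq k k0.
  rewrite kk0 in zE' *; split=> [i|i j]; rewrite zE'.
    have -> : (fun g w => pa' g k0 w i 0) = p0 i.
      by apply/funext => g; apply/funext => w; rewrite /pa' eqxx mxE.
    exact: Hp.
  have -> : (fun g w => qa' g k0 w i j) = q0 (i, j).
    by apply/funext => g; apply/funext => w; rewrite /qa' eqxx mxE.
  exact: (Hq (i, j)).
have [|sp sq] := IH k kN.
  have : (k0 < k)%N by rewrite ltn_neqAle eq_sym kk0.
  by rewrite -k0r -addSnnS leq_add2r.
split=> [i|i j]; rewrite zE'.
  have -> : (fun g w => pa' g k w i 0) = (fun g w => pa g k w i 0).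
    by apply/funext => g; apply/funext => w; rewrite /pa' (negbTE kk0).
  exact: sp.
have -> : (fun g w => qa' g k w i j) = (fun g w => qa g k w i j).
  by apply/funext => g; apply/funext => w; rewrite /qa' (negbTE kk0).
exact: sq.
Qed.

End Adjoint.

Section Duality.
Local Notation adL2 := (adL2 P B).

Variables (u u' : nat -> Omega -> 'cV[R]_m).
Hypotheses (u_adm : admissible P N B q U u) (u'_adm : admissible P N B q U u').
Variables (pa : Gamma -> nat -> Omega -> 'cV[R]_n).
Variables (qa : Gamma -> nat -> Omega -> 'M[R]_(n, d)).
Hypothesis step : forall k, (k < N)%N -> adjoint_step u pa qa k.

Local Notation du := (fun k w => u' k w - u k w).
Local Notation state := (state c B x0 u).
Local Notation V := (variation c B x0 u du).
Local Notation incr := (incr (n := n) L B du).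
Local Notation zeta := (zeta u pa qa).
Local Notation ham_u := (ham_u u pa qa).

Let Uu : Ubar N U u. Proof. by case: u_adm. Qed.
Let ua k (kN : (k < N)%N) : adapted_to (filtration B k) (u k).
Proof. by case: u_adm => + _ _; exact. Qed.

Let drift_dir g k w : 'cV[R]_n :=
  cbx c g k (state g k w) (u k w) *m V g k w
  + cbu c g k (state g k w) (u k w) *m du k w.
Let noise_dir l g k w : 'cV[R]_n :=
  csx c l g k (state g k w) (u k w) *m V g k w
  + csu c l g k (state g k w) (u k w) *m du k w.
Let cost_dir g k w : R :=
  (cfx c g k (state g k w) (u k w) *m V g k w) 0 0
  + (cfu c g k (state g k w) (u k w) *m du k w) 0 0.

(** The adjoint recursion and the Hamiltonian gradient are the transposes of
    the linearised dynamics in the state and in the control. *)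
Let adjoint_transpose g k w :
  inner (pa g k w) (drift_dir g k w)
  + \sum_l inner (col l (qa g k w)) (noise_dir l g k w) + cost_dir g k w
  = inner (adjoint_Z c B x0 u pa qa g k w) (V g k w)
    + (ham_u g k w *m du k w) 0 0.
Proof.
have sumE : \sum_l inner (col l (qa g k w)) (noise_dir l g k w)
  = inner (\sum_l (csx c l g k (state g k w) (u k w))^T *m col l (qa g k w)) (V g k w)
    + ((\sum_l (col l (qa g k w))^T *m csu c l g k (state g k w) (u k w))
        *m du k w) 0 0.
  rewrite inner_mul linear_sum !mulmx_suml !summxE -big_split; apply: eq_bigr => l _.
  rewrite /noise_dir innerDr !inner_mul/= trmx_mul trmxK.
  by rewrite -!mulmxA.
have addE (a b : 'M[R]_1) : (a + b) 0 0 = a 0 0 + b 0 0 by rewrite mxE.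
rewrite sumE /drift_dir /cost_dir /ham_u /hamiltonian_u /adjoint_Z.
set Sx := \sum_l _; set Su := \sum_l _.
rewrite !mulmxDl !innerDl innerDr !inner_mul !addE.
rewrite trmx_mul !trmxK -!mulmxA.
ring.
Qed.

Let V_adL2 g k i : (k <= N)%N -> adL2 k (fun w => V g k w i 0).
Proof.
move=> kN.
have mV := jmeas_variation x0 Gamma_polish hH1 L_ge0 U_segment hH3 hH4 Uu ua
  (fun k kN => direction_adapted u_adm u'_adm kN) i kN.
have mVg := jmeas_section g mV; split=> //.
have [_ g2] := gap_adL2 u_adm u'_adm kN.
apply: sqint_bound g2; first exact: (past_meas B_rv kN mVg).
move=> w; rewrite (le_trans (le_enorm _ _ _))// (le_trans _ (ler_norm _))//.
exact: (variation_gap B x0 hH1 L_ge0 _ Uu g w kN).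
Qed.

Let du_adL2 k i : (k < N)%N -> adL2 k (fun w => du k w i 0).
Proof.
move=> kN; have mdu := adapted_meas i 0 (direction_adapted u_adm u'_adm kN).
have [_ d2] := direction_adL2 u_adm u'_adm kN.
split=> //; apply: sqint_bound d2; first exact: (past_meas B_rv (ltnW kN) mdu).
move=> w; rewrite (le_trans (le_enorm _ _ _))//; exact: ler_norm.
Qed.

Let dir_adL2 k (Mx : Gamma -> 'cV[R]_n -> 'cV[R]_m -> 'M[R]_n)
  (Mu : Gamma -> 'cV[R]_n -> 'cV[R]_m -> 'M[R]_(n, m)) g i : (k < N)%N ->
  (forall i j, regular_coef (U k) (fun g x u => Mx g x u i j)) ->
  (forall i j, regular_coef (U k) (fun g x u => Mu g x u i j)) ->
  (forall x u, U k u -> enorm (Mx g x u) <= L /\ enorm (Mu g x u) <= L) ->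
  adL2 k (fun w => (Mx g (state g k w) (u k w) *m V g k w
    + Mu g (state g k w) (u k w) *m du k w) i 0).
Proof.
move=> kN rx ru bd.
have coef_meas chi (reg : regular_coef (U k) chi) := jmeas_section g
  (jmeas_state_coef x0 Gamma_polish hH1 L_ge0 U_segment hH4 Uu ua kN reg).
have mS : measurable_fun setT ((fun w =>
    \sum_j Mx g (state g k w) (u k w) i j * V g k w j 0
    + \sum_j Mu g (state g k w) (u k w) i j * du k w j 0) : Past B k -> R).
  apply: measurable_funD.
    apply: (@measurable_sum _ _ _ _ _ (index_enum 'I_n) (fun j (w : Past B k) =>
      Mx g (state g k w) (u k w) i j * V g k w j 0)) => j.
    by apply: measurable_funM; [exact: (coef_meas _ (rx i j))|
      have [] := V_adL2 g j (ltnW kN)].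
  apply: (@measurable_sum _ _ _ _ _ (index_enum 'I_m) (fun j (w : Past B k) =>
      Mu g (state g k w) (u k w) i j * du k w j 0)) => j.
  by apply: measurable_funM; [exact: (coef_meas _ (ru i j))|
    have [] := du_adL2 j kN].
have {}mS : measurable_fun setT ((fun w => (Mx g (state g k w) (u k w) *m V g k w
    + Mu g (state g k w) (u k w) *m du k w) i 0) : Past B k -> R).
  by move: mS; congr (measurable_fun _ _); apply/funext => w; rewrite !mxE.
split=> //.
have [_ /(sqintZ L)] := incr_adL2 u_adm u'_adm kN.
apply: sqint_bound; first exact: (past_meas B_rv (ltnW kN) mS).
move=> w; rewrite (le_trans (le_enorm _ _ _))// (le_trans _ (ler_norm _))//.
rewrite /incr mulrDr (le_trans (enormD _ _))//.
have [bx bu] := bd (state g k w) _ (Uu kN w).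
rewrite lerD// (le_trans (enormM _ _))//.
  apply: ler_pM => //; rewrite ?enorm_ge0//.
  exact: (variation_gap B x0 hH1 L_ge0 _ Uu g w (ltnW kN)).
by rewrite ler_wpM2r// enorm_ge0.
Qed.

Let drift_adL2 g k i : (k < N)%N -> adL2 k (fun w => drift_dir g k w i 0).
Proof.
move=> kN; apply: (dir_adL2 (Mx := fun g => cbx c g k) (Mu := fun g => cbu c g k)) => //.
- by move=> i' j; exact: (regular_bx hH3 hH4 kN i' j).
- by move=> i' j; exact: (regular_bu hH3 hH4 kN i' j).
- by move=> x w Uw; have [] := (hH1 kN g).2.2.2 x w Uw.
Qed.

Let noise_adL2 l g k i : (k < N)%N -> adL2 k (fun w => noise_dir l g k w i 0).
Proof.
move=> kN.
apply: (dir_adL2 (Mx := fun g => csx c l g k) (Mu := fun g => csu c l g k)) => //.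
- by move=> i' j; exact: (regular_sx hH3 hH4 kN l i' j).
- by move=> i' j; exact: (regular_su hH3 hH4 kN l i' j).
- by move=> x w Uw; have [_ _ h1 h2] := (hH1 kN g).2.2.2 x w Uw.
Qed.

Let zeta_sq g k i : (k <= N)%N -> sqint P (fun w => zeta g k w i 0).
Proof.
by move=> kN; exact: (ubL2_sqint g (zeta_ubL2 u_adm step i kN)).
Qed.

Lemma ham_u_rint g k : (k < N)%N -> rint P (fun w => (ham_u g k w *m du k w) 0 0).
Proof.
move=> kN; apply: rint_row_mul => i; last by have [] := du_adL2 i kN.
exact: (ubL2_sqint g (ubL2_ham_u u_adm step i kN)).
Qed.

Let cost_dir_rint g k : (k < N)%N -> rint P (cost_dir g k).
Proof.
move=> kN; apply: rintD; apply: rint_row_mul => i.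
- exact: (ubL2_sqint g (ubL2_fx u_adm i kN)).
- by have [] := V_adL2 g i (ltnW kN).
- exact: (ubL2_sqint g (ubL2_fu u_adm i kN)).
- by have [] := du_adL2 i kN.
Qed.

Let paired_rint g k : (k <= N)%N -> rint P (fun w => inner (zeta g k w) (V g k w)).
Proof.
by move=> kN; apply: rint_inner => i; [exact: zeta_sq|have [] := V_adL2 g i kN].
Qed.

Let pairing g k := \int[P]_w inner (zeta g k w) (V g k w).

(** The variation at time k+1 is affine in the noise B(k+1) with F_k-measurable
    coefficients; conditioning on F_k therefore only sees the conditional
    expectations of [zeta] and of [zeta] times the noise, which are the adjoint
    pair. *)
Let pairing_succ g k : (k < N)%N -> pairing g k.+1
  = \int[P]_w (inner (pa g k w) (drift_dir g k w)
      + \sum_l inner (col l (qa g k w)) (noise_dir l g k w)).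
Proof.
move=> kN; have [sp sq] := step kN.
have z2 i : ubL2 P (fun g w => zeta g k.+1 w i 0).
  exact: (zeta_ubL2 u_adm step i kN).
have mB l : measurable_fun setT ((fun w => B k.+1 w l 0) : Noise B k -> R).
  exact: noise_meas_coord.
have one2 : sqint P (fun=> 1 : R) by exact: sqint_cst.
have noise2 l := noise_coord_sqint B_rv p_ge2 B_moment l kN.
have pq := adjoint_ubL2 u_adm step kN.
pose f1 i w : R := drift_dir g k w i 0 * (zeta g k.+1 w i 0 * 1).
pose f2 l i w : R := noise_dir l g k w i 0 * (zeta g k.+1 w i 0 * B k.+1 w l 0).
have f1_int i : rint P (f1 i).
  rewrite /f1; under [X in rint _ X]eq_fun do rewrite mulr1.
  by apply: sqint_mul; [have [] := drift_adL2 g i kN|exact: zeta_sq].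
have f2_int l i : rint P (f2 l i).
  have [_ h2] := adL2_mul_noise B_rv B_indep kN (noise_adL2 l g i kN)
    (mB l) (noise2 l).
  have := sqint_mul h2 (zeta_sq g i kN).
  by congr (rint _ _); apply/funext => w; rewrite /f2 mulrAC mulrA.
have g1_int i : rint P (fun w => drift_dir g k w i 0 * pa g k w i 0).
  apply: sqint_mul; first by have [] := drift_adL2 g i kN.
  exact: (ubL2_sqint g (pq.1 i)).
have g2_int l i : rint P (fun w => noise_dir l g k w i 0 * qa g k w i l).
  apply: sqint_mul; first by have [] := noise_adL2 l g i kN.
  exact: (ubL2_sqint g (pq.2 i l)).
transitivity (\int[P]_w (\sum_i f1 i w + \sum_l \sum_i f2 l i w)).
  apply: eq_Rintegral => w _; rewrite [V _ _ _]/= /dstep innerDr inner_sumr.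
  congr (_ + _); first by apply: eq_bigr => i _; rewrite /f1 mulr1 mulrC.
  apply: eq_bigr => l _; rewrite innerZr mulr_sumr; apply: eq_bigr => i _.
  by rewrite /f2 /noise_dir; ring.
have f2s l : rint P (fun w => \sum_i f2 l i w) by apply: rint_sum => i.
have g2s l : rint P (fun w => \sum_i noise_dir l g k w i 0 * qa g k w i l).
  by apply: rint_sum => i.
transitivity (\int[P]_w (\sum_i drift_dir g k w i 0 * pa g k w i 0
    + \sum_l \sum_i noise_dir l g k w i 0 * qa g k w i l)); last first.
  apply: eq_Rintegral => w _; congr (_ + _).
    by apply: eq_bigr => i _; rewrite mulrC.
  by apply: eq_bigr => l _; rewrite /inner; apply: eq_bigr => i _; rewrite [col _ _ _ _]mxE mulrC.
rewrite RintegralD//; [|by apply: rint_sum|by apply: rint_sum].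
rewrite RintegralD//; [|by apply: rint_sum|by apply: rint_sum].
rewrite !Rintegral_sum//; congr (_ + _); apply: eq_bigr => i _.
  exact: (cexp_pairing g kN (sp i) (measurable_cst _) one2
    (drift_adL2 g i kN) (z2 i)).
rewrite !Rintegral_sum//; apply: eq_bigr => j _.
exact: (cexp_pairing g kN (sq j i) (mB i)
  (noise2 i) (noise_adL2 i g j kN) (z2 j)).
Qed.

Let pairing_step g k : (k < N)%N ->
  pairing g k.+1 + \int[P]_w cost_dir g k w
  = pairing g k + \int[P]_w (ham_u g k w *m du k w) 0 0.
Proof.
move=> kN.
have zE w : zeta g k w = adjoint_Z c B x0 u pa qa g k w by rewrite /zeta ltn_eqF.
have [p2 q2] := adjoint_ubL2 u_adm step kN.
have dual_int : rint P (fun w => inner (pa g k w) (drift_dir g k w)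
    + \sum_l inner (col l (qa g k w)) (noise_dir l g k w)).
  apply: rintD.
    apply: rint_inner => i; first exact: (ubL2_sqint g (p2 i)).
    by have [] := drift_adL2 g i kN.
  apply: rint_sum => l; apply: rint_inner => i; last by have [] := noise_adL2 l g i kN.
  have := ubL2_sqint g (q2 i l).
  by congr (sqint _ _); apply/funext => w; rewrite [RHS]mxE.
rewrite pairing_succ// -(RintegralD measurableT dual_int (cost_dir_rint g kN)).
rewrite /pairing -(RintegralD measurableT (paired_rint g (ltnW kN)) (ham_u_rint g kN)).
by apply: eq_Rintegral => w _; rewrite zE adjoint_transpose.
Qed.

(** [pairing_step] is summed from time 0, where the variation vanishes, to time
    [N], where [zeta] is the gradient of the terminal cost. The right-hand side
    is affine in [u'], which is not visible in [mean_variation], and it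
    localises in time and on events. *)
Lemma mean_variation_duality g : mean_variation u u' g
  = \sum_(k < N) \int[P]_w (ham_u g k w *m du k w) 0 0.
Proof.
have T0 : pairing g 0 = 0.
  rewrite /pairing (_ : (fun w => inner _ _) = fun=> 0).
    by rewrite Rintegral_cst// mul0r.
  by apply/funext => w; rewrite /inner big1// => i _; rewrite mxE mulr0.
have TN : \int[P]_w (cphix c g (state g N w) *m V g N w) 0 0 = pairing g N.
  by apply: eq_Rintegral => w _; rewrite inner_mul /zeta eqxx trmxK.
have phi_int : rint P (fun w => (cphix c g (state g N w) *m V g N w) 0 0).
  have := paired_rint g (leqnn N); congr (rint _ _); apply/funext => w.
  by rewrite inner_mul /zeta eqxx trmxK.
rewrite /mean_variation /cost_variation RintegralD//; last first.
  by apply: rint_sum => k; exact: (cost_dir_rint g (ltn_ord k)).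
rewrite TN Rintegral_sum; last by move=> k; exact: (cost_dir_rint g (ltn_ord k)).
have tele k : (k <= N)%N -> pairing g k + \sum_(j < k) \int[P]_w cost_dir g j w
    = \sum_(j < k) \int[P]_w (ham_u g j w *m du j w) 0 0.
  elim: k => [|k IH] kN; first by rewrite !big_ord0 T0 addr0.
  by rewrite !big_ord_recr/= addrCA (pairing_step g kN) addrA (addrC _ (pairing g k))
    IH// ltnW.
by rewrite -tele// addrC.
Qed.

End Duality.

Section LeastFavourable.
Variable Lam : set (probability (borel Gamma) R).
Hypothesis hH5 : H5 Lam.

Local Notation adm := (admissible P N B q U).

Let avg_cost u : weak_probability Gamma -> R := fun lam =>
  \int[lam]_(g in [set: borel Gamma]) mean_cost u g.
Let avg_variation u u' : weak_probability Gamma -> R := fun lam =>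
  \int[lam]_(g in [set: borel Gamma]) mean_variation u u' g.

Let cost_cont u (u_adm : adm u) : continuous (mean_cost u) :=
  mean_cost_continuous u_adm.
Let cost_bounded u (u_adm : adm u) : exists M : R, forall g, `|mean_cost u g| <= M.
Proof.
by eexists => g; exact: (mean_cost_bound g u_adm).
Qed.
Let variation_cont u u' (u_adm : adm u) (u'_adm : adm u') :
  continuous (mean_variation u u') :=
  mean_variation_continuous u_adm u'_adm.
Let variation_bounded u u' (u_adm : adm u) (u'_adm : adm u') :
  exists M : R, forall g, `|mean_variation u u' g| <= M.
Proof.
by eexists => g; exact: (mean_variation_bound u_adm u'_adm g).
Qed.

Let avg_cost_linear u : adm u -> weak_linear (avg_cost u).
Proof.
move=> u_adm; exists (mean_cost u).
by split; [exact: cost_cont|exact: cost_bounded|].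
Qed.

Let avg_variation_linear u u' : adm u -> adm u' -> weak_linear (avg_variation u u').
Proof.
move=> u_adm u'_adm; exists (mean_variation u u').
by split; [exact: variation_cont|exact: variation_bounded|].
Qed.

Let cost_int u (lam : probability (borel Gamma) R) : adm u ->
  rint lam (mean_cost u : borel Gamma -> R).
Proof.
move=> u_adm; have [M hM] := cost_bounded u_adm.
exact: (bounded_rint lam (continuous_borel_measurable (cost_cont u_adm)) hM).
Qed.

Let variation_int u u' (lam : probability (borel Gamma) R) : adm u -> adm u' ->
  rint lam (mean_variation u u' : borel Gamma -> R).
Proof.
move=> u_adm u'_adm; have [M hM] := variation_bounded u_adm u'_adm.
exact: (bounded_rint lam (continuous_borel_measurable (variation_cont u_adm u'_adm)) hM).
Qed.

Lemma averaged_valueE u (lam : probability (borel Gamma) R) : adm u ->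
  averaged_value P c N B x0 u lam = (avg_cost u lam)%:E.
Proof.
move=> u_adm; rewrite /averaged_value -(RintegralE (cost_int lam u_adm)).
apply: eq_integral => g _; exact: (valueE g u_adm).
Qed.

Let robust_fin u : adm u -> exists r : R, robust_cost P c N B x0 Lam u = r%:E.
Proof.
move=> u_adm; have [[lam0 Llam0] _ _] := hH5; have [M hM] := cost_bounded u_adm.
have hlo : ((avg_cost u lam0)%:E <= robust_cost P c N B x0 Lam u)%E.
  by rewrite -averaged_valueE//; apply: ereal_sup_ubound; exists lam0.
have hhi : (robust_cost P c N B x0 Lam u <= M%:E)%E.
  apply: ge_ereal_sup => _ [lam _ <-]; rewrite averaged_valueE// lee_fin.
  apply: le_trans (ler_norm _) _.
  exact: (bounded_Rintegral lam (continuous_borel_measurable (cost_cont u_adm)) hM).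
exists (fine (robust_cost P c N B x0 Lam u)); rewrite fineK// fin_numElt.
by rewrite (lt_le_trans _ hlo) ?ltNyr// (le_lt_trans hhi)// ltry.
Qed.

Let robust_adherent u (e : R) : adm u -> 0 < e ->
  exists2 lam, Lam lam & forall r : R, (r%:E <= robust_cost P c N B x0 Lam u)%E ->
    r <= avg_cost u lam + e.
Proof.
move=> u_adm e0; have [s sE] := robust_fin u_adm.
have fin : ereal_sup [set averaged_value P c N B x0 u lam | lam in Lam] \is a fin_num.
  by rewrite -/(robust_cost P c N B x0 Lam u) sE.
have [_ [lam Llam <-]] := ub_ereal_sup_adherent e0 fin.
rewrite -/(robust_cost P c N B x0 Lam u) sE averaged_valueE// -EFinB lte_fin => h.
by exists lam => // r; rewrite lee_fin => rs; lra.
Qed.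

Variable ustar : nat -> Omega -> 'cV[R]_m.
Hypothesis ustar_optimal : optimal P c N B x0 q U Lam ustar.

Let ustar_adm : adm ustar. Proof. by case: ustar_optimal. Qed.

(** The perturbed controls are admissible and do not have a smaller robust
    cost, which is the last hypothesis of [danskin]. *)
Let worst_direction u' : adm u' -> exists2 lam, Lam lam &
  (forall lam', Lam lam' -> avg_cost ustar lam' <= avg_cost ustar lam)
  /\ 0 <= avg_variation ustar u' lam.
Proof.
move=> u'_adm; have [_ Lamc _] := hH5.
have [M hM] := variation_bounded ustar_adm u'_adm.
pose t (j : nat) : R := j.+1%:R^-1.
pose ut j := perturbed ustar (fun k w => u' k w - ustar k w) (t j).
have ut_adm j : adm (ut j).
  apply: (perturbed_admissible ustar_adm u'_adm).
  by rewrite /t invr_ge0 ler0n/= invf_le1// ler1n.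
apply: (danskin (Y := fun j => avg_cost (ut j)) (M := M)) => //.
- by apply: weak_linear_continuous; exact: avg_cost_linear.
- by apply: weak_linear_continuous; exact: avg_variation_linear.
- move=> lam _; apply: le_trans (ler_norm _) _.
  exact: (bounded_Rintegral lam
    (continuous_borel_measurable (variation_cont ustar_adm u'_adm)) hM).
- move=> e e0; have [j0 Hj0] := uniform_expansion
    ustar_adm u'_adm e0.
  exists j0 => j jj lam _; rewrite -/(t j).
  have iY := cost_int lam (ut_adm j); have iY0 := cost_int lam ustar_adm.
  have iz := variation_int lam ustar_adm u'_adm.
  have -> : avg_cost (ut j) lam - avg_cost ustar lam - t j * avg_variation ustar u' lam
      = \int[lam]_(g in [set: borel Gamma]) (mean_cost (ut j) g - mean_cost ustar g
          - t j * mean_variation ustar u' g).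
    rewrite (RintegralB measurableT (rintB iY iY0) (rintZ (t j) iz)).
    by rewrite (RintegralB measurableT iY iY0) RintegralZl.
  apply: bounded_Rintegral; last by move=> g; exact: Hj0.
  exact: (rint_meas (rintB (rintB iY iY0) (rintZ (t j) iz))).
- move=> j e e0; have [lam Llam Hlam] := robust_adherent (ut_adm j) e0.
  exists lam => // lam' Llam'; apply: Hlam.
  apply: le_trans (ustar_optimal.2 _ (ut_adm j)).
  by rewrite -averaged_valueE//; apply: ereal_sup_ubound; exists lam'.
Qed.

Variables (pa : Gamma -> nat -> Omega -> 'cV[R]_n).
Variables (qa : Gamma -> nat -> Omega -> 'M[R]_(n, d)).
Hypothesis step : forall k, (k < N)%N -> adjoint_step ustar pa qa k.

Local Notation ham_u := (ham_u ustar pa qa).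

Let variation_affine u1 u2 (t : R) g : adm u1 -> adm u2 -> 0 <= t <= 1 ->
  mean_variation ustar (fun k w => u2 k w + t *: (u1 k w - u2 k w)) g
  = t * mean_variation ustar u1 g + (1 - t) * mean_variation ustar u2 g.
Proof.
move=> u1_adm u2_adm t01.
have u3_adm := perturbed_admissible u2_adm u1_adm t01.
have dual u' (u'_adm : adm u') := mean_variation_duality ustar_adm u'_adm step g.
have int u' (u'_adm : adm u') k (kN : (k < N)%N) := ham_u_rint ustar_adm u'_adm
  step g kN.
rewrite (dual _ u1_adm) (dual _ u2_adm) (dual _ u3_adm) !mulr_sumr -big_split/=.
apply: eq_bigr => k _; have kN := ltn_ord k.
rewrite -(RintegralZl t measurableT (int _ u1_adm k kN)).
rewrite -(RintegralZl (1 - t) measurableT (int _ u2_adm k kN)).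
rewrite -(RintegralD measurableT (rintZ t (int _ u1_adm k kN))
  (rintZ (1 - t) (int _ u2_adm k kN))).
apply: eq_Rintegral => w _.
set h := ham_u g k w; set a1 := u1 k w; set a2 := u2 k w; set a := ustar k w.
have -> : a2 + t *: (a1 - a2) - a = t *: (a1 - a) + (1 - t) *: (a2 - a).
  by apply/matrixP => i j; rewrite !mxE; ring.
by rewrite mulmxDr -!scalemxAr mxE !mxE.
Qed.

(** The measure found in [worst_direction] depends on the competitor. The
    maximisers of the averaged cost of [ustar] form a compact mixable set, and
    the derivatives are affine in the competitor, so [minimax] finds one
    measure for all competitors. *)
Lemma least_favourable : exists2 lam : probability (borel Gamma) R,
  worst_case P c N B x0 Lam ustar lam &
  forall u', adm u' ->
    (0 <= \int[lam]_(g in [set: borel Gamma]) (mean_variation ustar u' g)%:E)%E.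
Proof.
have [_ Lamc Lamx] := hH5.
have [lam0 Llam0 [max0 _]] := worst_direction ustar_adm.
pose K := Lam `&` [set lam | avg_cost ustar lam0 <= avg_cost ustar lam].
have Kc : compact (K : set (weak_probability Gamma)).
  apply: compact_closedI => //; apply: closed_superlevel.
  by apply: weak_linear_continuous; exact: avg_cost_linear.
have Kmix : mixable (@weak_linear _ Gamma) K.
  by apply: mixable_superlevel; [exact: avg_cost_linear|exact: convex_mixable].
have K0 : K !=set0 by exists lam0; split => //=.
have lin u' : adm u' -> weak_linear (avg_variation ustar u').
  by move=> u'_adm; exact: avg_variation_linear.
have mix i1 i2 (t : R) : adm i1 -> adm i2 -> 0 <= t <= 1 -> exists2 i, adm i &
    forall lam, avg_variation ustar i lam
      = t * avg_variation ustar i1 lam + (1 - t) * avg_variation ustar i2 lam.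
  move=> A1 A2 t01; exists (fun k w => i2 k w + t *: (i1 k w - i2 k w)).
    exact: (perturbed_admissible A2 A1 t01).
  move=> lam; have j1 := variation_int lam ustar_adm A1.
  have j2 := variation_int lam ustar_adm A2.
  rewrite /avg_variation -(RintegralZl t measurableT j1) -(RintegralZl (1 - t) measurableT j2).
  rewrite -(RintegralD measurableT (rintZ t j1) (rintZ (1 - t) j2)).
  by apply: eq_Rintegral => g _; rewrite variation_affine.
have feas u' : adm u' -> exists2 lam, K lam & 0 <= avg_variation ustar u' lam.
  move=> u'_adm; have [lam Llam [mlam zlam]] := worst_direction u'_adm.
  exists lam; last exact: zlam.
  by split; [exact: Llam|exact: (mlam _ Llam0)].
have [lam [Llam maxlam] Hlam] := minimax (@weak_linear_continuous _ _)
  Kc K0 Kmix lin mix feas.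
exists lam; last first.
  move=> u' u'_adm; rewrite (RintegralE (variation_int lam ustar_adm u'_adm)) lee_fin.
  exact: Hlam.
split=> //; apply/eqP; rewrite eq_le; apply/andP; split; last first.
  by apply: ereal_sup_ubound; exists lam.
apply: ge_ereal_sup => _ [lam' Llam' <-]; rewrite !averaged_valueE// lee_fin.
exact: le_trans (max0 _ Llam') maxlam.
Qed.

End LeastFavourable.

End Model.

(** * The maximum principle *)

Theorem theorem3p6
  (R : realType) (n m d N : nat) (N_gt0 : (0 < N)%N)
  (dO : measure_display) (Omega : measurableType dO)
  (P : probability Omega R) (P_complete : measure_is_complete P)
  (B : nat -> Omega -> 'cV[R]_d)
  (B_rv : forall k, (0 < k <= N)%N -> random_vector (B k))
  (B_indep : independent_vectors P N B)
  (p : R) (p_ge2 : 2 <= p) (Cp : R)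
  (B_moment : forall k, (0 < k <= N)%N ->
     ('E_P[(fun w => enorm (B k w) `^ p)%R] <= Cp%:E)%E)
  (U : nat -> set 'cV[R]_m)
  (U_nonempty : forall k, (k < N)%N -> U k !=set0)
  (U_convex : forall k, (k < N)%N ->
     convex_set (U k : set (convex_lmodType 'cV[R]_m)))
  (q : R) (q_gt2 : 2 < q)
  (Gamma : pmetricType R) (Gamma_polish : polish R Gamma)
  (Gamma_loc_compact : locally_compact [set: Gamma])
  (Lam : set (probability (borel Gamma) R))
  (c : coefficients R Gamma n m d) (x0 : 'cV[R]_n)
  (L : R) (L_gt0 : 0 < L)
  (v : nat -> 'cV[R]_m) (v_in : forall k, (k < N)%N -> U k (v k))
  (hH1 : H1 c N U L v) (hH2 : H2 c N U L v)
  (* Without this bound the conclusion can fail: phi_gamma(0) unbounded in gamma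
     may leave the supremum defining the cost unattained on a compact Lam. *)
  (phi_bounded_at_0 : forall g, `|cphi c g 0| <= L)
  (hH3 : H3 c N U) (hH4 : H4 c N U) (hH5 : H5 Lam)
  (ustar : nat -> Omega -> 'cV[R]_m)
  (ustar_optimal : optimal P c N B x0 q U Lam ustar) :
  exists lamstar : probability (borel Gamma) R,
    worst_case P c N B x0 Lam ustar lamstar /\
    exists (Pad : Gamma -> nat -> Omega -> 'cV[R]_n)
           (Qad : Gamma -> nat -> Omega -> 'M[R]_(n, d)),
      adjoint_solution P c N B x0 ustar Pad Qad /\
      jointly_measurable N Pad Qad /\
      forall (k : nat) (u : 'cV[R]_m), (k < N)%N -> U k u ->
        let integrand (w : Omega) (g : borel Gamma) : R :=
          inner (hamiltonian_u c g k (state c B x0 ustar g k w) (ustar k w)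
                   (Pad g k w) (Qad g k w))^T
                (u - ustar k w) in
        {ae P, forall w,
           lamstar.-integrable [set: borel Gamma]
             (fun g => (integrand w g)%:E) /\
           (0 <= \int[lamstar]_(g in [set: borel Gamma]) (integrand w g)%:E)%E}.
Proof.
have L_ge0 := ltW L_gt0.
have U_segment k u u' (t : R) : (k < N)%N -> U k u -> U k u' -> 0 <= t <= 1 ->
    U k (u + t *: (u' - u)).
  by move=> kN; exact: (convex_set_segment (U_convex k kN)).
have u_adm : admissible P N B q U ustar by case: ustar_optimal.
have [pa [qa step]] := adjoint_exists B_rv B_indep U_segment Gamma_polish x0
  L_ge0 hH1 hH3 hH4 u_adm.
have [lam worst pos] := least_favourable B_rv B_indep p_ge2 B_moment U_segment
  q_gt2 Gamma_polish L_ge0 v_in hH1 hH2 phi_bounded_at_0 hH3 hH4 hH5 ustar_optimal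
  step.
exists lam; split=> //; exists pa, qa; split.
  exact: (adjoint_solution_of_steps B_rv B_indep p_ge2 B_moment U_segment q_gt2
    Gamma_polish L_ge0 v_in hH1 hH2 hH3 hH4 u_adm step N_gt0).
split.
  move=> k kN; have [mp mq] := adjoint_jmeas step kN.
  by split=> [i|i j]; [exact: (jmeas_joint B_rv (ltnW kN) (mp i))|
    exact: (jmeas_joint B_rv (ltnW kN) (mq i j))].
move=> k a kN Ua /=.
pose h g w : 'cV[R]_m := (ham_u B c x0 ustar pa qa g k w)^T.
have h_meas i : jmeas B k (fun g w => h g w i 0).
  have := jmeas_ham_u U_segment Gamma_polish L_ge0 hH1 hH3 hH4 u_adm step i kN.
  by congr (measurable_fun _ _); apply/funext => z; rewrite /h [RHS]mxE.
have h_ub i : ubL2 P (fun g w => h g w i 0).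
  have := ubL2_ham_u B_rv B_indep p_ge2 B_moment U_segment q_gt2 Gamma_polish
    L_ge0 v_in hH1 hH2 hH3 hH4 u_adm step i kN.
  congr (ubL2 _ _); apply/funext => g; apply/funext => w.
  by rewrite /h [RHS]mxE.
have u_sq i : sqint P (fun w => (a - ustar k w) i 0).
  have [_ e2] := adL2_admissible B_rv q_gt2 u_adm kN.
  have mu := past_meas B_rv (ltnW kN) (adapted_meas i 0 (admissible_adapted u_adm kN)).
  have u2 : sqint P (fun w => ustar k w i 0).
    apply: (sqint_bound mu _ e2) => w.
    exact: (le_trans (le_enorm _ _ _) (ler_norm _)).
  have := sqintD (sqint_cst P (a i 0)) (sqintZ (-1) u2).
  by congr (sqint _ _); apply/funext => w; rewrite !mxE mulN1r.
have [C hC] := ubL2_inner_bound h_ub u_sq.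
have F_meas : jmeas B k (fun g w => inner (h g w) (a - ustar k w)).
  apply: jmeas_sum => i; apply: (jmeasM (h_meas i)); apply: jmeas_past.
  have mu := adapted_meas i 0 (admissible_adapted u_adm kN).
  have := measurable_funB (measurable_cst (a i 0)) mu.
  by congr (measurable_fun _ _); apply/funext => w; rewrite !mxE.
apply: (ae_nonneg_average (pi := (id : Omega -> Past B k))
  (F := fun (g : borel Gamma) (w : Past B k) => inner (h g w) (a - ustar k w))
  (measurable_past_id B_rv (ltnW kN)) F_meas hC).
move=> A mA; have spike_adm := spike_admissible B_rv u_adm kN mA Ua.
have := pos _ spike_adm; congr (_ <= _)%E; apply: eq_integral => g _.
have dual_int := ham_u_rint B_rv B_indep p_ge2 B_moment U_segment q_gt2 Gamma_polish
  L_ge0 v_in hH1 hH2 hH3 hH4 u_adm spike_adm step g kN.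
rewrite (mean_variation_duality B_rv B_indep p_ge2 B_moment U_segment q_gt2
  Gamma_polish L_ge0 v_in hH1 hH2 hH3 hH4 u_adm spike_adm step).
rewrite (bigD1 (Ordinal kN))//= big1 ?addr0; last first.
  move=> j /eqP jk; have jk' : (j == k :> nat) = false.
    by apply/eqP => jk'; apply: jk; exact: val_inj.
  rewrite (_ : (fun w => _) = fun=> 0) ?Rintegral_cst ?mul0r//.
  by apply/funext => w; rewrite /spike jk' addr0 subrr mulmx0 mxE.
rewrite -(RintegralE dual_int); apply: eq_integral => w _; congr (_%:E).
rewrite /spike eqxx (addrC (ustar k w)) addrK -scalemxAr mxE.
by rewrite inner_mul /h trmxK.
Qed.
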